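(* Given a set of $n$ trajectories in $\mathbb{R}^1$, each piecewise linear with vertices at times $t_0,\dots,t_\tau$, a central trajectory for $\varepsilon=0$ can be computed in $O(\tau n^2\log n)$ time using $O(\tau n^2)$ space.
   Context: Setting: $\mathcal{X}$ is a set of $n$ entities moving in $\mathbb{R}^1$ along piecewise-linear trajectories with vertices at the common times $t_0<\dots<t_\tau$, in general position (no three trajectories pass through the same point at the same time). With $\varepsilon=0$, a trajectoid is a function $\mathcal{T}:[t_0,t_\tau]\to\mathcal{X}$ that may switch from $\sigma$ to $\psi$ at time $t$ only if $\sigma(t)=\psi(t)$. $D(\sigma,t)=\max_{\psi\in\mathcal{X}}|\sigma(t)-\psi(t)|$. A central trajectory is a trajectoid minimizing $\int_{t_0}^{t_\tau}D(\mathcal{T}(t),t)\,dt$. Computation model: real RAM. *)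

(* Defs.v *)
From Stdlib Require Import Reals ZArith List Lia.
From Coquelicot Require Import Coquelicot.
Open Scope R_scope.

(* Trajectories.  Entities are 0..n-1.  Vertex times ts 0 < ... < ts tau;
   ps s k is the position of entity s at time ts k.                     *)

(* piecewise-linear interpolation of the values ps 0..ps m at times ts 0..ts m
   (for t in [ts 0, ts m]; values outside that interval are irrelevant) *)
Fixpoint pl (ts ps : nat -> R) (m : nat) (t : R) : R :=
  match m with
  | O => ps O
  | S m' => if Rlt_dec t (ts m') then pl ts ps m' t
            else ps m' + (ps m - ps m') * (t - ts m') / (ts m - ts m')
  end.

Definition traj (tau : nat) (ts : nat -> R) (ps : nat -> nat -> R) (s : nat) (t : R) : R :=
  pl ts (ps s) tau t.

Definition Dist (n tau : nat) ts ps (s : nat) (t : R) : R :=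
  fold_right Rmax 0 (map (fun q => Rabs (traj tau ts ps s t - traj tau ts ps q t)) (seq 0 n)).

Definition valid_input (n tau : nat) (ts : nat -> R) (ps : nat -> nat -> R) : Prop :=
  (1 <= n)%nat /\ (1 <= tau)%nat /\
  (forall k, (k < tau)%nat -> ts k < ts (S k)) /\
  (forall a b c t, (a < n)%nat -> (b < n)%nat -> (c < n)%nat ->
     a <> b -> b <> c -> a <> c -> ts O <= t <= ts tau ->
     ~ (traj tau ts ps a t = traj tau ts ps b t /\ traj tau ts ps b t = traj tau ts ps c t)).

(* Trajectoid (epsilon = 0): T maps [t0,t_tau] to entities; around every time
   t it is constant just before t (value a) and just after t (value b), and a
   switch can only happen between entities at the same position at time t. *)
Definition trajectoid (n tau : nat) ts ps (T : R -> nat) : Prop :=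
  (forall t, ts O <= t <= ts tau -> (T t < n)%nat) /\
  (forall t, ts O <= t <= ts tau ->
     exists delta, 0 < delta /\ exists a b : nat,
       (forall s, t - delta < s < t -> ts O <= s -> T s = a) /\
       (forall s, t < s < t + delta -> s <= ts tau -> T s = b) /\
       traj tau ts ps a t = traj tau ts ps (T t) t /\
       traj tau ts ps b t = traj tau ts ps (T t) t).

Definition cost (n tau : nat) ts ps (T : R -> nat) : R :=
  RInt (fun t => Dist n tau ts ps (T t) t) (ts O) (ts tau).

Definition central (n tau : nat) ts ps (T : R -> nat) : Prop :=
  trajectoid n tau ts ps T /\
  forall T', trajectoid n tau ts ps T' -> cost n tau ts ps T <= cost n tau ts ps T'.

(* Real RAM: memory cells hold reals; unit-cost arithmetic, comparison,
   and indirect addressing through cells holding natural numbers.      *)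

Inductive instr : Type :=
| IConst (d : nat) (c : Z)
| IAdd (d a b : nat)
| ISub (d a b : nat)
| IMul (d a b : nat)
| IDiv (d a b : nat)
| ILoad (d a : nat)
| IStore (a s : nat)
| IJle (a b l : nat)
| IHalt.

Definition state : Type := (nat * (nat -> R))%type.

Definition upd (m : nat -> R) (a : nat) (v : R) : nat -> R :=
  fun x => if Nat.eqb x a then v else m x.

Inductive step (sp : nat) (p : list instr) : state -> state -> Prop :=
| st_const pc m d c : nth_error p pc = Some (IConst d c) -> (d < sp)%nat ->
    step sp p (pc, m) (S pc, upd m d (IZR c))
| st_add pc m d a b : nth_error p pc = Some (IAdd d a b) -> (d < sp)%nat -> (a < sp)%nat -> (b < sp)%nat ->
    step sp p (pc, m) (S pc, upd m d (m a + m b))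
| st_sub pc m d a b : nth_error p pc = Some (ISub d a b) -> (d < sp)%nat -> (a < sp)%nat -> (b < sp)%nat ->
    step sp p (pc, m) (S pc, upd m d (m a - m b))
| st_mul pc m d a b : nth_error p pc = Some (IMul d a b) -> (d < sp)%nat -> (a < sp)%nat -> (b < sp)%nat ->
    step sp p (pc, m) (S pc, upd m d (m a * m b))
| st_div pc m d a b : nth_error p pc = Some (IDiv d a b) -> (d < sp)%nat -> (a < sp)%nat -> (b < sp)%nat ->
    m b <> 0 -> step sp p (pc, m) (S pc, upd m d (m a / m b))
| st_load pc m d a k : nth_error p pc = Some (ILoad d a) -> (d < sp)%nat -> (a < sp)%nat -> (k < sp)%nat ->
    m a = INR k -> step sp p (pc, m) (S pc, upd m d (m k))
| st_store pc m a s k : nth_error p pc = Some (IStore a s) -> (a < sp)%nat -> (s < sp)%nat -> (k < sp)%nat ->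
    m a = INR k -> step sp p (pc, m) (S pc, upd m k (m s))
| st_jle_t pc m a b l : nth_error p pc = Some (IJle a b l) -> (a < sp)%nat -> (b < sp)%nat ->
    m a <= m b -> step sp p (pc, m) (l, m)
| st_jle_f pc m a b l : nth_error p pc = Some (IJle a b l) -> (a < sp)%nat -> (b < sp)%nat ->
    m b < m a -> step sp p (pc, m) (S pc, m).

Inductive run (sp : nat) (p : list instr) : nat -> state -> state -> Prop :=
| run0 s : run sp p O s s
| runS k s s' s'' : step sp p s s' -> run sp p k s' s'' -> run sp p (S k) s s''.

(* Input encoding: M[0]=n, M[1]=tau, M[2+k]=t_k (k<=tau),
   M[3+tau+s*(tau+1)+k] = position of entity s at t_k; all other cells 0. *)
Definition init_mem (n tau : nat) (ts : nat -> R) (ps : nat -> nat -> R) : nat -> R :=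
  fun x =>
    if Nat.eqb x 0 then INR n
    else if Nat.eqb x 1 then INR tau
    else if Nat.ltb x (3 + tau) then ts (x - 2)%nat
    else if Nat.ltb x (3 + tau + n * (tau + 1)) then
      ps ((x - (3 + tau)) / (tau + 1))%nat ((x - (3 + tau)) mod (tau + 1))%nat
    else 0.

(* Output encoding: m pieces; piece i is entity es i up to end time rs i.
   The decoded trajectoid takes at time t the entity of the first piece i
   with t < rs i (the last piece if there is none). *)
Fixpoint first_piece (rs : nat -> R) (fuel i : nat) (t : R) : nat :=
  match fuel with
  | O => i
  | S f => if Rlt_dec t (rs i) then i else first_piece rs f (S i) t
  end.

Definition decode (m : nat) (es : nat -> nat) (rs : nat -> R) : R -> nat :=
  fun t => es (first_piece rs (m - 1) 0 t).

Definition output_central (n tau : nat) ts ps (M : nat -> R) : Prop :=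
  exists (m : nat) (es : nat -> nat) (rs : nat -> R),
    M O = INR m /\ (1 <= m)%nat /\
    (forall i, (i < m)%nat -> M (1 + 2 * i)%nat = INR (es i) /\ M (2 + 2 * i)%nat = rs i) /\
    central n tau ts ps (decode m es rs).

(* Main.v *)
Require Import Defs.
From Stdlib Require Import Reals ZArith List Lia Lra Arith.
From Coquelicot Require Import Coquelicot.
Import ListNotations.
Open Scope R_scope.

(** Between two consecutive vertex times the trajectories are lines, so they
    meet at most [n^2] times.  These meetings are sorted and swept in temporal
    order; for every entity [s] the sweep maintains the least cost [Phi s t] of
    following a trajectoid that ends on [s], and at a meeting of [i] and [j] it
    switches from [i] to [j] if that is cheaper.  The distance is
    [D s = ((U - L) + |U + L - 2 s|) / 2] with [U], [L] the upper and lower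
    envelopes, so its integral over a time span on which [U] and [L] are fixed
    lines is a closed formula.  Costs are therefore kept lazily and all brought
    up to date only when [U] or [L] moves to another line; the slope of [U]
    then increases and that of [L] decreases, so this happens at most [2 n]
    times per slab and costs [O(n^2)] in total.

    Optimality needs only three properties of [Phi]: entities at the same
    position have the same value, staying on [s] from [a] to [b] costs at least
    [Phi s b - Phi s a], and [Phi] is at most 0 at the start.  Hence the cost
    of a trajectoid minus [Phi] along it is locally nondecreasing, thus
    nondecreasing, and every trajectoid costs at least the final value, which
    the logged switches attain. *)

(** * A structured language and its compilation to the real RAM *)

(** The delicate invariant is that entities at the same position have the same value: a logged
    switch lowers the value of one entity, and any further entity at that point would keep a larger
    one. General position leaves only the two entities of the event there, so one relaxation in each
    direction restores the invariant; this is why events are ordered pairs. Lines that coincide on a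
    slab meet at all of its times but need this only once, at its start.

    A trajectoid comes with local data only, without a finite list of switches. The lower bound is
    therefore proved by continuous induction on time, carrying integrability along.

    On the machine side one fixed program serves all inputs, and the input leaves no low cell free
    for a register. The block size [B = 128 * tau * n^2] can be computed from [n] and [tau] in place
    and permits recovering both by exact division. Seventeen blocks of this size hold everything,
    and step counts are kept exact through compilation, so the asymptotic bounds reduce to
    arithmetic with explicit constants. *)

Record st := St {
  nv : nat -> nat;
  rv : nat -> R;
  na : nat -> nat -> nat;
  ra : nat -> nat -> R }.

(** Naturals and reals are separate sorts because the machine addresses only through cells holding
    some [INR k]; an address computed by an [nexp] has that form by construction. *)
Inductive nexp :=
| NVar (x : nat) | NCst (c : nat) | NAdd (a b : nexp) | NSub (a b : nexp)
| NMul (a b : nexp) | NGet (a : nat) (e : nexp).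

Inductive rexp :=
| RVar (x : nat) | RCst (z : Z) | RAdd (a b : rexp) | RSub (a b : rexp)
| RMul (a b : rexp) | RDiv (a b : rexp) | RGet (a : nat) (e : nexp)
| RNat (e : nexp).

Inductive cond := NLe (a b : nexp) | RLe (a b : rexp).

(* [Until b c] tests [b] first and runs [c] as long as [b] is false. *)
Inductive cmd :=
| Skip
| NAsn (x : nat) (e : nexp)
| RAsn (x : nat) (e : rexp)
| NSet (a : nat) (i e : nexp)
| RSet (a : nat) (i : nexp) (e : rexp)
| Seq (c d : cmd)
| If (b : cond) (c d : cmd)
| Until (b : cond) (c : cmd).

(* Cell 0 holds the array size B; variables sit in cells 1..2*NV, temporaries
   above them up to KR.  Real array a starts at a*B, nat array a at (RS+a)*B;
   real array 0 is the low memory itself, usable from index KR on. *)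
Definition NV : nat := 24.
Definition T0 : nat := 49.
Definition KR : nat := 64.
Definition RS : nat := 10.
Definition NS : nat := 7.
Definition cn (x : nat) : nat := 1 + 2 * x.
Definition cr (x : nat) : nat := 2 + 2 * x.

Definition setn (s : st) (x v : nat) : st :=
  St (fun y => if Nat.eqb y x then v else nv s y) (rv s) (na s) (ra s).
Definition setr (s : st) (x : nat) (v : R) : st :=
  St (nv s) (fun y => if Nat.eqb y x then v else rv s y) (na s) (ra s).
Definition setna (s : st) (a i v : nat) : st :=
  St (nv s) (rv s)
    (fun b j => if Nat.eqb b a then if Nat.eqb j i then v else na s b j else na s b j)
    (ra s).
Definition setra (s : st) (a i : nat) (v : R) : st :=
  St (nv s) (rv s) (na s)
    (fun b j => if Nat.eqb b a then if Nat.eqb j i then v else ra s b j else ra s b j).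

Fixpoint evN (s : st) (e : nexp) : nat :=
  match e with
  | NVar x => nv s x
  | NCst c => c
  | NAdd a b => evN s a + evN s b
  | NSub a b => evN s a - evN s b
  | NMul a b => evN s a * evN s b
  | NGet a e => na s a (evN s e)
  end.

Fixpoint evR (s : st) (e : rexp) : R :=
  match e with
  | RVar x => rv s x
  | RCst z => IZR z
  | RAdd a b => evR s a + evR s b
  | RSub a b => evR s a - evR s b
  | RMul a b => evR s a * evR s b
  | RDiv a b => evR s a / evR s b
  | RGet a e => ra s a (evN s e)
  | RNat e => INR (evN s e)
  end.

(** Side conditions under which the compiled code agrees with [evN]: real subtraction is not
    truncated, and an index out of range would land in another array. *)
Fixpoint dfN (B : nat) (s : st) (e : nexp) : Prop :=
  match e with
  | NVar _ | NCst _ => True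
  | NAdd a b | NMul a b => dfN B s a /\ dfN B s b
  | NSub a b => dfN B s a /\ dfN B s b /\ (evN s b <= evN s a)%nat
  | NGet a e => dfN B s e /\ (evN s e < B)%nat
  end.

Definition rix (B a i : nat) : Prop := (i < B)%nat /\ (a = 0%nat -> (KR <= i)%nat).

Fixpoint dfR (B : nat) (s : st) (e : rexp) : Prop :=
  match e with
  | RVar _ | RCst _ => True
  | RAdd a b | RSub a b | RMul a b => dfR B s a /\ dfR B s b
  | RDiv a b => dfR B s a /\ dfR B s b /\ evR s b <> 0
  | RGet a e => dfN B s e /\ rix B a (evN s e)
  | RNat e => dfN B s e
  end.

Definition holds (s : st) (b : cond) : Prop :=
  match b with
  | NLe a b => (evN s a <= evN s b)%nat
  | RLe a b => evR s a <= evR s b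
  end.

Definition dfC (B : nat) (s : st) (b : cond) : Prop :=
  match b with
  | NLe a b => dfN B s a /\ dfN B s b
  | RLe a b => dfR B s a /\ dfR B s b
  end.

(** Stack discipline: the value lands in cell [t] and nothing below [t] is written, so a first
    operand survives the evaluation of the second. Copying a variable is adding it to 0, as the
    machine has no move instruction. *)
Fixpoint cN (e : nexp) (t : nat) : list instr :=
  match e with
  | NVar x => [IConst t 0; IAdd t t (cn x)]
  | NCst c => [IConst t (Z.of_nat c)]
  | NAdd a b => cN a t ++ cN b (S t) ++ [IAdd t t (S t)]
  | NSub a b => cN a t ++ cN b (S t) ++ [ISub t t (S t)]
  | NMul a b => cN a t ++ cN b (S t) ++ [IMul t t (S t)]
  | NGet a e => cN e t ++ [IConst (S t) (Z.of_nat (RS + a)); IMul (S t) (S t) 0;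
                           IAdd t t (S t); ILoad t t]
  end.

Fixpoint cR (e : rexp) (t : nat) : list instr :=
  match e with
  | RVar x => [IConst t 0; IAdd t t (cr x)]
  | RCst z => [IConst t z]
  | RAdd a b => cR a t ++ cR b (S t) ++ [IAdd t t (S t)]
  | RSub a b => cR a t ++ cR b (S t) ++ [ISub t t (S t)]
  | RMul a b => cR a t ++ cR b (S t) ++ [IMul t t (S t)]
  | RDiv a b => cR a t ++ cR b (S t) ++ [IDiv t t (S t)]
  | RGet a e => cN e t ++ [IConst (S t) (Z.of_nat a); IMul (S t) (S t) 0;
                           IAdd t t (S t); ILoad t t]
  | RNat e => cN e t
  end.

Definition cC (b : cond) : list instr :=
  match b with
  | NLe a b => cN a T0 ++ cN b (S T0)
  | RLe a b => cR a T0 ++ cR b (S T0)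
  end.

Definition cstore (slot : nat) : list instr :=
  [IConst (S (S T0)) (Z.of_nat slot); IMul (S (S T0)) (S (S T0)) 0;
   IAdd T0 T0 (S (S T0)); IStore T0 (S T0)].

(** Jump targets are absolute, hence the argument [pc]. The conditional jump is taken when the test
    holds, so the else branch is laid out first; [IJle 0 0] serves as an unconditional jump. *)
Fixpoint compile (c : cmd) (pc : nat) : list instr :=
  match c with
  | Skip => []
  | NAsn x e => cN e T0 ++ [IConst (S T0) 0; IAdd (cn x) T0 (S T0)]
  | RAsn x e => cR e T0 ++ [IConst (S T0) 0; IAdd (cr x) T0 (S T0)]
  | NSet a i e => cN i T0 ++ cN e (S T0) ++ cstore (RS + a)
  | RSet a i e => cN i T0 ++ cR e (S T0) ++ cstore a
  | Seq c d => compile c pc ++ compile d (pc + length (compile c pc))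
  | If b c d =>
      let q := cC b in
      let l1 := (pc + length q + 1)%nat in
      let dd := compile d l1 in
      let l2 := (l1 + length dd + 1)%nat in
      let cc := compile c l2 in
      q ++ [IJle T0 (S T0) l2] ++ dd ++ [IJle 0 0 (l2 + length cc)] ++ cc
  | Until b c =>
      let q := cC b in
      let l1 := (pc + length q + 1)%nat in
      let cc := compile c l1 in
      q ++ [IJle T0 (S T0) (l1 + length cc + 1)] ++ cc ++ [IJle 0 0 pc]
  end.

Fixpoint wfN (e : nexp) (t : nat) : bool :=
  match e with
  | NVar x => Nat.ltb x NV && Nat.ltb t KR
  | NCst _ => Nat.ltb t KR
  | NAdd a b | NSub a b | NMul a b => wfN a t && wfN b (S t) && Nat.ltb (S t) KR
  | NGet a e => wfN e t && Nat.ltb a NS && Nat.ltb (S t) KR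
  end.

Fixpoint wfR (e : rexp) (t : nat) : bool :=
  match e with
  | RVar x => Nat.ltb x NV && Nat.ltb t KR
  | RCst _ => Nat.ltb t KR
  | RAdd a b | RSub a b | RMul a b | RDiv a b => wfR a t && wfR b (S t) && Nat.ltb (S t) KR
  | RGet a e => wfN e t && Nat.ltb a RS && Nat.ltb (S t) KR
  | RNat e => wfN e t
  end.

Definition wfC (b : cond) : bool :=
  match b with
  | NLe a b => wfN a T0 && wfN b (S T0)
  | RLe a b => wfR a T0 && wfR b (S T0)
  end.

Fixpoint wf (c : cmd) : bool :=
  match c with
  | Skip => true
  | NAsn x e => wfN e T0 && Nat.ltb x NV
  | RAsn x e => wfR e T0 && Nat.ltb x NV
  | NSet a i e => wfN i T0 && wfN e (S T0) && Nat.ltb a NS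
  | RSet a i e => wfN i T0 && wfR e (S T0) && Nat.ltb a RS
  | Seq c d => wf c && wf d
  | If b c d => wfC b && wf c && wf d
  | Until b c => wfC b && wf c
  end.

(** Expression code is straight-line, so its length is its running time; the length does not depend
    on the target cell, and 0 is an arbitrary choice. *)
Definition costN (e : nexp) : nat := length (cN e 0).
Definition costR (e : rexp) : nat := length (cR e 0).
Definition costC (b : cond) : nat := length (cC b).

(** Costs are exact instruction counts. A false test pays 2 instead of 1, because the else branch or
    the loop body ends with an extra jump. *)
Inductive exec (B : nat) : cmd -> st -> nat -> st -> Prop :=
| ex_skip s : exec B Skip s 0 s
| ex_nasn s x e : dfN B s e -> exec B (NAsn x e) s (costN e + 2) (setn s x (evN s e))
| ex_rasn s x e : dfR B s e -> exec B (RAsn x e) s (costR e + 2) (setr s x (evR s e))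
| ex_nset s a i e : dfN B s i -> dfN B s e -> (evN s i < B)%nat ->
    exec B (NSet a i e) s (costN i + costN e + 4) (setna s a (evN s i) (evN s e))
| ex_rset s a i e : dfN B s i -> dfR B s e -> rix B a (evN s i) ->
    exec B (RSet a i e) s (costN i + costR e + 4) (setra s a (evN s i) (evR s e))
| ex_seq s c d k1 s1 k2 s2 : exec B c s k1 s1 -> exec B d s1 k2 s2 ->
    exec B (Seq c d) s (k1 + k2) s2
| ex_if_t s b c d k s1 : dfC B s b -> holds s b -> exec B c s k s1 ->
    exec B (If b c d) s (costC b + 1 + k) s1
| ex_if_f s b c d k s1 : dfC B s b -> ~ holds s b -> exec B d s k s1 ->
    exec B (If b c d) s (costC b + 2 + k) s1
| ex_until_t s b c : dfC B s b -> holds s b -> exec B (Until b c) s (costC b + 1) s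
| ex_until_f s b c k1 s1 k2 s2 : dfC B s b -> ~ holds s b -> exec B c s k1 s1 ->
    exec B (Until b c) s1 k2 s2 ->
    exec B (Until b c) s (costC b + 2 + k1 + k2) s2.

Lemma length_cN e t t' : length (cN e t) = length (cN e t').
Proof.
  revert t t'; induction e; intros t t'; simpl; rewrite ?length_app; auto; simpl.
  all: rewrite ?(IHe1 t t'), ?(IHe2 (S t) (S t')), ?(IHe t t'); reflexivity.
Qed.

Lemma length_cR e t t' : length (cR e t) = length (cR e t').
Proof.
  revert t t'; induction e; intros t t'; simpl; rewrite ?length_app; auto; simpl.
  all: rewrite ?(IHe1 t t'), ?(IHe2 (S t) (S t')), ?(length_cN e t t'); auto using length_cN.
Qed.

Definition code_at (p : list instr) (pc : nat) (c : list instr) : Prop :=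
  exists l r, p = l ++ c ++ r /\ length l = pc.

Lemma code_at_app p pc c d :
  code_at p pc (c ++ d) -> code_at p pc c /\ code_at p (pc + length c) d.
Proof.
  intros (l & r & -> & <-); split.
  - exists l, (d ++ r); now rewrite <- app_assoc.
  - exists (l ++ c), r; rewrite length_app, <- !app_assoc; auto.
Qed.

Lemma code_at_cons p pc i c :
  code_at p pc (i :: c) -> nth_error p pc = Some i /\ code_at p (S pc) c.
Proof.
  intros (l & r & -> & <-); split.
  - rewrite nth_error_app2 by lia. now rewrite Nat.sub_diag.
  - exists (l ++ [i]), r; rewrite length_app; simpl; rewrite <- app_assoc; split; auto; lia.
Qed.

Tactic Notation "next" hyp(C) ident(I) := apply code_at_cons in C; destruct C as [I C].
Tactic Notation "chop" hyp(C) ident(D) := apply code_at_app in C; destruct C as [D C].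

Lemma run_app sp p k1 k2 s1 s2 s3 :
  run sp p k1 s1 s2 -> run sp p k2 s2 s3 -> run sp p (k1 + k2) s1 s3.
Proof. induction 1; simpl; auto; intros; econstructor; eauto. Qed.

Lemma run_one sp p s1 s2 : step sp p s1 s2 -> run sp p 1 s1 s2.
Proof. intros; econstructor; eauto; constructor. Qed.

Lemma upd_same m a v : upd m a v a = v.
Proof. unfold upd; now rewrite Nat.eqb_refl. Qed.

Lemma upd_other m a v x : x <> a -> upd m a v x = m x.
Proof. unfold upd; intros; destruct (Nat.eqb_spec x a); congruence. Qed.

Lemma slot_inj B a i a' i' : (i < B)%nat -> (i' < B)%nat ->
  (a * B + i = a' * B + i')%nat -> a = a' /\ i = i'.
Proof.
  intros. assert (a = a') by nia. subst; split; [auto | lia].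
Qed.

Lemma slot_ge B a i : (1 <= a)%nat -> (B <= a * B + i)%nat.
Proof. nia. Qed.

Record rel (B : nat) (s : st) (m : nat -> R) : Prop := {
  rel_B : m 0%nat = INR B;
  rel_n : forall x, (x < NV)%nat -> m (cn x) = INR (nv s x);
  rel_r : forall x, (x < NV)%nat -> m (cr x) = rv s x;
  rel_ra : forall a i, (a < RS)%nat -> rix B a i -> m (a * B + i)%nat = ra s a i;
  rel_na : forall a i, (a < NS)%nat -> (i < B)%nat -> m ((RS + a) * B + i)%nat = INR (na s a i) }.

(** Cells from [t] up to [KR] are scratch space, the only ones that an expression evaluated at [t]
    may change. *)
Definition same (t : nat) (m m' : nat -> R) : Prop :=
  forall x, (x < t \/ KR <= x)%nat -> m' x = m x.

Lemma same_trans t t' m m' m'' : (t <= t')%nat -> same t m m' -> same t' m' m'' -> same t m m''.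
Proof. unfold same; intros H A C x Hx. rewrite C by lia. apply A; lia. Qed.

Lemma rel_same B s m m' : (KR <= B)%nat -> rel B s m -> same T0 m m' -> rel B s m'.
Proof.
  intros HB [h0 h1 h2 h3 h4] H; unfold same in H; constructor; intros.
  - rewrite H; auto. unfold T0; lia.
  - rewrite H; auto. unfold T0, cn, NV in *; lia.
  - rewrite H; auto. unfold T0, cr, NV in *; lia.
  - rewrite H; auto. right. destruct H1 as [H1 H2].
    destruct a; [specialize (H2 eq_refl); lia | nia].
  - rewrite H; auto. right; unfold RS; nia.
Qed.

(** * Correctness of the compilation, with exact step counts *)

Section Compile.
Variables (B : nat) (HB : (KR <= B)%nat) (p : list instr).
Let sp : nat := ((RS + NS) * B)%nat.

Ltac bsplit := repeat match goal with
  | H : andb _ _ = true |- _ => apply andb_prop in H; destruct H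
  | H : Nat.ltb _ _ = true |- _ => apply Nat.ltb_lt in H
  end.

Local Lemma small_sp x : (x < KR)%nat -> (x < sp)%nat.
Proof using HB. unfold sp, RS, NS; nia. Qed.

Ltac bnd := first [assumption | apply small_sp; unfold T0, KR, NV, cn, cr in *; lia].

Local Lemma load_slot pc m t k a :
  code_at p pc [IConst (S t) (Z.of_nat a); IMul (S t) (S t) 0; IAdd t t (S t); ILoad t t] ->
  (T0 <= t)%nat -> (S t < KR)%nat -> m 0%nat = INR B -> m t = INR k ->
  (a * B + k < sp)%nat -> (KR <= a * B + k)%nat ->
  exists m', run sp p 4 (pc, m) (pc + 4, m')%nat /\ m' t = m (a * B + k)%nat /\ same t m m'.
Proof.
  intros C Ht Hk h0 ht Hs Hlo.
  next C I1. next C I2. next C I3. next C I4.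
  set (m1 := upd m (S t) (IZR (Z.of_nat a))).
  set (m2 := upd m1 (S t) (m1 (S t) * m1 0%nat)).
  set (m3 := upd m2 t (m2 t + m2 (S t))).
  assert (E3 : m3 t = INR (a * B + k)).
  { unfold m3; rewrite upd_same. unfold m2; rewrite upd_same, upd_other by lia.
    unfold m1; rewrite upd_same, !upd_other by (unfold T0 in *; lia).
    rewrite h0, ht, plus_INR, mult_INR, (INR_IZR_INZ a). ring. }
  assert (E4 : m3 (a * B + k)%nat = m (a * B + k)%nat).
  { unfold m3, m2, m1; rewrite !upd_other by (unfold T0, KR in *; lia); auto. }
  exists (upd m3 t (m3 (a * B + k)%nat)); split; [|split].
  - replace (pc + 4)%nat with (S (S (S (S pc)))) by lia.
    econstructor; [eapply st_const; eauto; bnd|]. fold m1.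
    econstructor; [eapply st_mul; eauto; bnd|]. fold m2.
    econstructor; [eapply st_add; eauto; bnd|]. fold m3.
    apply run_one. eapply st_load; eauto; bnd.
  - rewrite upd_same; auto.
  - intros x Hx. unfold m3, m2, m1. rewrite !upd_other by (unfold T0, KR in *; lia); auto.
Qed.

Local Lemma var_copy pc m t x : code_at p pc [IConst t 0; IAdd t t x] ->
  (x < t)%nat -> (t < KR)%nat ->
  exists m', run sp p 2 (pc, m) (pc + 2, m')%nat /\ m' t = m x /\ same t m m'.
Proof.
  intros C Hx Ht.
  next C I1. next C I2.
  eexists; split; [|split].
  - replace (pc + 2)%nat with (S (S pc)) by lia.
    econstructor; [eapply st_const; eauto; bnd|].
    apply run_one; eapply st_add; eauto; bnd.
  - rewrite upd_same, upd_same, upd_other by lia. ring.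
  - intros y Hy; rewrite !upd_other by lia; auto.
Qed.

Local Lemma const_step pc m t z : code_at p pc [IConst t z] -> (t < KR)%nat ->
  exists m', run sp p 1 (pc, m) (pc + 1, m')%nat /\ m' t = IZR z /\ same t m m'.
Proof.
  intros C Ht; next C I1.
  exists (upd m t (IZR z)); split; [|split].
  - rewrite Nat.add_1_r; apply run_one, st_const; auto; bnd.
  - apply upd_same.
  - intros x Hx; apply upd_other; lia.
Qed.

Definition evals (code : list instr) (t : nat) (v : R) (s : st) : Prop :=
  forall pc m, code_at p pc code -> rel B s m ->
  exists m', run sp p (length code) (pc, m) (pc + length code, m')%nat /\ m' t = v /\ same t m m'.

Local Lemma evals_op ca cb i t va vb (f : R -> R -> R) s :
  evals ca t va s -> evals cb (S t) vb s -> (T0 <= t)%nat -> (S t < KR)%nat ->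
  (forall q m, nth_error p q = Some i -> (t < sp)%nat -> (S t < sp)%nat -> m (S t) = vb ->
     step sp p (q, m) (S q, upd m t (f (m t) (m (S t))))) ->
  evals (ca ++ cb ++ [i]) t (f va vb) s.
Proof.
  intros Ha Hb Ht Hk H pc m C R.
  chop C C1.
  chop C C2.
  destruct (Ha _ _ C1 R) as (m1 & R1 & E1 & S1).
  assert (R' : rel B s m1) by (eapply rel_same; eauto; intros x Hx; apply S1; lia).
  destruct (Hb _ _ C2 R') as (m2 & R2 & E2 & S2).
  next C I.
  exists (upd m2 t (f (m2 t) (m2 (S t)))); split; [|split].
  - rewrite !length_app, !Nat.add_assoc; simpl.
    eapply run_app; [eapply run_app; eauto|].
    rewrite Nat.add_1_r; apply run_one, H; auto; bnd.
  - rewrite upd_same, E2, S2, E1 by lia; auto.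
  - intros x Hx; rewrite upd_other, S2, S1 by lia; auto.
Qed.

Local Lemma evals_load ce t k a s v :
  evals ce t (INR k) s -> (T0 <= t)%nat -> (S t < KR)%nat ->
  (a < RS + NS)%nat -> rix B a k -> (forall m, rel B s m -> m (a * B + k)%nat = v) ->
  evals (ce ++ [IConst (S t) (Z.of_nat a); IMul (S t) (S t) 0; IAdd t t (S t); ILoad t t]) t v s.
Proof.
  intros He Ht Hk Ha [Hi Hlo] Hv pc m C R.
  chop C C1.
  destruct (He _ _ C1 R) as (m1 & R1 & E1 & S1).
  assert (R' : rel B s m1) by (eapply rel_same; eauto; intros x Hx; apply S1; lia).
  destruct (load_slot _ m1 t k a C) as (m2 & R2 & E2 & S2); auto.
  - apply R'.
  - unfold sp; nia.
  - destruct a; [specialize (Hlo eq_refl); lia | nia].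
  - exists m2; split; [|split].
    + rewrite length_app, Nat.add_assoc; eapply run_app; eauto.
    + rewrite E2; auto.
    + eapply same_trans; eauto.
Qed.

Lemma cN_evals s e t : wfN e t = true -> dfN B s e -> (T0 <= t)%nat ->
  evals (cN e t) t (INR (evN s e)) s.
Proof.
  revert t; induction e; cbn [cN cR wfN wfR dfN dfR evN evR]; intros t W D Ht; bsplit.
  - intros pc m C R. destruct (var_copy pc m t (cn x) C) as (m' & ? & E & ?); auto.
    { unfold cn, NV, T0 in *; lia. }
    exists m'; split; [|split]; auto. rewrite E; apply R; auto.
  - intros pc m C R. destruct (const_step pc m t _ C) as (m' & ? & E & ?); auto.
    exists m'; split; [|split]; auto. rewrite E; symmetry; apply INR_IZR_INZ.
  - rewrite plus_INR; apply evals_op; intuition auto. apply st_add; auto.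
  - rewrite minus_INR by tauto; apply evals_op; intuition auto. apply st_sub; auto.
  - rewrite mult_INR; apply evals_op; intuition auto. apply st_mul; auto.
  - apply evals_load with (k := evN s e); intuition auto.
    + unfold RS, NS in *; lia.
    + split; auto. unfold RS; lia.
    + eapply rel_na; eauto.
Qed.

Lemma cR_evals s e t : wfR e t = true -> dfR B s e -> (T0 <= t)%nat ->
  evals (cR e t) t (evR s e) s.
Proof.
  revert t; induction e; cbn [cN cR wfN wfR dfN dfR evN evR]; intros t W D Ht; bsplit.
  - intros pc m C R. destruct (var_copy pc m t (cr x) C) as (m' & ? & E & ?); auto.
    { unfold cr, NV, T0 in *; lia. }
    exists m'; split; [|split]; auto. rewrite E; apply R; auto.
  - intros pc m C R. apply const_step; auto.
  - apply evals_op; intuition auto. apply st_add; auto.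
  - apply evals_op; intuition auto. apply st_sub; auto.
  - apply evals_op; intuition auto. apply st_mul; auto.
  - apply evals_op; intuition auto. apply st_div; auto. congruence.
  - apply evals_load with (k := evN s e); intuition auto.
    + apply cN_evals; auto.
    + unfold RS, NS in *; lia.
    + eapply rel_ra; eauto.
  - apply cN_evals; auto.
Qed.

Local Lemma two_evals ca cb va vb s pc m :
  evals ca T0 va s -> evals cb (S T0) vb s -> code_at p pc (ca ++ cb) -> rel B s m ->
  exists m', run sp p (length ca + length cb) (pc, m) (pc + (length ca + length cb), m')%nat /\
    m' T0 = va /\ m' (S T0) = vb /\ same T0 m m'.
Proof.
  intros Ha Hb C R. apply code_at_app in C; destruct C as [C1 C2].
  destruct (Ha _ _ C1 R) as (m1 & R1 & E1 & S1).
  assert (R' : rel B s m1) by (eapply rel_same; eauto).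
  destruct (Hb _ _ C2 R') as (m2 & R2 & E2 & S2).
  exists m2; split; [|split; [|split]]; auto.
  - rewrite Nat.add_assoc; eapply run_app; eauto.
  - rewrite S2 by lia; auto.
  - apply (same_trans T0 (S T0) m m1 m2); auto.
Qed.

Local Lemma cC_run s b pc m : wfC b = true -> dfC B s b -> code_at p pc (cC b) -> rel B s m ->
  exists m', run sp p (costC b) (pc, m) (pc + costC b, m')%nat /\
    (holds s b <-> m' T0 <= m' (S T0)) /\ same T0 m m'.
Proof.
  intros W D C R; destruct b; simpl in *; bsplit; destruct D.
  - destruct (two_evals (cN a T0) (cN b (S T0)) (INR (evN s a)) (INR (evN s b)) s pc m)
      as (m' & r & e1 & e2 & S); auto using cN_evals.
    exists m'; unfold costC; simpl; rewrite length_app; split; [|split]; auto.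
    rewrite e1, e2; split; [apply le_INR | apply INR_le].
  - destruct (two_evals (cR a T0) (cR b (S T0)) (evR s a) (evR s b) s pc m)
      as (m' & r & e1 & e2 & S); auto using cR_evals.
    exists m'; unfold costC; simpl; rewrite length_app; split; [|split]; auto.
    rewrite e1, e2; tauto.
Qed.

Local Lemma store_run pc m k v a : code_at p pc (cstore a) -> m 0%nat = INR B ->
  m T0 = INR k -> m (S T0) = v -> (a < RS + NS)%nat -> rix B a k ->
  exists m', run sp p 4 (pc, m) (pc + 4, m')%nat /\
     same T0 (upd m (a * B + k) v) m'.
Proof.
  intros C h0 h1 h2 Ha [Hk Hlo].
  next C I1. next C I2. next C I3. next C I4.
  set (t := T0) in *; assert (Et : t = T0) by auto. clearbody t.
  set (m1 := upd m (S (S t)) (IZR (Z.of_nat a))).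
  set (m2 := upd m1 (S (S t)) (m1 (S (S t)) * m1 0%nat)).
  set (m3 := upd m2 t (m2 t + m2 (S (S t)))).
  assert (E3 : m3 t = INR (a * B + k)).
  { unfold m3; rewrite upd_same. unfold m2; rewrite upd_same, upd_other by lia.
    unfold m1; rewrite upd_same, !upd_other by (unfold T0 in *; lia).
    rewrite h0, h1, plus_INR, mult_INR, (INR_IZR_INZ a). ring. }
  assert (E4 : m3 (S t) = v).
  { unfold m3, m2, m1; rewrite !upd_other by lia; auto. }
  exists (upd m3 (a * B + k) (m3 (S t))); split.
  - replace (pc + 4)%nat with (S (S (S (S pc)))) by lia.
    econstructor; [eapply st_const; eauto; bnd|]. fold m1.
    econstructor; [eapply st_mul; eauto; bnd|]. fold m2.
    econstructor; [eapply st_add; eauto; bnd|]. fold m3.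
    apply run_one. eapply st_store; eauto; try bnd. unfold sp; nia.
  - intros x Hx. unfold upd at 1 2. destruct (Nat.eqb_spec x (a * B + k)); auto.
    unfold m3, m2, m1. rewrite !upd_other by (unfold T0, KR in *; lia); auto.
Qed.

Local Lemma asn_run pc m v d : code_at p pc [IConst (S T0) 0; IAdd d T0 (S T0)] ->
  (d < T0)%nat -> m T0 = v ->
  exists m', run sp p 2 (pc, m) (pc + 2, m')%nat /\ same T0 (upd m d v) m'.
Proof.
  intros C Hd h.
  next C I1. next C I2.
  eexists; split.
  - replace (pc + 2)%nat with (S (S pc)) by lia.
    econstructor; [eapply st_const; eauto; bnd|].
    apply run_one; eapply st_add; eauto; bnd.
  - intros x Hx. destruct (Nat.eq_dec x d) as [->|Hxd].
    + rewrite !upd_same, upd_other, h by (unfold T0; lia). ring.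
    + rewrite !upd_other; auto. unfold T0, KR in *; lia.
Qed.

Ltac unf := unfold T0, KR, NV, RS, NS, cn, cr in *.

Lemma rel_setn s m x v : (x < NV)%nat -> rel B s m -> rel B (setn s x v) (upd m (cn x) (INR v)).
Proof.
  intros Hx [h0 h1 h2 h3 h4]; constructor; cbn [nv rv na ra setn setr setna setra]; intros.
  - rewrite upd_other; auto. unf; lia.
  - destruct (Nat.eqb_spec x0 x); [subst; apply upd_same|]. rewrite upd_other; auto. unf; lia.
  - rewrite upd_other; auto. unf; lia.
  - rewrite upd_other; auto. destruct H0 as [H0 H1].
    destruct a; [specialize (H1 eq_refl); unf; lia | unf; nia].
  - rewrite upd_other; auto. pose proof (slot_ge B (RS + a) i ltac:(unf; lia)). unf; lia.
Qed.

Lemma rel_setr s m x v : (x < NV)%nat -> rel B s m -> rel B (setr s x v) (upd m (cr x) v).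
Proof.
  intros Hx [h0 h1 h2 h3 h4]; constructor; cbn [nv rv na ra setn setr setna setra]; intros.
  - rewrite upd_other; auto. unf; lia.
  - rewrite upd_other; auto. unf; lia.
  - destruct (Nat.eqb_spec x0 x); [subst; apply upd_same|]. rewrite upd_other; auto. unf; lia.
  - rewrite upd_other; auto. destruct H0 as [H0 H1].
    destruct a; [specialize (H1 eq_refl); unf; lia | unf; nia].
  - rewrite upd_other; auto. pose proof (slot_ge B (RS + a) i ltac:(unf; lia)). unf; lia.
Qed.

Lemma rel_setna s m a i v : (a < NS)%nat -> (i < B)%nat -> rel B s m ->
  rel B (setna s a i v) (upd m ((RS + a) * B + i) (INR v)).
Proof.
  intros Ha Hi [h0 h1 h2 h3 h4]; constructor; cbn [nv rv na ra setn setr setna setra]; intros.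
  - rewrite upd_other; auto. pose proof (slot_ge B (RS + a) i ltac:(unf; lia)). unf; lia.
  - rewrite upd_other; auto. pose proof (slot_ge B (RS + a) i ltac:(unf; lia)). unf; lia.
  - rewrite upd_other; auto. pose proof (slot_ge B (RS + a) i ltac:(unf; lia)). unf; lia.
  - rewrite upd_other; auto. destruct H0 as [H0 H1].
    intros E; apply slot_inj in E; auto. unf; lia.
  - destruct (Nat.eqb_spec a0 a); [destruct (Nat.eqb_spec i0 i)|].
    + subst; apply upd_same.
    + rewrite upd_other; auto. intros E; apply slot_inj in E; auto; lia.
    + rewrite upd_other; auto. intros E; apply slot_inj in E; auto; lia.
Qed.

Lemma rel_setra s m a i v : (a < RS)%nat -> rix B a i -> rel B s m ->
  rel B (setra s a i v) (upd m (a * B + i) v).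
Proof.
  intros Ha [Hi Hlo] [h0 h1 h2 h3 h4].
  assert (HK : (KR <= a * B + i)%nat) by (destruct a; [specialize (Hlo eq_refl); lia | nia]).
  constructor; cbn [nv rv na ra setn setr setna setra]; intros.
  - rewrite upd_other; auto. unf; lia.
  - rewrite upd_other; auto. unf; lia.
  - rewrite upd_other; auto. unf; lia.
  - destruct (Nat.eqb_spec a0 a); [destruct (Nat.eqb_spec i0 i)|].
    + subst; apply upd_same.
    + rewrite upd_other; auto. intros E; apply slot_inj in E; auto; destruct H0; auto; lia.
    + rewrite upd_other; auto. intros E; apply slot_inj in E; auto; destruct H0; auto; lia.
  - rewrite upd_other; auto. 
    intros E; apply slot_inj in E; auto. unf; lia.
Qed.

Lemma run_jmp pc m l : nth_error p pc = Some (IJle 0 0 l) -> run sp p 1 (pc, m) (l, m).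
Proof. intros; apply run_one; eapply st_jle_t; eauto; try bnd. lra. Qed.

(** Induction on the execution, not on the command: a further round of a loop is again an execution
    of the whole loop from the same [pc]. *)
Theorem compile_run c s k s' : exec B c s k s' -> wf c = true ->
  forall pc m, code_at p pc (compile c pc) -> rel B s m ->
  exists m', run sp p k (pc, m) (pc + length (compile c pc), m')%nat /\ rel B s' m'.
Proof.
  induction 1; simpl; intros W pc m C R; bsplit.
  - exists m; rewrite Nat.add_0_r; split; auto; constructor.
  - chop C C1.
    destruct (cN_evals s e T0 H0 H (Nat.le_refl _) _ _ C1 R) as (m1 & R1 & E1 & S1).
    destruct (asn_run _ m1 (INR (evN s e)) _ C) as (m2 & R2 & S2); auto.
    { unf; lia. }
    exists m2; split.
    + rewrite length_app, Nat.add_assoc. unfold costN; rewrite (length_cN e 0 T0).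
      eapply run_app; eauto.
    + eapply rel_same; [auto| |eauto]. apply rel_setn; auto. eapply rel_same; eauto.
  - chop C C1.
    destruct (cR_evals s e T0 H0 H (Nat.le_refl _) _ _ C1 R) as (m1 & R1 & E1 & S1).
    destruct (asn_run _ m1 (evR s e) _ C) as (m2 & R2 & S2); auto.
    { unf; lia. }
    exists m2; split.
    + rewrite length_app, Nat.add_assoc. unfold costR; rewrite (length_cR e 0 T0).
      eapply run_app; eauto.
    + eapply rel_same; [auto| |eauto]. apply rel_setr; auto. eapply rel_same; eauto.
  - rewrite app_assoc in C. chop C C1.
    destruct (two_evals (cN i T0) (cN e (S T0)) (INR (evN s i)) (INR (evN s e)) s pc m)
      as (m1 & R1 & E1 & E2 & S1); auto using cN_evals.
    rewrite length_app in C.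
    assert (R' : rel B s m1) by (eapply rel_same; eauto).
    destruct (store_run _ m1 (evN s i) (INR (evN s e)) _ C) as (m2 & R2 & S2); auto.
    { apply R'. } { unf; lia. } { split; auto. unf; lia. }
    exists m2; split.
    + rewrite !length_app, !Nat.add_assoc. unfold costN.
      rewrite (length_cN e 0 (S T0)), (length_cN i 0 T0).
      rewrite Nat.add_assoc in *. eapply run_app; eauto.
    + eapply rel_same; [auto| |eauto]. apply rel_setna; auto.
  - rewrite app_assoc in C. chop C C1.
    destruct (two_evals (cN i T0) (cR e (S T0)) (INR (evN s i)) (evR s e) s pc m)
      as (m1 & R1 & E1 & E2 & S1); auto using cN_evals, cR_evals.
    rewrite length_app in C.
    assert (R' : rel B s m1) by (eapply rel_same; eauto).
    destruct (store_run _ m1 (evN s i) (evR s e) _ C) as (m2 & R2 & S2); auto.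
    { apply R'. } { unf; lia. }
    exists m2; split.
    + rewrite !length_app, !Nat.add_assoc. unfold costN, costR.
      rewrite (length_cR e 0 (S T0)), (length_cN i 0 T0).
      rewrite Nat.add_assoc in *. eapply run_app; eauto.
    + eapply rel_same; [auto| |eauto]. apply rel_setra; auto.
  - apply code_at_app in C; destruct C as [C1 C2].
    destruct (IHexec1 H1 _ _ C1 R) as (m1 & R1 & E1).
    destruct (IHexec2 H2 _ _ C2 E1) as (m2 & R2 & E2).
    exists m2; split; auto. rewrite length_app, Nat.add_assoc; eapply run_app; eauto.
  - chop C C1.
    next C I1.
    chop C C2.
    next C I2.
    destruct (cC_run s b pc m H2 H C1 R) as (m1 & R1 & E1 & S1).
    assert (R' : rel B s m1) by (eapply rel_same; eauto).
    set (l2 := (pc + length (cC b) + 1 + length (compile d (pc + length (cC b) + 1)) + 1)%nat) in *.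
    replace (S (S (pc + length (cC b)) + length (compile d (pc + length (cC b) + 1)))) with l2 in C
      by (unfold l2; lia).
    destruct (IHexec H4 _ _ C R') as (m2 & R2 & E2).
    exists m2; split; auto.
    rewrite length_app. simpl. rewrite length_app. simpl.
    replace (pc + _)%nat with (l2 + length (compile c l2))%nat by (unfold l2; lia).
    eapply run_app; eauto. eapply run_app; eauto.
    apply run_one. eapply st_jle_t; eauto; try bnd. apply E1; auto.
  - chop C C1.
    next C I1.
    chop C C2.
    next C I2.
    destruct (cC_run s b pc m H2 H C1 R) as (m1 & R1 & E1 & S1).
    assert (R' : rel B s m1) by (eapply rel_same; eauto).
    set (l1 := (pc + length (cC b) + 1)%nat) in *.
    replace (S (pc + length (cC b))) with l1 in * by (unfold l1; lia).
    destruct (IHexec H3 _ _ C2 R') as (m2 & R2 & E2).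
    exists m2; split; auto.
    rewrite length_app. simpl. rewrite length_app. simpl.
    replace (costC b + 2 + k)%nat with (costC b + (1 + (k + 1)))%nat by lia.
    eapply run_app; eauto. eapply run_app.
    { apply run_one. eapply st_jle_f; eauto; try bnd. apply Rnot_le_lt; tauto. }
    unfold costC. replace (S (pc + length (cC b))) with l1 by (unfold l1; lia).
    eapply run_app; eauto.
    replace (pc + _)%nat with
      (l1 + length (compile d l1) + 1 + length (compile c (l1 + length (compile d l1) + 1)))%nat
      by (unfold l1; lia).
    apply run_jmp; auto.
  - chop C C1.
    next C I1.
    destruct (cC_run s b pc m H1 H C1 R) as (m1 & R1 & E1 & S1).
    exists m1; split; [|eapply rel_same; eauto].
    eapply run_app; eauto. apply run_one.
    rewrite length_app; simpl; rewrite length_app; simpl.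
    replace (pc + (length (cC b) + _))%nat with
      (pc + length (cC b) + 1 + length (compile c (pc + length (cC b) + 1)) + 1)%nat by lia.
    eapply st_jle_t; eauto; try bnd. apply E1; auto.
  (* The code of the whole loop is kept, since after the backward jump the second induction
     hypothesis runs it again at the same address. *)
  - assert (C0 := C). chop C C1.
    next C I1.
    chop C C2.
    next C I2.
    destruct (cC_run s b pc m H3 H C1 R) as (m1 & R1 & E1 & S1).
    assert (R' : rel B s m1) by (eapply rel_same; eauto).
    replace (S (pc + length (cC b))) with (pc + length (cC b) + 1)%nat in * by lia.
    destruct (IHexec1 H4 _ _ C2 R') as (m2 & R2 & E2).
    simpl in IHexec2; rewrite H3, H4 in IHexec2; specialize (IHexec2 eq_refl).
    destruct (IHexec2 pc m2 C0 E2) as (m3 & R3 & E3).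
    exists m3; split; auto.
    replace (costC b + 2 + k1 + k2)%nat with (costC b + (1 + (k1 + (1 + k2))))%nat by lia.
    eapply run_app; eauto. eapply run_app.
    { apply run_one. eapply st_jle_f; eauto; try bnd. apply Rnot_le_lt; tauto. }
    unfold costC. replace (S (pc + length (cC b))) with (pc + length (cC b) + 1)%nat by lia.
    eapply run_app; eauto. eapply run_app; eauto. apply run_jmp; auto.
Qed.

End Compile.

(* The input occupies every low cell, so cells 0 and 1 are first turned into
   2*B and n*tau, from which both n and tau can be recovered; cells 2..63 are
   then saved at the start of array 2 to make room for the registers. *)
Definition save_code : list instr :=
  flat_map (fun d => [IAdd 0 0 2; IStore 0 d]) (seq 3 61).

Definition clear_code : list instr := map (fun d => IConst d 0) (seq 4 60).

Definition prelude : list instr :=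
  ([IMul 1 1 0; IMul 0 0 1] ++ repeat (IAdd 0 0 0) 8 ++ [IStore 0 2; IConst 2 1]) ++
  save_code ++
  [IConst 2 61; ISub 0 0 2; IConst 2 2; IDiv 0 0 2;
   IConst 2 128; IDiv 2 0 2; IDiv 2 2 1; IDiv 1 1 2;
   IConst 3 0; IAdd 3 3 2; IConst 2 0] ++ clear_code.

(* Array 1 starts at the address held in cell 0, so its first 64 entries can be
   moved down in place, cell 0 last. *)
Definition postlude : list instr :=
  flat_map (fun d => [IConst d (Z.of_nat d); IAdd d d 0; ILoad d d]) (seq 1 63) ++ [ILoad 0 0].

Definition program (c : cmd) : list instr :=
  prelude ++ compile c (length prelude) ++ postlude ++ [IHalt].

Lemma save_run sp p pc len d m q :
  code_at p pc (flat_map (fun d => [IAdd 0 0 2; IStore 0 d]) (seq d len)) ->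
  m 0%nat = INR q -> m 2%nat = 1 -> (3 <= d)%nat -> (d + len <= q)%nat -> (q + len < sp)%nat ->
  exists m', run sp p (2 * len) (pc, m) (pc + 2 * len, m')%nat /\
    m' 0%nat = INR (q + len) /\
    (forall i, (i < len)%nat -> m' (q + 1 + i)%nat = m (d + i)%nat) /\
    (forall x, (0 < x <= q \/ q + len < x)%nat -> m' x = m x).
Proof.
  revert d q m pc; induction len; intros d q m pc C h0 h2 Hd Hq Hs.
  - exists m; rewrite !Nat.add_0_r; split; [constructor|].
    split; [|split]; auto; intros; lia.
  - cbn [seq flat_map app] in C.
    next C I1. next C I2.
    set (m1 := upd m 0 (m 0%nat + m 2%nat)).
    set (m2 := upd m1 (q + 1) (m1 d)).
    destruct (IHlen (S d) (q + 1)%nat m2 (S (S pc))) as (m' & R & E0 & E1 & E2); auto; try lia.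
    { unfold m2; rewrite upd_other by lia. unfold m1; rewrite upd_same, h0, h2.
      rewrite plus_INR; simpl; ring. }
    { unfold m2, m1; rewrite !upd_other by lia; auto. }
    exists m'; split; [|split; [|split]].
    + replace (2 * S len)%nat with (2 + 2 * len)%nat by lia.
      eapply (run_app _ _ 2 (2 * len) _ (S (S pc), m2)).
      * econstructor; [eapply st_add; eauto; lia|]. fold m1.
        apply run_one; eapply st_store; eauto; try lia.
        unfold m1; rewrite upd_same, h0, h2, plus_INR; simpl; ring.
      * replace (pc + (2 + 2 * len))%nat with (S (S pc) + 2 * len)%nat by lia; auto.
    + rewrite E0; f_equal; lia.
    + intros [|i] Hi.
      * rewrite E2 by lia. rewrite Nat.add_0_r; unfold m2; rewrite upd_same.
        unfold m1; rewrite upd_other by lia; f_equal; lia.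
      * replace (q + 1 + S i)%nat with (q + 1 + 1 + i)%nat by lia. rewrite E1 by lia.
        unfold m2, m1; rewrite !upd_other by lia; f_equal; lia.
    + intros x Hx; rewrite E2 by lia. unfold m2, m1; rewrite !upd_other by lia; auto.
Qed.

Lemma clear_run sp p pc len d m :
  code_at p pc (map (fun d => IConst d 0) (seq d len)) -> (d + len <= sp)%nat ->
  exists m', run sp p len (pc, m) (pc + len, m')%nat /\
    forall x, m' x = if andb (Nat.leb d x) (Nat.ltb x (d + len)) then 0 else m x.
Proof.
  revert d m pc; induction len; intros d m pc C Hs.
  - exists m; rewrite !Nat.add_0_r; split; [constructor|].
    intros x. destruct (Nat.leb_spec d x), (Nat.ltb_spec x d); simpl; auto; lia.
  - cbn [seq map] in C. next C I1.
    destruct (IHlen (S d) (upd m d 0) (S pc) C) as (m' & R & E); [lia|].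
    exists m'; split.
    + rewrite <- Nat.add_succ_comm. econstructor; eauto. eapply st_const; eauto; lia.
    + intros x; rewrite E. unfold upd.
      destruct (Nat.leb_spec (S d) x), (Nat.ltb_spec x (S d + len)), (Nat.leb_spec d x),
        (Nat.ltb_spec x (d + S len)), (Nat.eqb_spec x d); simpl; auto; lia.
Qed.

Lemma postlude_run sp p pc len d m B :
  code_at p pc (flat_map (fun d => [IConst d (Z.of_nat d); IAdd d d 0; ILoad d d]) (seq d len)) ->
  m 0%nat = INR B -> (1 <= d)%nat -> (d + len <= B)%nat -> (d + len + B <= sp)%nat ->
  exists m', run sp p (3 * len) (pc, m) (pc + 3 * len, m')%nat /\
    forall x, m' x = if andb (Nat.leb d x) (Nat.ltb x (d + len)) then m (B + x)%nat else m x.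
Proof.
  revert d m pc; induction len; intros d m pc C h0 Hd Hl Hs.
  - exists m; rewrite !Nat.add_0_r; split; [constructor|].
    intros x. destruct (Nat.leb_spec d x), (Nat.ltb_spec x d); simpl; auto; lia.
  - cbn [seq flat_map app] in C.
    next C I1. next C I2. next C I3.
    set (m1 := upd m d (IZR (Z.of_nat d))).
    set (m2 := upd m1 d (m1 d + m1 0%nat)).
    set (m3 := upd m2 d (m2 (B + d)%nat)).
    destruct (IHlen (S d) m3 (S (S (S pc))) C) as (m' & R & E); try lia.
    { unfold m3, m2, m1; rewrite !upd_other by lia; auto. }
    exists m'; split.
    + replace (3 * S len)%nat with (3 + 3 * len)%nat by lia.
      eapply (run_app _ _ 3 (3 * len) _ (S (S (S pc)), m3)).
      * econstructor; [eapply st_const; eauto; lia|]. fold m1.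
        econstructor; [eapply st_add; eauto; lia|]. fold m2.
        apply run_one; eapply st_load; eauto; try lia.
        unfold m2, m1; rewrite !upd_same, upd_other, h0, plus_INR, (INR_IZR_INZ d) by lia.
        ring.
      * replace (pc + (3 + 3 * len))%nat with (S (S (S pc)) + 3 * len)%nat by lia; auto.
    + intros x; rewrite E.
      destruct (Nat.eq_dec x d) as [->|Hx].
      * destruct (Nat.leb_spec (S d) d), (Nat.leb_spec d d), (Nat.ltb_spec d (d + S len));
          simpl; try lia.
        unfold m3; rewrite upd_same. unfold m2, m1; rewrite !upd_other by lia; auto.
      * destruct (Nat.leb_spec (S d) x), (Nat.ltb_spec x (S d + len)), (Nat.leb_spec d x),
          (Nat.ltb_spec x (d + S len)); simpl; try lia;
          unfold m3, m2, m1; rewrite !upd_other by lia; auto.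
Qed.

(** What the prelude leaves, as the source language sees it: the variables for [tau] and [n], the
    saved cells 2 to 63 as entries 0 to 61 of array 2, and the rest of the input still in place,
    readable through array 0. *)
Definition start (n tau : nat) (ts : nat -> R) (ps : nat -> nat -> R) : st :=
  St (fun x => match x with 0 => tau | 1 => n | _ => 0 end)%nat (fun _ => 0)
    (fun _ _ => 0%nat)
    (fun a i => match a with
                | 0%nat => init_mem n tau ts ps i
                | 2%nat => if Nat.ltb i 62 then init_mem n tau ts ps (i + 2) else 0
                | _ => 0
                end).

(** The encoding ends below half of the block size, so all blocks above the low memory start out
    zero. *)
Lemma init_mem_high n tau ts ps x : (1 <= n)%nat -> (1 <= tau)%nat ->
  (64 * tau * (n * n) <= x)%nat -> init_mem n tau ts ps x = 0.
Proof.
  intros Hn Ht Hx. unfold init_mem.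
  assert (3 + tau + n * (tau + 1) <= 64 * tau * (n * n))%nat by nia.
  destruct (Nat.eqb_spec x 0), (Nat.eqb_spec x 1), (Nat.ltb_spec x (3 + tau)),
    (Nat.ltb_spec x (3 + tau + n * (tau + 1))); auto; nia.
Qed.

(** * Freeing the registers and recovering [n] and [tau] *)

Section Prelude.
Variables (n tau : nat) (ts : nat -> R) (ps : nat -> nat -> R) (p : list instr).
Hypotheses (Hn : (1 <= n)%nat) (Ht : (1 <= tau)%nat).
Let B : nat := (128 * (tau * (n * n)))%nat.
Let sp : nat := ((RS + NS) * B)%nat.

Local Lemma B_ge : (128 <= B)%nat.
Proof using Hn Ht. unfold B; nia. Qed.

Local Lemma double_run k : forall pc m q, code_at p pc (repeat (IAdd 0 0 0) k) ->
  m 0%nat = INR q ->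
  exists m', run sp p k (pc, m) (pc + k, m')%nat /\ m' 0%nat = INR (2 ^ k * q) /\
    forall x, x <> 0%nat -> m' x = m x.
Proof using Hn Ht.
  pose proof B_ge. induction k; intros pc m q C h.
  - exists m; rewrite Nat.add_0_r; split; [constructor|]. rewrite Nat.mul_1_l; auto.
  - cbn [repeat] in C; next C I.
    destruct (IHk (S pc) (upd m 0 (m 0%nat + m 0%nat)) (2 * q)%nat C) as (m' & R & E0 & E).
    { rewrite upd_same, h, mult_INR; simpl; ring. }
    exists m'; split; [|split].
    + rewrite <- Nat.add_succ_comm. econstructor; eauto.
      eapply st_add; eauto; unfold sp, RS, NS; lia.
    + rewrite E0; f_equal. cbn [Nat.pow]; lia.
    + intros; rewrite E, upd_other; auto.
Qed.

Lemma prelude_run : code_at p 0 prelude ->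
  exists m, run sp p (length prelude) (0%nat, init_mem n tau ts ps) (length prelude, m) /\
    rel B (start n tau ts ps) m.
Proof using Hn Ht.
  pose proof B_ge as HB.
  set (m0 := init_mem n tau ts ps).
  intros C. unfold prelude in C.
  rewrite <- !app_assoc in C.
  next C I1. next C I2.
  chop C Cd.
  rewrite repeat_length in C.
  next C I3. next C I4.
  chop C Cs.
  change (length save_code) with 122%nat in C.
  apply code_at_app in C; destruct C as [Ci Cc].
  set (m1 := upd m0 1 (m0 1%nat * m0 0%nat)).
  set (m2 := upd m1 0 (m1 0%nat * m1 1%nat)).
  assert (h2 : m2 0%nat = INR (tau * (n * n))).
  { unfold m2, m1, m0; rewrite upd_same, upd_same, upd_other by lia.
    unfold init_mem; simpl. rewrite !mult_INR; ring. }
  destruct (double_run 8 _ m2 _ Cd h2) as (m3 & R3 & E3 & F3).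
  (* Eight doublings give [2 * B], the address of array 2, without a free cell for the constant
     256. *)
  replace (2 ^ 8 * (tau * (n * n)))%nat with (2 * B)%nat in E3 by (unfold B; simpl; lia).
  set (m4 := upd m3 (2 * B) (m3 2%nat)).
  set (m5 := upd m4 2 (IZR 1)).
  assert (E50 : m5 0%nat = INR (2 * B)).
  { unfold m5, m4; rewrite !upd_other by lia; auto. }
  destruct (save_run sp p _ 61 3 m5 (2 * B) Cs) as (m6 & R6 & A0 & A1 & A2);
    [exact E50 | apply upd_same | lia | lia | unfold sp, RS, NS; lia |].
  assert (E6 : forall x, (2 < x < 2 * B)%nat \/ (2 * B + 61 < x)%nat -> m6 x = m0 x).
  { intros x Hx. rewrite A2 by lia. unfold m5, m4; rewrite !upd_other by lia.
    rewrite F3 by lia. unfold m2, m1; rewrite !upd_other by lia; auto. }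
  assert (E61 : m6 1%nat = INR (n * tau)).
  { rewrite A2 by lia. unfold m5, m4; rewrite !upd_other by lia.
    rewrite F3 by lia. unfold m2, m1; rewrite upd_other, upd_same by lia.
    unfold m0, init_mem; simpl. rewrite mult_INR; ring. }
  assert (E6s : forall i, (i < 62)%nat -> m6 (2 * B + i)%nat = m0 (i + 2)%nat).
  { intros [|i] Hi.
    - rewrite A2 by lia. rewrite Nat.add_0_r; unfold m5, m4.
      rewrite upd_other, upd_same, F3 by lia. unfold m2, m1; rewrite !upd_other by lia; auto.
    - replace (2 * B + S i)%nat with (2 * B + 1 + i)%nat by lia.
      rewrite A1 by lia. unfold m5, m4; rewrite !upd_other by lia. rewrite F3 by lia.
      unfold m2, m1; rewrite !upd_other by lia; f_equal; lia. }
  next Ci J1. next Ci J2. next Ci J3. next Ci J4. next Ci J5. next Ci J6. next Ci J7. next Ci J8. next Ci J9. next Ci J10. next Ci J11.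
  assert (Hin : INR n <> 0) by (apply not_0_INR; lia).
  assert (Hit : INR tau <> 0) by (apply not_0_INR; lia).
  assert (HiB : INR B = 128 * (INR tau * (INR n * INR n))).
  { unfold B; rewrite !mult_INR; f_equal. rewrite INR_IZR_INZ; reflexivity. }
  (* After 61 increments cell 0 holds [2 * B + 61], which yields [B]; then [B / 128] divided by
     [n * tau] is [n], and [n * tau] divided by [n] is [tau]. The addresses 134 and 145 delimit
     these eleven instructions within the prelude. *)
  assert (Q : exists m7, run sp p 11 (134%nat, m6) (145%nat, m7) /\
     m7 0%nat = INR B /\ m7 1%nat = INR tau /\ m7 2%nat = 0 /\ m7 3%nat = INR n /\
     forall x, (3 < x)%nat -> m7 x = m6 x).
  { assert (S0 : (4 < sp)%nat) by (unfold sp, RS, NS; lia).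
    eexists; split.
    { econstructor; [eapply st_const; [exact J1|lia]|].
      econstructor; [eapply st_sub; [exact J2|lia..]|].
      econstructor; [eapply st_const; [exact J3|lia]|].
      econstructor; [eapply st_div; [exact J4|try lia..]|].
      { rewrite upd_same; lra. }
      econstructor; [eapply st_const; [exact J5|lia]|].
      econstructor; [eapply st_div; [exact J6|try lia..]|].
      { rewrite upd_same; lra. }
      econstructor; [eapply st_div; [exact J7|try lia..]|].
      { unfold upd; cbn [Nat.eqb]. rewrite E61, mult_INR. apply Rmult_integral_contrapositive; auto. }
      econstructor; [eapply st_div; [exact J8|try lia..]|].
      { unfold upd; cbn [Nat.eqb]. rewrite E61, A0, plus_INR, !mult_INR, HiB.
        replace (INR 61) with 61 by (rewrite INR_IZR_INZ; reflexivity).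
        simpl (INR 2).
        match goal with |- ?e <> 0 => replace e with (INR n) by (field; split; auto) end. auto. }
      econstructor; [eapply st_const; [exact J9|lia]|].
      econstructor; [eapply st_add; [exact J10|lia..]|].
      apply run_one; eapply st_const; [exact J11|lia]. }
    unfold upd; cbn [Nat.eqb].
    rewrite E61, A0, plus_INR, !mult_INR, HiB.
    replace (INR 61) with 61 by (rewrite INR_IZR_INZ; reflexivity).
    simpl (INR 2).
    assert (Hq : 2 * (128 * (INR tau * (INR n * INR n))) + 61 - 61 <> 0).
    { replace (2 * (128 * (INR tau * (INR n * INR n))) + 61 - 61)
        with (256 * (INR tau * (INR n * INR n))) by ring.
      repeat apply Rmult_integral_contrapositive_currified; auto; lra. }
    split; [field|]. split; [field; auto|]. split; [auto|]. split; [field; auto|].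
    intros [|[|[|[|x]]]] Hx; try lia. reflexivity. }
  destruct Q as (m7 & R7 & F0 & F1 & F2 & F3' & F4).
  destruct (clear_run sp p _ 60 4 m7 Cc) as (m8 & R8 & G).
  { unfold sp, RS, NS; lia. }
  exists m8; split.
  - change (length prelude) with (1 + (1 + (8 + (1 + (1 + (2 * 61 + (11 + 60)))))))%nat at 1.
    eapply run_app. { apply run_one; eapply st_mul; eauto; unfold sp, RS, NS; lia. }
    fold m1. eapply run_app. { apply run_one; eapply st_mul; eauto; unfold sp, RS, NS; lia. }
    fold m2. eapply run_app; [exact R3|].
    eapply run_app. { apply run_one. eapply st_store; eauto; unfold sp, RS, NS; lia. }
    fold m4. eapply run_app. { apply run_one. eapply st_const; eauto; unfold sp, RS, NS; lia. }
    fold m5. eapply run_app; [exact R6|]. eapply run_app; [exact R7|]. exact R8.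
  - assert (G' : forall x, (64 <= x)%nat -> m8 x = m6 x).
    { intros x Hx. rewrite G. destruct (Nat.ltb_spec x (4 + 60)); [lia|].
      rewrite Bool.andb_false_r. apply F4; lia. }
    constructor.
    + rewrite G; simpl; auto.
    + intros x Hx. rewrite G. unfold cn, NV in *.
      destruct x as [|[|x]]; [simpl; auto..|].
      destruct (Nat.leb_spec 4 (1 + 2 * S (S x))), (Nat.ltb_spec (1 + 2 * S (S x)) (4 + 60));
        try lia. reflexivity.
    + intros x Hx. rewrite G. unfold cr, NV in *.
      destruct x as [|x]; [simpl; auto..|].
      destruct (Nat.leb_spec 4 (2 + 2 * S x)), (Nat.ltb_spec (2 + 2 * S x) (4 + 60));
        try lia. reflexivity.
    + intros a i Ha [Hi Hlo].
      assert (Z : forall x, (2 * B + 61 < x)%nat \/ (B <= x < 2 * B)%nat -> m8 x = 0).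
      { intros x Hx. rewrite G' by lia. rewrite E6 by lia. apply init_mem_high; auto.
        unfold B in *; lia. }
      destruct a as [|[|[|a]]]; cbn [ra start].
      * specialize (Hlo eq_refl); unfold KR in Hlo. cbn [Nat.mul Nat.add]. rewrite G', E6 by lia. reflexivity.
      * apply Z; lia.
      * rewrite G' by lia. destruct (Nat.ltb_spec i 62).
        { apply E6s; auto. }
        { rewrite <- G' by lia. apply Z; lia. }
      * apply Z; nia.
    + intros a i Ha Hi. cbn [na start]. rewrite G' by (unfold RS; nia).
      rewrite E6 by (unfold RS; nia). apply init_mem_high; auto. unfold B in *; unfold RS; nia.
Qed.

End Prelude.

(** The 190 extra steps are the postlude: three for each of the cells 1 to 63 and one for cell 0,
    which comes last because it holds the base address used by the others. *)
Theorem program_run n tau ts ps c k s : (1 <= n)%nat -> (1 <= tau)%nat -> wf c = true ->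
  exec (128 * (tau * (n * n))) c (start n tau ts ps) k s ->
  exists pc M,
    run ((RS + NS) * (128 * (tau * (n * n)))) (program c) (length prelude + (k + 190))
      (0%nat, init_mem n tau ts ps) (pc, M) /\
    nth_error (program c) pc = Some IHalt /\
    (forall x, (x < KR)%nat -> M x = ra s 1 x) /\
    (forall x, (KR <= x < 128 * (tau * (n * n)))%nat -> M x = ra s 0 x).
Proof.
  intros Hn Ht W E. set (B := (128 * (tau * (n * n)))%nat) in *.
  assert (HB : (128 <= B)%nat) by (unfold B; nia).
  assert (C0 : code_at (program c) 0 (program c))
    by (exists [], []; split; auto; now rewrite app_nil_r).
  apply code_at_app in C0; destruct C0 as [C0 C].
  chop C C1.
  unfold postlude in C; rewrite <- app_assoc in C.
  chop C C2.
  next C I1. next C I2.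
  destruct (prelude_run n tau ts ps (program c) Hn Ht C0) as (m0 & R0 & E0).
  fold B in R0, E0.
  destruct (compile_run B ltac:(unfold KR; lia) (program c) _ _ _ _ E W _ m0 C1 E0)
    as (m1 & R1 & E1).
  destruct (postlude_run ((RS + NS) * B) (program c) _ 63 1 m1 B C2) as (m2 & R2 & E2);
    [apply E1 | lia | lia | unfold RS, NS; lia |].
  set (m3 := upd m2 0 (m2 B)).
  eexists _, m3; split; [|split; [exact I2|split]].
  - eapply run_app; [exact R0|]. eapply run_app; [exact R1|].
    change 190%nat with (3 * 63 + 1)%nat. eapply run_app; [exact R2|].
    apply run_one. eapply st_load; [exact I1|unfold RS, NS; lia..|].
    rewrite E2; simpl. apply E1.
  - intros x Hx. unfold KR in Hx. unfold m3. destruct x as [|x].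
    + rewrite upd_same, E2. destruct (Nat.ltb_spec B (1 + 63)); [lia|].
      rewrite Bool.andb_false_r. replace B with (1 * B + 0)%nat at 1 by lia.
      apply E1; [unfold RS; lia|]. split; [lia|discriminate].
    + rewrite upd_other, E2 by lia. destruct (Nat.ltb_spec (S x) (1 + 63)); [|lia].
      change (Nat.leb 1 (S x)) with true; cbn [andb].
      replace (B + S x)%nat with (1 * B + S x)%nat by lia.
      apply E1; [unfold RS; lia|]. split; [lia|discriminate].
  - intros x Hx. unfold KR in *. unfold m3. rewrite upd_other, E2 by lia.
    destruct (Nat.ltb_spec x (1 + 63)); [lia|]. rewrite Bool.andb_false_r.
    change x with (0 * B + x)%nat at 1. apply E1; [unfold RS; lia|]. split; [lia|unfold KR; lia].
Qed.

(** * Continuity of the distance functions *)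

(** The identity [max(a, b) = (a + b + |a - b|) / 2] reduces this to continuity of the absolute
    value. *)
Lemma continuous_Rmax (f g : R -> R) t :
  continuous f t -> continuous g t -> continuous (fun u => Rmax (f u) (g u)) t.
Proof.
  intros Hf Hg.
  apply continuous_ext with (fun u => plus (scal (/ 2) (plus (f u) (g u))) (scal (/ 2) (Rabs (minus (f u) (g u))))).
  - intros u. unfold plus, scal, minus, opp; simpl; unfold mult, plus; simpl.
    unfold Rmax, Rabs; destruct (Rle_dec (f u) (g u)), (Rcase_abs (f u + - g u)); lra.
  - apply (@continuous_plus R_UniformSpace R_AbsRing R_NormedModule).
    + apply (@continuous_scal_r R_UniformSpace R_AbsRing R_NormedModule).
      now apply (@continuous_plus R_UniformSpace R_AbsRing R_NormedModule).
    + apply (@continuous_scal_r R_UniformSpace R_AbsRing R_NormedModule).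
      apply (continuous_comp (fun u => minus (f u) (g u)) Rabs).
      * now apply (@continuous_minus R_UniformSpace R_AbsRing R_NormedModule).
      * apply continuous_Rabs.
Qed.

Lemma continuous_affine a b t : continuous (fun u => a + b * u) t.
Proof.
  apply (@continuous_plus R_UniformSpace R_AbsRing R_NormedModule).
  - apply continuous_const.
  - apply (@continuous_scal_r R_UniformSpace R_AbsRing R_NormedModule b (fun u => u)).
    apply continuous_id.
Qed.

(** * Piecewise-linear trajectories and integrals of the distance *)

Section Trajectories.
Variables (n tau : nat) (ts : nat -> R) (ps : nat -> nat -> R).
Hypothesis Hv : valid_input n tau ts ps.

Let x (s : nat) (t : R) : R := traj tau ts ps s t.
Let D (s : nat) (t : R) : R := Dist n tau ts ps s t.

Lemma ts_le i j : (i <= j)%nat -> (j <= tau)%nat -> ts i <= ts j.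
Proof using Hv.
  intros H; induction H; intros; [lra|].
  destruct Hv as (_ & _ & Hts & _). specialize (Hts m ltac:(lia)). specialize (IHle ltac:(lia)). lra.
Qed.

Lemma ts_lt i j : (i < j)%nat -> (j <= tau)%nat -> ts i < ts j.
Proof using Hv.
  intros H Hj. destruct Hv as (_ & _ & Hts & _). specialize (Hts i ltac:(lia)).
  pose proof (ts_le (S i) j H Hj). lra.
Qed.

Lemma pl_last q m : (m <= tau)%nat -> pl ts q m (ts m) = q m.
Proof using Hv.
  intros Hm; destruct m; simpl; auto.
  pose proof (ts_lt m (S m) ltac:(lia) Hm).
  destruct (Rlt_dec (ts (S m)) (ts m)); [lra|]. field; lra.
Qed.

Lemma pl_segment q m k t : (k < m)%nat -> (m <= tau)%nat -> ts k <= t <= ts (S k) ->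
  pl ts q m t = q k + (q (S k) - q k) / (ts (S k) - ts k) * (t - ts k).
Proof using Hv.
  revert k; induction m; intros k Hk Hm Ht; [lia|]. simpl.
  pose proof (ts_lt m (S m) ltac:(lia) Hm).
  pose proof (ts_lt k (S k) ltac:(lia) ltac:(lia)).
  destruct (Rlt_dec t (ts m)).
  - apply IHm; auto; try lia. destruct (Nat.eq_dec k m); [subst; lra | lia].
  - destruct (Nat.eq_dec k m); [subst; field; lra|].
    (* The interpolant tests [t < ts m] strictly, so what remains is the breakpoint [t = ts m],
       shared by segment [k] and the next one, where both formulas agree. *)
    pose proof (ts_le (S k) m ltac:(lia) ltac:(lia)).
    assert (t = ts m) by lra. assert (ts (S k) = ts m) by lra.
    assert (S k = m).
    { destruct (Nat.eq_dec (S k) m); auto. pose proof (ts_lt (S k) m ltac:(lia) ltac:(lia)). lra. }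
    subst. field; lra.
Qed.

Lemma traj_segment k s t : (k < tau)%nat -> ts k <= t <= ts (S k) ->
  x s t = ps s k + (ps s (S k) - ps s k) / (ts (S k) - ts k) * (t - ts k).
Proof using Hv. intros; apply pl_segment; auto. Qed.

(* Gluing: the two branches agree at the breakpoint, so the interpolant is
   [pl m (min t c) + affine (max t c) - q m]. *)
Lemma pl_continuous q m t : (m <= tau)%nat -> continuous (pl ts q m) t.
Proof using Hv.
  revert t; induction m; intros t Hm.
  - apply continuous_const.
  - pose proof (ts_lt m (S m) ltac:(lia) Hm).
    set (c := ts m) in *. set (sl := (q (S m) - q m) / (ts (S m) - c)).
    apply continuous_ext with (fun u => plus (pl ts q m (- Rmax (- u) (- c)))
        ((fun v => (- sl * c) + sl * v) (Rmax u c))).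
    { intros u. simpl. fold c. unfold plus; simpl.
      destruct (Rlt_dec u c).
      - rewrite Rmax_left, Rmax_right, Ropp_involutive by lra. lra.
      - rewrite Rmax_right, Rmax_left, Ropp_involutive by lra.
        unfold c at 1; rewrite pl_last by lia. unfold sl; field; lra. }
    apply (@continuous_plus R_UniformSpace R_AbsRing R_NormedModule).
    + apply (continuous_comp (fun u => - Rmax (- u) (- c)) (pl ts q m)).
      * apply (@continuous_opp R_UniformSpace R_AbsRing R_NormedModule).
        apply continuous_Rmax; [|apply continuous_const].
        apply (@continuous_opp R_UniformSpace R_AbsRing R_NormedModule), continuous_id.
      * apply IHm; lia.
    + apply (continuous_comp (fun u => Rmax u c) (fun v => (- sl * c) + sl * v)).
      * apply continuous_Rmax; [apply continuous_id | apply continuous_const].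
      * apply continuous_affine.
Qed.

Lemma Dist_continuous s t : continuous (D s) t.
Proof using Hv.
  unfold D, Dist. induction (seq 0 n) as [|q l IH]; simpl.
  - apply continuous_const.
  - apply continuous_Rmax; auto.
    apply (continuous_comp (fun u => traj tau ts ps s u - traj tau ts ps q u) Rabs).
    + apply (@continuous_minus R_UniformSpace R_AbsRing R_NormedModule);
        apply pl_continuous; lia.
    + apply continuous_Rabs.
Qed.

Lemma Dist_pos_eq s q t : x s t = x q t -> D s t = D q t.
Proof. unfold x, D, Dist; intros ->; reflexivity. Qed.

Lemma fold_Rmax_char (l : list R) b :
  (forall y, In y l -> y <= b) -> 0 <= b -> (b = 0 \/ In b l) -> fold_right Rmax 0 l = b.
Proof.
  intros H H0 Hb. apply Rle_antisym.
  - clear Hb; induction l; simpl in *; auto. apply Rmax_lub; auto.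
  - destruct Hb as [->|Hb].
    + induction l; simpl in *; [lra|]. eapply Rle_trans; [|apply Rmax_r]. apply IHl; auto.
    + induction l; simpl in *; [tauto|]. destruct Hb as [->|Hb]; [apply Rmax_l|].
      eapply Rle_trans; [|apply Rmax_r]. auto.
Qed.

(** The farthest entity lies on one of the envelopes, and [max(p, q) = (p + q + |p - q|) / 2] is
    applied to the distances [p] to the upper and [q] to the lower one. The sign of [U + L - 2 s]
    tells which is larger. *)
Lemma Dist_envelope s u d t : (s < n)%nat -> (u < n)%nat -> (d < n)%nat ->
  (forall q, (q < n)%nat -> x d t <= x q t <= x u t) ->
  D s t = ((x u t - x d t) + Rabs (x u t + x d t - 2 * x s t)) / 2.
Proof.
  intros Hs Hu Hd H. unfold D, Dist. fold (x s t).
  pose proof (H s Hs).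
  apply fold_Rmax_char.
  - intros y Hy. apply in_map_iff in Hy; destruct Hy as (q & <- & Hq).
    apply in_seq in Hq. specialize (H q ltac:(lia)). fold (x q t).
    unfold Rabs; destruct (Rcase_abs _), (Rcase_abs _); lra.
  - unfold Rabs; destruct (Rcase_abs _); lra.
  - right. apply in_map_iff. unfold Rabs at 2; destruct (Rcase_abs _).
    + exists d; split; [|apply in_seq; lia]. fold (x d t). rewrite Rabs_right; lra.
    + exists u; split; [|apply in_seq; lia]. fold (x u t). rewrite Rabs_left1; lra.
Qed.

Definition Ic (s : nat) (a b : R) : R := RInt (D s) a b.

Lemma ex_Ic s a b : ex_RInt (D s) a b.
Proof using Hv. apply (@ex_RInt_continuous R_CompleteNormedModule). intros; apply Dist_continuous. Qed.

Lemma is_Ic s a b : is_RInt (D s) a b (Ic s a b).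
Proof using Hv. apply (@RInt_correct R_CompleteNormedModule), ex_Ic. Qed.

Lemma Ic_split s a b c : Ic s a c = Ic s a b + Ic s b c.
Proof using Hv.
  symmetry. apply (@RInt_Chasles R_CompleteNormedModule); apply ex_Ic.
Qed.

Lemma Ic_refl s a : Ic s a a = 0.
Proof. apply (@RInt_point R_CompleteNormedModule). Qed.

Lemma Ic_pos_eq s q a b : a <= b -> (forall w, a <= w <= b -> x s w = x q w) -> Ic s a b = Ic q a b.
Proof.
  intros H E. unfold Ic. apply (@RInt_ext R_CompleteNormedModule). intros w Hw. rewrite Rmin_left, Rmax_right in Hw by lra.
  apply Dist_pos_eq, E; lra.
Qed.

(** * The value function of a log of switches *)

Definition entry : Type := (R * nat * nat)%type.

(* Newest entry first; [(u, i, j)] means that from time [u] on the best way to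
   follow [j] is to switch to it from [i]. *)
Fixpoint Phi (l : list entry) (s : nat) (t : R) : R :=
  match l with
  | [] => Ic s (ts 0) t
  | (u, i, j) :: l' =>
      if Nat.eqb s j then
        if Rle_dec u t then Phi l' i u + Ic s u t else Phi l' s t
      else Phi l' s t
  end.

(** Times do not increase towards the tail, and a switch is logged only if it is a strict gain. This
    makes every entry a downward jump of [Phi] and excludes [i = j]. *)
Fixpoint vlog (T : R) (l : list entry) : Prop :=
  match l with
  | [] => True
  | (u, i, j) :: l' =>
      (ts 0 <= u <= T /\ (i < n)%nat /\ (j < n)%nat /\ x i u = x j u /\
       Phi l' i u < Phi l' j u) /\ vlog u l'
  end.

Lemma vlog_mono T T' l : T <= T' -> vlog T l -> vlog T' l.
Proof. destruct l as [|[[u i] j] l]; simpl; auto. intros; intuition lra. Qed.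

(** Between entries the value grows exactly by the cost of staying, and at an entry it only jumps
    down. *)
Lemma Phi_step T l s a b : vlog T l -> a <= b -> Phi l s b <= Phi l s a + Ic s a b.
Proof using Hv.
  revert T s a b; induction l as [|[[u i] j] l IH]; simpl; intros T s a b V Hab.
  - rewrite (Ic_split s (ts 0) a b). lra.
  - destruct V as [(Hu & Hi & Hj & Hx & HP) V]. specialize (IH u) as IHu.
    destruct (Nat.eqb_spec s j); [subst|eauto].
    destruct (Rle_dec u b), (Rle_dec u a); try lra; eauto.
    + rewrite (Ic_split j u a b). lra.
    + pose proof (IHu j a u V ltac:(lra)). rewrite (Ic_split j a u b). lra.
Qed.

Lemma Phi_start T l s : vlog T l -> Phi l s (ts 0) <= 0.
Proof.
  revert T s; induction l as [|[[u i] j] l IH]; simpl; intros T s V.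
  - rewrite Ic_refl; lra.
  - destruct V as [(Hu & _) V]. destruct (Nat.eqb s j); eauto.
    destruct (Rle_dec u (ts 0)); eauto. assert (u = ts 0) as -> by lra.
    rewrite Ic_refl. specialize (IH _ i V). lra.
Qed.

(** After the newest entry no jump is left, so [Phi_step] becomes an equality. *)
Lemma Phi_advance T l s u t : vlog T l -> T <= u -> u <= t -> ts 0 <= u ->
  Phi l s t = Phi l s u + Ic s u t.
Proof using Hv.
  revert T s; induction l as [|[[v i] j] l IH]; simpl; intros T s V Hu Ht H0.
  - apply Ic_split.
  - destruct V as [(Hv' & _) V].
    destruct (Nat.eqb s j).
    + destruct (Rle_dec v t), (Rle_dec v u); try lra. rewrite (Ic_split s v u t); lra.
    + apply (IH v); auto; lra.
Qed.

(** The new entry changes only the value of [j], downwards and from [u] on, so the inequality is in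
    danger only for [s = j]. This is where general position enters. *)
Lemma relax_keep T u i j l s q t : vlog T ((u, i, j) :: l) ->
  (s < n)%nat -> (q < n)%nat -> u <= ts tau ->
  (u <= t -> forall w, u <= w <= t -> x s w = x q w) ->
  Phi l q t <= Phi l s t -> Phi ((u, i, j) :: l) q t <= Phi ((u, i, j) :: l) s t.
Proof using Hv.
  intros V Hs Hq Hut E H. simpl in *.
  destruct V as [(Hu & Hi & Hj & Hx & HP) V].
  destruct (Rle_dec u t) as [Hle|]; [|destruct (Nat.eqb s j), (Nat.eqb q j); auto].
  specialize (E Hle).
  destruct (Nat.eqb_spec s j), (Nat.eqb_spec q j); try lra.
  - subst; lra.
  (* Here [q] is with [j] at time [u], and so is [i]; hence [q = i]. The new value of [j] is that of
     [i] at [u] plus the cost of the common way, and [Phi_step] bounds the value of [i] by it. *)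
  - subst. assert (q = i).
    { destruct (Nat.eq_dec q i); auto. exfalso.
      destruct (Nat.eq_dec i j); [subst; lra|].
      destruct Hv as (_ & _ & _ & G). apply (G q i j u); auto; [lra|].
      fold (x q u) (x i u) (x j u). rewrite <- (E u) by lra. auto. }
    subst q. rewrite (Ic_pos_eq j i u t) by auto.
    apply (Phi_step u l i u t); auto.
  - subst. rewrite (Phi_advance u l s u t) in H by (auto; lra).
    rewrite (Phi_advance u l j u t) in H by (auto; lra).
    rewrite (Phi_advance u l s u t) by (auto; lra). lra.
Qed.

(** The switch makes both values equal at [u], and travelling together adds the same cost to both.
    This covers crossings, with [t = u], and coinciding lines alike. *)
Lemma relax_new T u i j l t : vlog T ((u, i, j) :: l) ->
  u <= t -> (forall w, u <= w <= t -> x i w = x j w) ->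
  Phi ((u, i, j) :: l) j t <= Phi ((u, i, j) :: l) i t.
Proof using Hv.
  simpl; intros [(Hu & Hi & Hj & Hx & HP) V] Ht E.
  rewrite Nat.eqb_refl. destruct (Rle_dec u t); [|lra].
  destruct (Nat.eqb_spec i j); [subst; lra|].
  rewrite (Phi_advance u l i u t) by (auto; lra).
  rewrite (Ic_pos_eq i j u t) by auto. lra.
Qed.

Lemma norelax_new T u i j l t : vlog T l -> T <= u -> ts 0 <= u -> Phi l j u <= Phi l i u ->
  u <= t -> (forall w, u <= w <= t -> x i w = x j w) -> Phi l j t <= Phi l i t.
Proof using Hv.
  intros V HT H0 H Ht E. rewrite !(Phi_advance T l _ u t) by auto.
  rewrite (Ic_pos_eq i j u t) by auto. lra.
Qed.

(** * Every trajectoid costs at least the final value *)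

(** Induction along an interval, through the supremum of the points reached. It fits trajectoids,
    which are specified only in a neighbourhood of each time. *)
Lemma real_induction (P : R -> Prop) a b : a <= b -> P a ->
  (forall t, a <= t <= b -> exists d, 0 < d /\
     (forall s, t - d < s < t -> a <= s -> P s -> P t) /\
     (forall s, t < s < t + d -> s <= b -> P t -> P s)) ->
  P b.
Proof.
  intros Hab Pa H.
  set (E := fun t => a <= t <= b /\ P t).
  destruct (completeness E) as (c & Hub & Hlub).
  - exists b; intros t [Ht _]; lra.
  - exists a; split; [lra | auto].
  - assert (Hac : a <= c) by (apply Hub; split; [lra|auto]).
    assert (Hcb : c <= b) by (apply Hlub; intros t [Ht _]; lra).
    destruct (H c) as (d & Hd & HL & HR); [lra|].
    assert (Pc : P c).
    { destruct (Classical_Prop.classic (P c)) as [|NP]; auto.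
      exfalso. assert (is_upper_bound E (c - d)).
      { intros t [Ht Pt]. destruct (Rle_dec t (c - d)); auto. exfalso; apply NP.
        assert (t <= c) by (apply Hub; split; auto).
        destruct (Req_dec t c); [subst; auto|]. apply (HL t); auto; lra. }
      apply Hlub in H0; lra. }
    destruct (Req_dec c b); [subst; auto|].
    set (s := Rmin b (c + d / 2)).
    assert (c < s) by (unfold s; apply Rmin_glb_lt; lra).
    assert (s <= b) by apply Rmin_l. assert (s <= c + d / 2) by apply Rmin_r.
    assert (E s) by (split; [lra | apply HR; auto; lra]).
    apply Hub in H4; lra.
Qed.

Lemma Phi_lower_bound T l Tr : vlog T l ->
  (forall s q t, (s < n)%nat -> (q < n)%nat -> ts 0 <= t <= ts tau -> x s t = x q t ->
     Phi l q t <= Phi l s t) ->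
  trajectoid n tau ts ps Tr ->
  (Tr (ts tau) < n)%nat /\ Phi l (Tr (ts tau)) (ts tau) <= cost n tau ts ps Tr.
Proof using Hv.
  intros V P1 [HT HL]. pose proof (ts_le 0 tau ltac:(lia) ltac:(lia)) as H0.
  split; [apply HT; lra|].
  (* Integrability is proved together with the bound: [cost] is a total [RInt], meaningful only once
     the integrand along [Tr] is known to be integrable. *)
  assert (Q : exists v, is_RInt (fun t => D (Tr t) t) (ts 0) (ts tau) v /\
    Phi l (Tr (ts tau)) (ts tau) <= v).
  { apply (real_induction (fun t => exists v, is_RInt (fun t => D (Tr t) t) (ts 0) t v /\
      Phi l (Tr t) t <= v) (ts 0) (ts tau)); auto.
    - exists 0; split; [apply (@is_RInt_point R_NormedModule) | eapply Phi_start; eauto].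
    - intros t Ht. destruct (HL t Ht) as (d & Hd & a & b & Ha & Hb & Xa & Xb).
      exists d; split; [auto|]; split.
      + intros s Hs Has (v & Iv & Pv).
        assert (Ea := Ha s Hs Has).
        exists (v + Ic a s t); split.
        * apply (@is_RInt_Chasles R_NormedModule _ _ s); auto.
          apply is_RInt_ext with (D a); [|apply is_Ic].
          intros w Hw. rewrite Rmin_left, Rmax_right in Hw by lra. rewrite Ha by lra; auto.
        * assert ((a < n)%nat) by (rewrite <- Ea; apply HT; lra).
          (* A switch at [t] itself does not raise [Phi], since both entities are at the same
             position. *)
          apply Rle_trans with (Phi l a t).
          { apply P1; auto. }
          rewrite Ea in Pv. pose proof (Phi_step T l a s t V ltac:(lra)). lra.
      + intros s Hs Hbs (v & Iv & Pv).
        assert (Eb := Hb s Hs Hbs).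
        exists (v + Ic b t s); split.
        * apply (@is_RInt_Chasles R_NormedModule _ _ t); auto.
          apply is_RInt_ext with (D b); [|apply is_Ic].
          intros w Hw. rewrite Rmin_left, Rmax_right in Hw by lra. rewrite Hb by lra; auto.
        * assert ((b < n)%nat) by (rewrite <- Eb; apply HT; lra).
          rewrite Eb.
          assert (Phi l b t <= Phi l (Tr t) t) by (apply P1; auto).
          pose proof (Phi_step T l b t s V ltac:(lra)). lra. }
  destruct Q as (v & Iv & Pv). unfold cost.
  apply (@is_RInt_unique R_CompleteNormedModule) in Iv. unfold D in Iv; rewrite Iv; auto.
Qed.

(** * The trajectoid described by a log *)

(* Pieces are listed from the last to the first, as (entity, end time). *)
Fixpoint pcs (l : list entry) (s : nat) (en : R) : list (nat * R) :=
  match l with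
  | [] => [(s, en)]
  | (u, i, j) :: l' => if Nat.eqb s j then (s, en) :: pcs l' i u else pcs l' s en
  end.

(** The choice at [t] looks at the end of the preceding piece; the end of the last piece is never
    tested, as in [first_piece]. The 0 for the empty list is a dummy, excluded by [okp]. *)
Fixpoint Tp (P : list (nat * R)) (t : R) : nat :=
  match P with
  | [] => 0%nat
  | (s, _) :: P' =>
      match P' with
      | [] => s
      | (_, r) :: _ => if Rlt_dec t r then Tp P' t else s
      end
  end.

Fixpoint pcost (P : list (nat * R)) : R :=
  match P with
  | [] => 0
  | (s, en) :: P' =>
      match P' with
      | [] => Ic s (ts 0) en
      | (_, r) :: _ => pcost P' + Ic s r en
      end
  end.

Fixpoint okp (P : list (nat * R)) : Prop :=
  match P with
  | [] => False
  | (s, en) :: P' =>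
      (s < n)%nat /\ ts 0 <= en /\
      match P' with
      | [] => True
      | (s', r) :: _ => r <= en /\ x s r = x s' r /\ okp P'
      end
  end.

Lemma pcs_head l s en : exists P, pcs l s en = (s, en) :: P.
Proof.
  induction l as [|[[u i] j] l IH]; simpl; eauto. destruct (Nat.eqb s j); eauto.
Qed.

Lemma pcs_ok T l s en : vlog T l -> T <= en -> ts 0 <= en -> (s < n)%nat ->
  okp (pcs l s en).
Proof.
  revert T s en; induction l as [|[[u i] j] l IH]; simpl; intros T s en V HT H0 Hs; auto.
  destruct V as [(Hu & Hi & Hj & Hx & _) V].
  destruct (Nat.eqb_spec s j).
  - subst. specialize (IH u i u V ltac:(lra) ltac:(lra) Hi).
    destruct (pcs_head l i u) as (P & E); rewrite E in *. simpl.
    repeat split; auto; try lra; apply IH.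
  - apply (IH u); auto; lra.
Qed.

Lemma pcs_cost T l s en : vlog T l -> T <= en -> pcost (pcs l s en) = Phi l s en.
Proof.
  revert T s en; induction l as [|[[u i] j] l IH]; simpl; intros T s en V HT; auto.
  destruct V as [(Hu & _) V].
  destruct (Nat.eqb_spec s j).
  - subst. destruct (Rle_dec u en); [|lra].
    rewrite <- (IH u i u V) by lra.
    destruct (pcs_head l i u) as (P & E); rewrite E. reflexivity.
  - apply (IH u); auto; lra.
Qed.

Lemma pcs_length l s en : (length (pcs l s en) <= S (length l))%nat.
Proof.
  revert s en; induction l as [|[[u i] j] l IH]; simpl; intros; auto.
  destruct (Nat.eqb s j); simpl; [apply le_n_S; apply IH|].
  eapply Nat.le_trans; [apply IH|lia].
Qed.

Lemma Tp_after s en P t : okp ((s, en) :: P) -> en <= t -> Tp ((s, en) :: P) t = s.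
Proof.
  simpl; intros (_ & _ & H) Ht. destruct P as [|[s' r] P]; auto.
  destruct (Rlt_dec t r); auto. lra.
Qed.

Lemma Tp_lt P t : okp P -> (Tp P t < n)%nat.
Proof.
  induction P as [|[s en] P IH]; [simpl; tauto|]. cbn [okp Tp]. intros (H & _ & HP).
  destruct P as [|[s' r] P]; auto. destruct (Rlt_dec t r); auto. apply IH; tauto.
Qed.

Lemma Tp_local P t : okp P -> exists delta, 0 < delta /\ exists a b : nat,
   (forall s, t - delta < s < t -> Tp P s = a) /\
   (forall s, t < s < t + delta -> Tp P s = b) /\
   x a t = x (Tp P t) t /\ x b t = x (Tp P t) t.
Proof.
  induction P as [|[s en] P IH]; [simpl; tauto|]. cbn [okp Tp]. intros (H & H0 & HP).
  destruct P as [|[s' r] P].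
  - exists 1; split; [lra|]. exists s, s; auto.
  - destruct HP as (Hr & Hx & OK). destruct (IH OK) as (d & Hd & a & b & Ha & Hb & Xa & Xb).
    destruct (Rtotal_order t r) as [Hlt|[->|Hgt]].
    + exists (Rmin d (r - t)); split; [apply Rmin_glb_lt; lra|].
      pose proof (Rmin_l d (r - t)); pose proof (Rmin_r d (r - t)).
      exists a, b; split; [|split].
      * intros w Hw. destruct (Rlt_dec w r); [|lra]. apply Ha; lra.
      * intros w Hw. destruct (Rlt_dec w r); [|lra]. apply Hb; lra.
      * destruct (Rlt_dec t r); [|lra]. auto.
    (* At the joint the left neighbourhood comes from the earlier pieces and the right one from [s];
       by [okp] the two entities meet there. *)
    + exists d; split; auto. exists a, s; split; [|split].
      * intros w Hw. destruct (Rlt_dec w r); [|lra]. apply Ha; lra.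
      * intros w Hw. destruct (Rlt_dec w r); [lra|auto].
      * destruct (Rlt_dec r r); [lra|]. split; auto.
        rewrite Xa, Hx. rewrite Tp_after; auto; lra.
    + exists (t - r); split; [lra|]. exists s, s; split; [|split].
      * intros w Hw. destruct (Rlt_dec w r); [lra|auto].
      * intros w Hw. destruct (Rlt_dec w r); [lra|auto].
      * destruct (Rlt_dec t r); [lra|auto].
Qed.

Lemma Tp_cost s en P : okp ((s, en) :: P) ->
  is_RInt (fun t => D (Tp ((s, en) :: P) t) t) (ts 0) en (pcost ((s, en) :: P)).
Proof using Hv.
  revert s en; induction P as [|[s' r] P IH]; intros s en OK.
  - apply is_Ic.
  - cbn [okp] in OK. destruct OK as (Hs & H0 & Hr & Hx & OK).
    assert (ts 0 <= r) by (cbn [okp] in OK; tauto).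
    change (pcost ((s, en) :: (s', r) :: P)) with (pcost ((s', r) :: P) + Ic s r en).
    apply (@is_RInt_Chasles R_NormedModule _ _ r).
    + eapply is_RInt_ext; [|apply IH; auto].
      intros w Hw. rewrite Rmin_left, Rmax_right in Hw by lra.
      cbn [Tp]. destruct (Rlt_dec w r); [reflexivity|lra].
    + apply is_RInt_ext with (D s); [|apply is_Ic].
      intros w Hw. rewrite Rmin_left, Rmax_right in Hw by lra.
      cbn [Tp]. destruct (Rlt_dec w r); [lra|reflexivity].
Qed.

(** [first_piece] tests end times from the earliest on, [Tp] from the latest; for sorted end times
    the last test may be made first. *)
Lemma first_piece_snoc rs t f i : (forall a b, (i <= a <= b)%nat -> (b <= i + f)%nat -> rs a <= rs b) ->
  first_piece rs (S f) i t =
  if Rlt_dec t (rs (i + f)%nat) then first_piece rs f i t else S (i + f).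
Proof.
  revert i; induction f; intros i Hm.
  - simpl; rewrite Nat.add_0_r; destruct (Rlt_dec t (rs i)); auto.
  - change (first_piece rs (S (S f)) i t) with
      (if Rlt_dec t (rs i) then i else first_piece rs (S f) (S i) t).
    rewrite IHf by (intros; apply Hm; lia). cbn [first_piece].
    rewrite Nat.add_succ_comm.
    destruct (Rlt_dec t (rs i)); auto.
    destruct (Rlt_dec t (rs (i + S f)%nat)); auto.
    specialize (Hm i (i + S f)%nat ltac:(lia) ltac:(lia)). lra.
Qed.

Lemma okp_sorted P a b : okp P -> (a <= b < length P)%nat ->
  snd (nth b P (0%nat, 0)) <= snd (nth a P (0%nat, 0)).
Proof.
  revert a b; induction P as [|[s en] P IH]; [simpl; tauto|]. cbn [okp length].
  intros a b (H & H0 & HP) Hab. destruct P as [|[s' r] P].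
  - simpl in Hab. replace a with 0%nat by lia. replace b with 0%nat by lia. simpl; lra.
  - destruct HP as (Hr & _ & OK). destruct b; [replace a with 0%nat by lia; lra|].
    change (nth (S b) ((s, en) :: (s', r) :: P) (0%nat, 0)) with (nth b ((s', r) :: P) (0%nat, 0)).
    destruct a.
    + specialize (IH 0%nat b OK ltac:(simpl in *; lia)). simpl in IH |- *; lra.
    + change (nth (S a) ((s, en) :: (s', r) :: P) (0%nat, 0)) with (nth a ((s', r) :: P) (0%nat, 0)).
      apply IH; auto; simpl in *; lia.
Qed.

Lemma decode_pieces P es rs t : okp P ->
  (forall i, (i < length P)%nat -> nth (length P - 1 - i) P (0%nat, 0) = (es i, rs i)) ->
  decode (length P) es rs t = Tp P t.
Proof.
  induction P as [|[s en] P IH]; [simpl; tauto|]. intros OK E.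
  destruct P as [|[s' r] P].
  - specialize (E 0%nat ltac:(simpl; lia)). simpl in E. injection E as -> ->. reflexivity.
  - assert (OK' := OK). cbn [okp] in OK'. destruct OK' as (_ & _ & _ & _ & OK').
    set (Q := (s', r) :: P) in *. unfold decode.
    assert (L : (length ((s, en) :: Q) - 1 = S (length Q - 1))%nat) by (unfold Q; simpl; lia).
    assert (LQ : length ((s, en) :: Q) = S (length Q)) by reflexivity.
    assert (LQ0 : (1 <= length Q)%nat) by (unfold Q; simpl; lia).
    rewrite L, first_piece_snoc.
    + rewrite Nat.add_0_l.
      assert (Er : nth 0 Q (0%nat, 0) = (es (length Q - 1)%nat, rs (length Q - 1)%nat)).
      { rewrite <- (E (length Q - 1)%nat) by (rewrite LQ; lia). rewrite L.
        replace (S (length Q - 1) - (length Q - 1))%nat with 1%nat by lia. reflexivity. }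
      assert (Es : (s, en) = (es (S (length Q - 1)), rs (S (length Q - 1)))).
      { rewrite <- (E (S (length Q - 1))) by (rewrite LQ; lia). rewrite L, Nat.sub_diag.
        reflexivity. }
      injection Es as Es1 Es2.
      assert (Er2 : rs (length Q - 1)%nat = r).
      { change r with (snd (nth 0 Q (0%nat, 0))). rewrite Er; reflexivity. }
      rewrite Er2. change (Tp ((s, en) :: Q) t) with (if Rlt_dec t r then Tp Q t else s).
      destruct (Rlt_dec t r); [|auto].
      change (decode (length Q) es rs t = Tp Q t). apply IH; auto.
      intros i Hi. rewrite <- E by (rewrite LQ; lia). rewrite L.
      replace (S (length Q - 1) - i)%nat with (S (length Q - 1 - i)) by lia. reflexivity.
    + intros a b Hab Hb.
      assert (Ra : forall i, (i <= length Q - 1)%nat ->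
        rs i = snd (nth (length ((s, en) :: Q) - 1 - i) ((s, en) :: Q) (0%nat, 0))).
      { intros i Hi; rewrite E by (rewrite LQ; lia); reflexivity. }
      rewrite (Ra a), (Ra b) by lia. apply okp_sorted; auto. rewrite L, LQ; lia.
Qed.

(** The decoded pieces cost [Phi] of the best final entity, which is at most [Phi] of the final
    entity of any competitor, which is at most the cost of that competitor. *)
Lemma output_optimal T l s M : vlog T l -> T <= ts tau -> (s < n)%nat ->
  (forall s q t, (s < n)%nat -> (q < n)%nat -> ts 0 <= t <= ts tau -> x s t = x q t ->
     Phi l q t <= Phi l s t) ->
  (forall q, (q < n)%nat -> Phi l s (ts tau) <= Phi l q (ts tau)) ->
  (let P := pcs l s (ts tau) in
   M 0%nat = INR (length P) /\
   forall i, (i < length P)%nat ->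
     M (1 + 2 * i)%nat = INR (fst (nth (length P - 1 - i) P (0%nat, 0))) /\
     M (2 + 2 * i)%nat = snd (nth (length P - 1 - i) P (0%nat, 0))) ->
  output_central n tau ts ps M.
Proof using Hv.
  intros V HT Hs P1 Hmin [M0 MP]. set (P := pcs l s (ts tau)) in *.
  pose proof (ts_le 0 tau ltac:(lia) ltac:(lia)) as H0.
  assert (OK : okp P) by (eapply pcs_ok; eauto).
  set (es := fun i => fst (nth (length P - 1 - i) P (0%nat, 0))).
  set (rs := fun i => snd (nth (length P - 1 - i) P (0%nat, 0))).
  assert (DE : forall t, decode (length P) es rs t = Tp P t).
  { intros t; apply decode_pieces; auto. intros; unfold es, rs; destruct nth; auto. }
  exists (length P), es, rs. split; [auto|]. split.
  { unfold P; destruct (pcs_head l s (ts tau)) as (Q & ->); simpl; lia. }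
  split; [exact MP|]. split.
  - split.
    + intros t Ht. rewrite DE. apply Tp_lt; auto.
    + intros t Ht. destruct (Tp_local P t OK) as (d & Hd & a & b & Ha & Hb & Xa & Xb).
      exists d; split; auto. exists a, b. rewrite DE. repeat split; auto.
      * intros w Hw _; rewrite DE; auto.
      * intros w Hw _; rewrite DE; auto.
  - intros T' HT'. destruct (Phi_lower_bound T l T' V P1 HT') as [Hn' Hle].
    eapply Rle_trans; [|exact Hle]. eapply Rle_trans; [|apply Hmin; auto].
    rewrite <- (pcs_cost T l s (ts tau) V HT). fold P. right.
    unfold cost. apply (@is_RInt_unique R_CompleteNormedModule).
    destruct (pcs_head l s (ts tau)) as (Q & E). fold P in E. rewrite E in *.
    eapply is_RInt_ext; [|apply Tp_cost; auto].
    intros w _. cbv beta. rewrite DE. reflexivity.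
Qed.

End Trajectories.

(** * Weakest preconditions with running times *)

(** Total correctness: the existential asserts termination, and the exact number of steps is handed
    to the postcondition. *)
Definition wp (B : nat) (c : cmd) (Q : st -> nat -> Prop) (s : st) : Prop :=
  exists k s', exec B c s k s' /\ Q s' k.

Section WP.
Variable B : nat.

Lemma wp_mono c (Q Q' : st -> nat -> Prop) s :
  wp B c Q s -> (forall s' k, Q s' k -> Q' s' k) -> wp B c Q' s.
Proof. intros (k & s' & E & H) HQ; exists k, s'; auto. Qed.

Lemma wp_skip (Q : st -> nat -> Prop) s : Q s 0%nat -> wp B Skip Q s.
Proof. intros; exists 0%nat, s; split; auto; constructor. Qed.

Lemma wp_nasn x e (Q : st -> nat -> Prop) s k : (costN e + 2 = k)%nat ->
  dfN B s e -> Q (setn s x (evN s e)) k -> wp B (NAsn x e) Q s.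
Proof. intros <- ? ?; eexists _, _; split; [constructor|]; eauto. Qed.

Lemma wp_rasn x e (Q : st -> nat -> Prop) s k : (costR e + 2 = k)%nat ->
  dfR B s e -> Q (setr s x (evR s e)) k -> wp B (RAsn x e) Q s.
Proof. intros <- ? ?; eexists _, _; split; [constructor|]; eauto. Qed.

Lemma wp_nset a i e (Q : st -> nat -> Prop) s k : (costN i + costN e + 4 = k)%nat ->
  dfN B s i /\ dfN B s e /\ (evN s i < B)%nat ->
  Q (setna s a (evN s i) (evN s e)) k -> wp B (NSet a i e) Q s.
Proof. intros <- (? & ? & ?) ?; eexists _, _; split; [constructor|]; eauto. Qed.

Lemma wp_rset a i e (Q : st -> nat -> Prop) s k : (costN i + costR e + 4 = k)%nat ->
  dfN B s i /\ dfR B s e /\ rix B a (evN s i) ->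
  Q (setra s a (evN s i) (evR s e)) k -> wp B (RSet a i e) Q s.
Proof. intros <- (? & ? & ?) ?; eexists _, _; split; [constructor|]; eauto. Qed.

Lemma wp_seq c d (Q : st -> nat -> Prop) s :
  wp B c (fun s1 k1 => wp B d (fun s2 k2 => Q s2 (k1 + k2)%nat) s1) s -> wp B (Seq c d) Q s.
Proof.
  intros (k1 & s1 & E1 & k2 & s2 & E2 & H).
  exists (k1 + k2)%nat, s2; split; auto. econstructor; eauto.
Qed.

Lemma wp_if b c d (Q : st -> nat -> Prop) s kb : costC b = kb -> dfC B s b ->
  (holds s b -> wp B c (fun s' k => Q s' (kb + 1 + k)%nat) s) ->
  (~ holds s b -> wp B d (fun s' k => Q s' (kb + 2 + k)%nat) s) -> wp B (If b c d) Q s.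
Proof.
  intros <- D H1 H2. destruct (Classical_Prop.classic (holds s b)) as [H|H].
  - destruct (H1 H) as (k & s' & E & HQ). eexists _, _; split; [apply ex_if_t|]; eauto.
  - destruct (H2 H) as (k & s' & E & HQ). eexists _, _; split; [apply ex_if_f|]; eauto.
Qed.

(** The invariant takes the steps spent so far as an argument, so time bounds are part of it; [mu]
    only ensures termination. *)
Lemma wp_until (I : st -> nat -> Prop) (mu : st -> nat) b c (Q : st -> nat -> Prop) s kb :
  costC b = kb ->
  (forall s k, I s k -> dfC B s b /\
     (holds s b -> Q s (k + (kb + 1))%nat) /\
     (~ holds s b ->
        wp B c (fun s' k' => I s' (k + (kb + 2) + k')%nat /\ (mu s' < mu s)%nat) s)) ->
  I s 0%nat -> wp B (Until b c) Q s.
Proof.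
  intros <- H I0.
  assert (G : forall f s k, (mu s < f)%nat -> I s k ->
    exists k' s', exec B (Until b c) s k' s' /\ Q s' (k + k')%nat).
  { induction f; intros s0 k Hf HI; [lia|].
    destruct (H s0 k HI) as (D & Ht & Hn).
    destruct (Classical_Prop.classic (holds s0 b)) as [Hb|Hb].
    - eexists _, s0; split; [apply ex_until_t; auto|auto].
    - destruct (Hn Hb) as (k1 & s1 & E1 & HI1 & Hmu).
      destruct (IHf s1 _ ltac:(lia) HI1) as (k2 & s2 & E2 & HQ).
      exists (costC b + 2 + k1 + k2)%nat, s2; split.
      + eapply ex_until_f; eauto.
      + replace (k + (costC b + 2 + k1 + k2))%nat with (k + (costC b + 2) + k1 + k2)%nat by lia.
        auto. }
  destruct (G (S (mu s)) s 0%nat) as (k & s' & E & HQ); auto.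
  exists k, s'; auto.
Qed.

(** A syntactic over-approximation of what a command writes. Being computable, it lets frame
    conditions be discharged by [eq_refl]. *)
Fixpoint wn (c : cmd) (x : nat) : bool :=
  match c with
  | NAsn y _ => Nat.eqb x y
  | Seq c d | If _ c d => wn c x || wn d x
  | Until _ c => wn c x
  | _ => false
  end.

Fixpoint wr (c : cmd) (x : nat) : bool :=
  match c with
  | RAsn y _ => Nat.eqb x y
  | Seq c d | If _ c d => wr c x || wr d x
  | Until _ c => wr c x
  | _ => false
  end.

Fixpoint wna (c : cmd) (x : nat) : bool :=
  match c with
  | NSet y _ _ => Nat.eqb x y
  | Seq c d | If _ c d => wna c x || wna d x
  | Until _ c => wna c x
  | _ => false
  end.

Fixpoint wra (c : cmd) (x : nat) : bool :=
  match c with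
  | RSet y _ _ => Nat.eqb x y
  | Seq c d | If _ c d => wra c x || wra d x
  | Until _ c => wra c x
  | _ => false
  end.

Record frame (c : cmd) (s s' : st) : Prop := {
  fr_n : forall x, wn c x = false -> nv s' x = nv s x;
  fr_r : forall x, wr c x = false -> rv s' x = rv s x;
  fr_na : forall a, wna c a = false -> forall i, na s' a i = na s a i;
  fr_ra : forall a, wra c a = false -> forall i, ra s' a i = ra s a i }.

Lemma exec_frame c s k s' : exec B c s k s' -> frame c s s'.
Proof.
  induction 1; constructor; simpl; intros; auto;
    repeat match goal with
    | H : orb _ _ = false |- _ => apply Bool.orb_false_iff in H; destruct H
    | H : Nat.eqb _ _ = false |- _ => rewrite H; clear H
    end; auto;
    repeat match goal with H : frame _ _ _ |- _ => destruct H end; simpl in *; auto;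
    first [ etransitivity; [eapply fr_n1; eauto | eapply fr_n0; eauto]
          | etransitivity; [eapply fr_r1; eauto | eapply fr_r0; eauto]
          | etransitivity; [eapply fr_na1; eauto | eapply fr_na0; eauto]
          | etransitivity; [eapply fr_ra1; eauto | eapply fr_ra0; eauto]
          | etransitivity; [eapply fr_n0; eauto | eapply fr_n1; eauto]
          | etransitivity; [eapply fr_r0; eauto | eapply fr_r1; eauto]
          | etransitivity; [eapply fr_na0; eauto | eapply fr_na1; eauto]
          | etransitivity; [eapply fr_ra0; eauto | eapply fr_ra1; eauto] ].
Qed.

Lemma wp_frame c (Q : st -> nat -> Prop) s :
  wp B c (fun s' k => frame c s s' -> Q s' k) s -> wp B c Q s.
Proof. intros (k & s' & E & H); exists k, s'; split; auto. apply H; eapply exec_frame; eauto. Qed.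

Definition Loop (x : nat) (e : nexp) (body : cmd) : cmd :=
  Until (NLe e (NVar x)) (Seq body (NAsn x (NAdd (NVar x) (NCst 1)))).

Definition For (x : nat) (e : nexp) (body : cmd) : cmd :=
  Seq (NAsn x (NCst 0)) (Loop x e body).

(** Overhead of one round: [costN e + 4] for the test and its two jump instructions, 6 for the
    increment of the counter. *)
Definition cl (e : nexp) : nat := (costN e + 10)%nat.

(** The final test is cheaper than [cl e], so [Q] has to be stable under decreasing the time; in
    return the overhead is the same everywhere. *)
Lemma wp_loop (I : nat -> st -> nat -> Prop) i0 N x e body (Q : st -> nat -> Prop) s :
  wn body x = false ->
  (forall i s k, I i s k -> nv s x = i /\ dfN B s e /\ evN s e = N) ->
  (forall i s k, (i < N)%nat -> nv s x = i -> I i s k ->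
     wp B body (fun s' k' => I (S i) (setn s' x (S i)) (k + k' + cl e)%nat) s) ->
  I i0 s 0%nat -> (i0 <= N)%nat ->
  (forall s k, I N s k -> Q s (k + cl e)%nat) ->
  (forall s k k', (k <= k')%nat -> Q s k' -> Q s k) ->
  wp B (Loop x e body) Q s.
Proof.
  intros Hw Hx Hb I0 Hi HQ HQm. unfold Loop.
  assert (Hc : costC (NLe e (NVar x)) = (costN e + 2)%nat).
  { unfold costC, costN; simpl. rewrite length_app. simpl. rewrite (length_cN e T0 0). lia. }
  apply wp_until with (I := fun s k => I (nv s x) s k /\ (nv s x <= N)%nat) (mu := fun s => (N - nv s x)%nat) (kb := (costN e + 2)%nat); auto.
  - clear s I0. intros s k [HI Hle]. destruct (Hx _ _ _ HI) as (_ & D & E).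
    split; [simpl; auto|]. simpl. rewrite E. split.
    + intros Hle'. assert (EN : nv s x = N) by lia. rewrite EN in HI.
      eapply HQm; [|apply HQ; eauto]. unfold cl; lia.
    + intros Hlt. apply wp_seq, wp_frame.
      eapply wp_mono; [apply (Hb (nv s x) s k); auto; lia|].
      intros s' k' H F. cbv beta in H. eapply wp_nasn; [reflexivity|simpl; auto|].
      simpl. rewrite Nat.eqb_refl. rewrite (fr_n _ _ _ F x Hw), Nat.add_1_r in *.
      split; [split|]; try lia.
      match goal with |- I _ _ ?z => replace z with (k + k' + cl e)%nat end; auto.
      unfold cl, costN; simpl; lia.
  - destruct (Hx _ _ _ I0) as (E & _). rewrite E; auto.
Qed.

End WP.

Arguments fr_n {c s s'} _ _ _.
Arguments fr_r {c s s'} _ _ _.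
Arguments fr_na {c s s'} _ _ _ _.
Arguments fr_ra {c s s'} _ _ _ _.

(* Follows unmodified variables and array cells back through the frames in the context. *)
Ltac unch := repeat match goal with
  | F : frame _ _ ?s |- context [nv ?s ?x] => rewrite (fr_n F x eq_refl)
  | F : frame _ _ ?s |- context [rv ?s ?x] => rewrite (fr_r F x eq_refl)
  | F : frame _ _ ?s |- context [na ?s ?a _] => rewrite (fr_na F a eq_refl)
  | F : frame _ _ ?s |- context [ra ?s ?a _] => rewrite (fr_ra F a eq_refl)
  | s := _ : st |- _ => progress (unfold s; cbn [nv rv na ra setn setr setna setra Nat.eqb])
  end; auto.

Tactic Notation "call" uconstr(H) := apply wp_frame; eapply wp_mono; [apply H|].

Ltac scbn := cbn [nv rv na ra setn setr setna setra evN evR dfN dfR dfC holds Nat.eqb].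
Ltac scbn_in H := cbn [nv rv na ra setn setr setna setra evN evR dfN dfR dfC holds Nat.eqb] in H.

Ltac wstep :=
  lazymatch goal with
  | |- wp _ (Seq _ _) _ _ => apply wp_seq
  | |- wp _ Skip _ _ => apply wp_skip
  | |- wp ?B (NAsn ?x ?e) ?Q ?s =>
      let k := eval vm_compute in (costN e + 2)%nat in
      apply (wp_nasn B x e Q s k eq_refl); scbn
  | |- wp ?B (RAsn ?x ?e) ?Q ?s =>
      let k := eval vm_compute in (costR e + 2)%nat in
      apply (wp_rasn B x e Q s k eq_refl); scbn
  | |- wp ?B (NSet ?a ?i ?e) ?Q ?s =>
      let k := eval vm_compute in (costN i + costN e + 4)%nat in
      apply (wp_nset B a i e Q s k eq_refl); scbn
  | |- wp ?B (RSet ?a ?i ?e) ?Q ?s =>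
      let k := eval vm_compute in (costN i + costR e + 4)%nat in
      apply (wp_rset B a i e Q s k eq_refl); scbn
  | |- wp ?B (If ?b ?c ?d) ?Q ?s =>
      let k := eval vm_compute in (costC b) in
      apply (wp_if B b c d Q s k eq_refl); scbn
  end.

(* Proves that a subcommand writes no more than the command containing it. *)
Ltac wsub :=
  match goal with H : ?w _ ?x = false |- ?w _ ?x = false =>
    revert H; cbn;
    repeat (match goal with |- context [Nat.eqb x ?k] => destruct (Nat.eqb x k) end;
            cbn; try discriminate); auto
  end.

Ltac frame_upd F :=
  constructor; cbn [nv rv na ra setn setr setna setra]; intros;
  repeat match goal with
  | H : _ = false |- context [Nat.eqb ?x ?y] =>
      destruct (Nat.eqb_spec x y); [subst; discriminate H|]
  end;
  try reflexivity; try (apply F; wsub).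

Lemma frame_refl c s : frame c s s.
Proof. constructor; auto. Qed.

Lemma frame_trans c c1 c2 s s1 s2 : frame c1 s s1 -> frame c2 s1 s2 ->
  (forall x, wn c x = false -> wn c1 x = false /\ wn c2 x = false) ->
  (forall x, wr c x = false -> wr c1 x = false /\ wr c2 x = false) ->
  (forall x, wna c x = false -> wna c1 x = false /\ wna c2 x = false) ->
  (forall x, wra c x = false -> wra c1 x = false /\ wra c2 x = false) ->
  frame c s s2.
Proof.
  intros [] [] Hn Hr Hna Hra; constructor; intros.
  - destruct (Hn x H). transitivity (nv s1 x); auto.
  - destruct (Hr x H). transitivity (rv s1 x); auto.
  - destruct (Hna a H). transitivity (na s1 a i); auto.
  - destruct (Hra a H). transitivity (ra s1 a i); auto.
Qed.

Ltac ftrans F1 F2 := apply (frame_trans _ _ _ _ _ _ F1 F2); intros; split; wsub.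

Notation vtau := 0%nat (only parsing).
Notation vn := 1%nat (only parsing).
Notation vk := 2%nat (only parsing).
Notation vi := 3%nat (only parsing).
Notation vj := 4%nat (only parsing).
Notation ve := 5%nat (only parsing).
Notation vN := 6%nat (only parsing).
Notation vtop := 7%nat (only parsing).
Notation vbot := 8%nat (only parsing).
Notation vs := 9%nat (only parsing).
Notation vcnt := 10%nat (only parsing).
Notation vx := 11%nat (only parsing).
Notation vw := 12%nat (only parsing).
Notation vlo := 13%nat (only parsing).
Notation vmid := 14%nat (only parsing).
Notation vhi := 15%nat (only parsing).
Notation va := 16%nat (only parsing).
Notation vb := 17%nat (only parsing).
Notation vc := 18%nat (only parsing).
Notation vm := 19%nat (only parsing).
Notation vcur := 20%nat (only parsing).
Notation aEU := 7%nat (only parsing).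
Notation bO := 2%nat (only parsing).
Notation bT := 3%nat (only parsing).

(** * Merge sort *)

Definition take (v : nat) : cmd :=
  Seq (NSet bT (NVar vc) (NGet bO (NVar v))) (NAsn v (NAdd (NVar v) (NCst 1))).

Definition merge_cmd : cmd :=
  Until (NLe (NVar vhi) (NVar vc))
    (Seq
      (If (NLe (NVar vhi) (NVar vb)) (take va)
        (If (NLe (NVar vmid) (NVar va)) (take vb)
          (If (RLe (RGet aEU (NGet bO (NVar va))) (RGet aEU (NGet bO (NVar vb))))
            (take va) (take vb))))
      (NAsn vc (NAdd (NVar vc) (NCst 1)))).

Definition pass_cmd : cmd :=
  Until (NLe (NVar vN) (NVar vlo))
    (Seq (NAsn vmid (NAdd (NVar vlo) (NVar vw)))
    (Seq (If (NLe (NVar vN) (NVar vmid)) (NAsn vmid (NVar vN)) Skip)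
    (Seq (NAsn vhi (NAdd (NVar vmid) (NVar vw)))
    (Seq (If (NLe (NVar vN) (NVar vhi)) (NAsn vhi (NVar vN)) Skip)
    (Seq (NAsn va (NVar vlo))
    (Seq (NAsn vb (NVar vmid))
    (Seq (NAsn vc (NVar vlo))
    (Seq merge_cmd
         (NAsn vlo (NVar vhi)))))))))).

Definition sort_cmd : cmd :=
  Seq (NAsn vw (NCst 1))
    (Until (NLe (NVar vN) (NVar vw))
      (Seq (NAsn vlo (NCst 0))
      (Seq pass_cmd
      (Seq (For vx (NVar vN) (NSet bO (NVar vx) (NGet bT (NVar vx))))
           (NAsn vw (NAdd (NVar vw) (NVar vw))))))).

Section Sort.
Variables (B N : nat).
Hypothesis HN : (N <= B)%nat.

(** Invariant of bottom-up merge sort, with blocks aligned at multiples of [w]; [L] cuts off what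
    the current pass has not produced yet. *)
Definition sortedBlk (key : nat -> R) (w L : nat) (f : nat -> nat) : Prop :=
  forall q y z, (q * w <= y)%nat -> (y <= z)%nat -> (z < q * w + w)%nat -> (z < L)%nat ->
  key (f y) <= key (f z).

(** Weaker than being a permutation, but enough: the sweep only needs that every event is listed and
    that nothing else is. *)
Definition samemem (lo hi : nat) (f g : nat -> nat) : Prop :=
  (forall y, (lo <= y < hi)%nat -> exists z, (lo <= z < hi)%nat /\ f y = g z) /\
  (forall z, (lo <= z < hi)%nat -> exists y, (lo <= y < hi)%nat /\ f y = g z).

Record merged (key : nat -> R) (lo mid hi : nat) (O T : nat -> nat) (a b c : nat) : Prop := {
  mg_a : (lo <= a <= mid)%nat;
  mg_b : (mid <= b <= hi)%nat;
  mg_c : (c + mid = a + b)%nat;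
  mg_sort : forall y z, (lo <= y)%nat -> (y <= z)%nat -> (z < c)%nat -> key (T y) <= key (T z);
  mg_le : forall y z, (lo <= y < c)%nat -> (a <= z < mid \/ b <= z < hi)%nat ->
    key (T y) <= key (O z);
  mg_from : forall y, (lo <= y < c)%nat -> exists z, (lo <= z < hi)%nat /\ T y = O z;
  mg_to : forall z, (lo <= z < a \/ mid <= z < b)%nat -> exists y, (lo <= y < c)%nat /\ T y = O z }.

Lemma merged_step key lo mid hi O T a b c a' b' v :
  (forall y z, (lo <= y)%nat -> (y <= z)%nat -> (z < mid)%nat -> key (O y) <= key (O z)) ->
  (forall y z, (mid <= y)%nat -> (y <= z)%nat -> (z < hi)%nat -> key (O y) <= key (O z)) ->
  merged key lo mid hi O T a b c ->
  ((v = a /\ a' = S a /\ b' = b /\ (a < mid)%nat /\ ((hi <= b)%nat \/ key (O a) <= key (O b))) \/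
   (v = b /\ a' = a /\ b' = S b /\ (b < hi)%nat /\ ((mid <= a)%nat \/ key (O b) <= key (O a)))) ->
  merged key lo mid hi O (fun j => if Nat.eqb j c then O v else T j) a' b' (S c).
Proof.
  intros S1 S2 [Ha Hb Hc Hs Hle Hf Ht] Hcase.
  assert (Hvr : (a <= v < mid \/ b <= v < hi)%nat) by lia.
  (* The chosen [v] is a minimum of everything left: in its own block by sortedness, in the other
     one by comparison of the heads. *)
  assert (Hmin : forall z, (a' <= z < mid \/ b' <= z < hi)%nat -> key (O v) <= key (O z)).
  { intros z Hz. destruct Hcase as [(-> & -> & -> & Hlt & Hk)|(-> & -> & -> & Hlt & Hk)].
    - destruct Hz; [apply S1; lia|]. destruct Hk; [lia|].
      eapply Rle_trans; [eauto|]. apply S2; lia.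
    - destruct Hz; [|apply S2; lia]. destruct Hk; [lia|].
      eapply Rle_trans; [eauto|]. apply S1; lia. }
  constructor; try lia.
  - intros y z Hy Hyz Hz. destruct (Nat.eqb_spec z c), (Nat.eqb_spec y c); try lia.
    + lra.
    + apply Hle; auto; lia.
    + apply Hs; lia.
  - intros y z Hy Hz. destruct (Nat.eqb_spec y c).
    + auto.
    + apply Hle; lia.
  - intros y Hy. destruct (Nat.eqb_spec y c).
    + exists v; split; auto; lia.
    + apply Hf; lia.
  - intros z Hz. destruct (Nat.eq_dec z v).
    + exists c; rewrite Nat.eqb_refl; split; [lia | subst; auto].
    + destruct (Ht z) as (y & Hy & E); [lia|]. exists y; split; [lia|].
      destruct (Nat.eqb_spec y c); [lia|auto].
Qed.

Lemma merge_wp lo mid hi s :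
  (lo <= mid <= hi)%nat -> (hi <= B)%nat ->
  nv s vmid = mid -> nv s vhi = hi -> nv s va = lo -> nv s vb = mid -> nv s vc = lo ->
  (forall y, (y < hi)%nat -> (na s bO y < B)%nat) ->
  (forall y z, (lo <= y)%nat -> (y <= z)%nat -> (z < mid)%nat -> ra s aEU (na s bO y) <= ra s aEU (na s bO z)) ->
  (forall y z, (mid <= y)%nat -> (y <= z)%nat -> (z < hi)%nat -> ra s aEU (na s bO y) <= ra s aEU (na s bO z)) ->
  wp B merge_cmd (fun s' k =>
    (k <= 70 * (hi - lo) + 10)%nat /\
    (forall y z, (lo <= y)%nat -> (y <= z)%nat -> (z < hi)%nat ->
       ra s aEU (na s' bT y) <= ra s aEU (na s' bT z)) /\
    samemem lo hi (na s' bT) (na s bO) /\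
    (forall y, (y < lo)%nat -> na s' bT y = na s bT y)) s.
Proof.
  intros Hlo Hhi Em Eh Ea Eb Ec HO S1 S2.
  set (key := ra s aEU). set (O := na s bO) in *.
  apply wp_until with (kb := 4%nat)
    (I := fun s' k => frame merge_cmd s s' /\
       merged key lo mid hi O (na s' bT) (nv s' va) (nv s' vb) (nv s' vc) /\
       (k <= 70 * (nv s' vc - lo))%nat /\ (forall y, (y < lo)%nat -> na s' bT y = na s bT y))
    (mu := fun s' => (hi - nv s' vc)%nat).
  - reflexivity.
  - intros s1 k (F & M & Hk & Hlow). scbn.
    assert (Fm : nv s1 vmid = mid) by unch.
    assert (Fh : nv s1 vhi = hi) by unch.
    assert (FO : forall i, na s1 bO i = O i) by (intros; unch).
    assert (FE : forall i, ra s1 aEU i = key i) by (intros; unch).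
    rewrite Fh. split; [auto|]. split.
    + intros Hend. destruct M as [Ha Hb Hc Hs Hle Hf Ht].
      assert (nv s1 vc = hi) by lia. rewrite H in *.
      split; [lia|]. split; [auto|]. split; [|auto]. split.
      * intros y Hy; apply Hf; auto.
      * intros z Hz; apply Ht; lia.
    + intros Hgo. assert (Hgo' : (nv s1 vc < hi)%nat) by lia.
      assert (BO : forall y, (y < hi)%nat -> (na s1 bO y < B)%nat) by (intros; rewrite FO; auto).
      assert (Hlen := M). destruct Hlen as [Ha Hb Hc _ _ _ _].
      (* All four branches end with the same [take] and increment; [k'] bounds the cost of the tests
         passed on the way. *)
      assert (K : forall v a' b' k', (v = va \/ v = vb) ->
        (k' <= 40)%nat -> (nv s1 v < hi)%nat ->
        merged key lo mid hi O (fun j => if Nat.eqb j (nv s1 vc) then O (nv s1 v) else na s1 bT j)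
          a' b' (S (nv s1 vc)) ->
        (a' = if Nat.eqb v va then S (nv s1 va) else nv s1 va) ->
        (b' = if Nat.eqb v vb then S (nv s1 vb) else nv s1 vb) ->
        wp B (take v) (fun s2 k2 =>
          wp B (NAsn vc (NAdd (NVar vc) (NCst 1))) (fun s3 k3 =>
            (frame merge_cmd s s3 /\
             merged key lo mid hi O (na s3 bT) (nv s3 va) (nv s3 vb) (nv s3 vc) /\
             (k + 6 + (k' + k2 + k3) <= 70 * (nv s3 vc - lo))%nat /\
             (forall y, (y < lo)%nat -> na s3 bT y = na s bT y)) /\
            (hi - nv s3 vc < hi - nv s1 vc)%nat) s2) s1).
      { intros v a' b' k' Hv Hk' Hvh M' Ea' Eb'. unfold take.
        wstep. wstep. { repeat split; auto; lia. }
        wstep; [auto|]. wstep; [auto|].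
        assert (EQ : na s1 bO (nv s1 v) = O (nv s1 v)) by auto.
        destruct Hv as [->| ->]; cbn [Nat.eqb] in *; rewrite EQ; rewrite !Nat.add_1_r;
          subst a' b'.
        all: split; [|lia]; split; [|split; [exact M'|split; [lia|]]].
        1,3: frame_upd F.
        all: intros y Hy; destruct (Nat.eqb_spec y (nv s1 vc)); [lia|auto]. }
      apply wp_seq. wstep. { auto. }
      * intros Hb'. rewrite Fh in Hb'. eapply wp_mono.
        { apply (K va (S (nv s1 va)) (nv s1 vb) 6%nat); auto; try lia.
          - eapply merged_step; eauto. left; repeat split; auto; lia. }
        intros s2 k2 H. eapply wp_mono; [exact H|]. intros s3 k3 ((G1 & G2 & G3 & G4) & G5).
        split; auto. split; auto. split; auto. split; auto. lia.
      * intros Hb'. rewrite Fh in Hb'. wstep; [auto|..].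
        { intros Ha'. rewrite Fm in Ha'. eapply wp_mono.
          { apply (K vb (nv s1 va) (S (nv s1 vb)) 12%nat); auto; try lia.
            eapply merged_step; eauto. right; repeat split; auto; lia. }
          intros s2 k2 H. eapply wp_mono; [exact H|]. intros s3 k3 ((G1 & G2 & G3 & G4) & G5).
          split; auto. split; auto. split; auto. split; auto. lia. }
        { intros Ha'. rewrite Fm in Ha'. wstep.
          { repeat split; auto; try lia; try (apply BO; lia); discriminate. }
          - rewrite !FE, !FO. intros Hkey. eapply wp_mono.
            { apply (K va (S (nv s1 va)) (nv s1 vb) 40%nat); auto; try lia.
              eapply merged_step; eauto. left; repeat split; auto; lia. }
            intros s2 k2 H. eapply wp_mono; [exact H|]. intros s3 k3 ((G1 & G2 & G3 & G4) & G5).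
            split; auto. split; auto. split; auto. split; auto. lia.
          - rewrite !FE, !FO. intros Hkey. eapply wp_mono.
            { apply (K vb (nv s1 va) (S (nv s1 vb)) 40%nat); auto; try lia.
              eapply merged_step; eauto. right; repeat split; auto; try lia. right; lra. }
            intros s2 k2 H. eapply wp_mono; [exact H|]. intros s3 k3 ((G1 & G2 & G3 & G4) & G5).
            split; auto. split; auto. split; auto. split; auto. lia. }
  - split; [constructor; auto|]. rewrite Ea, Eb, Ec. split; [|split; [lia|auto]].
    constructor; try lia; intros; lia.
Qed.

Lemma pass_wp w s : (1 <= w)%nat -> nv s vN = N -> nv s vw = w -> nv s vlo = 0%nat ->
  (forall y, (y < N)%nat -> (na s bO y < B)%nat) ->
  sortedBlk (ra s aEU) w N (na s bO) ->
  wp B pass_cmd (fun s' k =>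
    (k <= 140 * N + 10)%nat /\
    sortedBlk (ra s aEU) (2 * w) N (na s' bT) /\ samemem 0 N (na s' bT) (na s bO)) s.
Proof.
  intros Hw EN Ew Elo HO S0. set (key := ra s aEU). set (O := na s bO) in *.
  apply wp_until with (kb := 4%nat)
    (I := fun s' k => frame pass_cmd s s' /\
       (exists q, nv s' vlo = Nat.min (q * (2 * w)) N) /\
       sortedBlk key (2 * w) (nv s' vlo) (na s' bT) /\
       samemem 0 (nv s' vlo) (na s' bT) O /\
       (k <= 140 * nv s' vlo)%nat)
    (mu := fun s' => (N - nv s' vlo)%nat).
  - reflexivity.
  - intros s1 k (F & (q & Hq) & HS & HM & Hk). scbn.
    assert (F1 : nv s1 vN = N) by unch.
    assert (F2 : nv s1 vw = w) by unch.
    assert (FO : forall i, na s1 bO i = O i) by (intros; unch).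
    assert (FE : forall i, ra s1 aEU i = key i) by (intros; unch).
    rewrite F1. split; [auto|]. split.
    + intros Hend. assert (E : nv s1 vlo = N) by lia. rewrite E in *. split; [lia|auto].
    + intros Hgo. set (lo := nv s1 vlo) in *.
      (* Since [lo < N], the minimum is its first argument, so the blocks to be merged are
         aligned. *)
      assert (Elo' : lo = (q * (2 * w))%nat) by lia.
      set (mid := Nat.min (lo + w) N). set (hi := Nat.min (mid + w) N).
      assert (G : forall s2 k2, frame pass_cmd s1 s2 ->
        (forall y, na s2 bT y = na s1 bT y) ->
        nv s2 vlo = lo -> nv s2 vmid = mid -> nv s2 vhi = hi -> nv s2 va = lo -> nv s2 vb = mid ->
        nv s2 vc = lo -> (k2 <= 50)%nat ->
        wp B (Seq merge_cmd (NAsn vlo (NVar vhi))) (fun s' k' =>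
          (frame pass_cmd s s' /\
           (exists q, nv s' vlo = Nat.min (q * (2 * w)) N) /\
           sortedBlk key (2 * w) (nv s' vlo) (na s' bT) /\
           samemem 0 (nv s' vlo) (na s' bT) O /\ (k + 6 + (k2 + k') <= 140 * nv s' vlo)%nat) /\
          (N - nv s' vlo < N - lo)%nat) s2).
      { intros s2 k2 F' ET El Em Eh Ea Eb Ec Hk2.
        assert (FO' : forall i, na s2 bO i = O i)
          by (intros; unch).
        assert (FE' : forall i, ra s2 aEU i = key i)
          by (intros; unch).
        wstep. apply wp_frame. eapply wp_mono.
        { apply (merge_wp lo mid hi s2); auto; try lia.
          - intros y Hy; rewrite FO'; apply HO; lia.
          (* The two halves are the blocks [2 * q] and [2 * q + 1] at width [w]. *)
          - intros y z Hy Hyz Hz; rewrite !FE', !FO'. apply (S0 (2 * q)%nat); lia.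
          - intros y z Hy Hyz Hz; rewrite !FE', !FO'. apply (S0 (2 * q + 1)%nat); lia. }
        intros s3 k3 (Hk3 & HS3 & HM3 & HL3) F3. cbv beta.
        assert (FE3 : forall i, ra s3 aEU i = key i)
          by (intros; unch).
        wstep; [auto|].
        rewrite (fr_n F3 vhi eq_refl), Eh.
        split; [|lia]. split; [|split; [|split; [|split]]].
        - assert (F5 : frame pass_cmd s s3).
          { assert (F4 : frame pass_cmd s s2) by ftrans F F'. ftrans F4 F3. }
          frame_upd F5.
        - exists (S q). lia.
        - intros r y z Hy Hyz Hz Hzh.
          destruct (Nat.lt_ge_cases z lo).
          + rewrite !HL3, !ET by lia. apply (HS r); auto.
          (* A block of width [2 * w] that reaches past [lo] is the one just merged. *)
          + assert (r = q).
            { assert (z < q * (2 * w) + 2 * w)%nat by lia.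
              assert (r * (2 * w) < (q + 1) * (2 * w))%nat by lia.
              assert (q * (2 * w) < (r + 1) * (2 * w))%nat by lia.
              apply Nat.mul_lt_mono_pos_r in H1; [|lia].
              apply Nat.mul_lt_mono_pos_r in H2; [|lia]. lia. }
            subst r. specialize (HS3 y z). rewrite !FE' in HS3. apply HS3; lia.
        - destruct HM as [HMa HMb], HM3 as [HM3a HM3b]. split.
          + intros y Hy. destruct (Nat.lt_ge_cases y lo).
            * rewrite HL3, ET by lia. destruct (HMa y) as (z & Hz & E); [lia|].
              exists z; split; [lia|auto].
            * destruct (HM3a y) as (z & Hz & E); [lia|]. exists z; rewrite <- FO'. split; [lia|auto].
          + intros z Hz. destruct (Nat.lt_ge_cases z lo).
            * destruct (HMb z) as (y & Hy & E); [lia|]. exists y; rewrite HL3, ET by lia.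
              split; [lia|auto].
            * destruct (HM3b z) as (y & Hy & E); [lia|]. exists y; rewrite <- FO'. split; [lia|auto].
        - lia. }
      wstep. wstep; [auto|]. rewrite F2. fold lo.
      wstep. wstep; [auto|..]; intros Hc1; rewrite F1 in Hc1.
      * wstep; [auto|]. rewrite F1.
        wstep. wstep; [auto|]. rewrite F2.
        wstep. wstep; [auto|..]; intros Hc2; rewrite F1 in Hc2; [|lia].
        wstep; [auto|]. rewrite F1.
        wstep. wstep; [auto|]. wstep. wstep; [auto|]. wstep. wstep; [auto|].
        eapply wp_mono; [apply G with (k2 := 50%nat); scbn; auto; try lia|].
        { frame_upd (frame_refl pass_cmd s1). }
        intros s' k' ((H1 & H2 & H3 & H4 & H5) & H6).
        split; [split; [exact H1|split; [exact H2|split; [exact H3|split; [exact H4|]]]]|exact H6].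
        lia.
      * wstep. wstep. wstep; [auto|]. rewrite F2.
        wstep. wstep; [auto|..]; intros Hc2; rewrite F1 in Hc2.
        -- wstep; [auto|]. rewrite F1.
        wstep. wstep; [auto|]. wstep. wstep; [auto|]. wstep. wstep; [auto|].
        eapply wp_mono; [apply G with (k2 := 50%nat); scbn; auto; try lia|].
        { frame_upd (frame_refl pass_cmd s1). }
        intros s' k' ((H1 & H2 & H3 & H4 & H5) & H6).
        split; [split; [exact H1|split; [exact H2|split; [exact H3|split; [exact H4|]]]]|exact H6].
        lia.
        -- wstep.
        wstep. wstep; [auto|]. wstep. wstep; [auto|]. wstep. wstep; [auto|].
        eapply wp_mono; [apply G with (k2 := 50%nat); scbn; auto; try lia|].
        { frame_upd (frame_refl pass_cmd s1). }
        intros s' k' ((H1 & H2 & H3 & H4 & H5) & H6).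
        split; [split; [exact H1|split; [exact H2|split; [exact H3|split; [exact H4|]]]]|exact H6].
        lia.
  - rewrite Elo. split; [constructor; auto|]. split; [exists 0%nat; lia|].
    split; [intros r y z; lia|]. split; [split; intros; lia|lia].
Qed.

Lemma copy_wp s : nv s vN = N ->
  wp B (For vx (NVar vN) (NSet bO (NVar vx) (NGet bT (NVar vx))))
    (fun s' k => (k <= 24 * N + 20)%nat /\ forall y, (y < N)%nat -> na s' bO y = na s bT y) s.
Proof.
  intros EN. unfold For. wstep. wstep; [auto|].
  apply wp_loop with (i0 := 0%nat) (N := N)
    (I := fun i s' k => nv s' vx = i /\ nv s' vN = N /\ (forall y, na s' bT y = na s bT y) /\
       (k <= 24 * i)%nat /\ forall y, (y < i)%nat -> na s' bO y = na s bT y).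
  - reflexivity.
  - intros i s1 k (H1 & H2 & _). simpl; auto.
  - intros i s1 k Hi _ (H1 & H2 & H3 & H4 & H5). wstep.
    { repeat split; auto; lia. }
    rewrite H1, H3. repeat split; auto; [unfold cl; simpl; unfold costN; simpl; lia|].
    intros y Hy. destruct (Nat.eqb_spec y i); [subst; auto|]. apply H5; lia.
  - scbn. repeat split; auto; intros; lia.
  - lia.
  - intros s1 k (H1 & H2 & H3 & H4 & H5). split; auto. unfold cl, costN; simpl; lia.
  - intros s1 k k' Hk [H1 H2]; split; auto; lia.
Qed.

Lemma samemem_trans L f g h : samemem 0 L f g -> samemem 0 L g h -> samemem 0 L f h.
Proof.
  intros [A1 A2] [C1 C2]; split.
  - intros y Hy. destruct (A1 y Hy) as (z & Hz & E). destruct (C1 z Hz) as (v & Hv & E').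
    exists v; split; congruence.
  - intros z Hz. destruct (C2 z Hz) as (v & Hv & E). destruct (A2 v Hv) as (y & Hy & E').
    exists y; split; congruence.
Qed.

(** [P] is the number of passes. The final width is [2 ^ P], and the last pass was made because half
    of it was still below [N]; this gives the logarithm later. *)
Lemma sort_wp s : nv s vN = N -> (forall y, (y < N)%nat -> (na s bO y < B)%nat) ->
  wp B sort_cmd (fun s' k =>
    (exists P, (k <= 200 * (N + 1) * (P + 1))%nat /\ (P = 0 \/ 2 ^ (P - 1) < N)%nat) /\
    (forall y z, (y <= z < N)%nat -> ra s aEU (na s' bO y) <= ra s aEU (na s' bO z)) /\
    samemem 0 N (na s' bO) (na s bO)) s.
Proof.
  intros EN HO. set (key := ra s aEU). unfold sort_cmd. wstep. wstep; [auto|].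
  apply wp_until with (kb := 4%nat)
    (I := fun s' k => frame sort_cmd s s' /\
       (exists P, nv s' vw = 2 ^ P /\ (k <= 200 * (N + 1) * P) /\ (P = 0 \/ 2 ^ (P - 1) < N))%nat /\
       sortedBlk key (nv s' vw) N (na s' bO) /\ samemem 0 N (na s' bO) (na s bO))
    (mu := fun s' => (N - nv s' vw)%nat).
  - reflexivity.
  - intros s1 k (F & (P & Ew & Hk & HP) & HS & HM). scbn.
    assert (F1 : nv s1 vN = N) by unch.
    assert (FE : forall i, ra s1 aEU i = key i) by (intros; unch).
    rewrite F1. split; [auto|]. split.
    + intros Hend. split; [exists P; split; [lia|auto]|]. split; auto.
      intros y z Hyz. apply (HS 0%nat); lia.
    + intros Hgo. assert (Hw : (1 <= nv s1 vw)%nat).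
      { rewrite Ew. pose proof (Nat.pow_nonzero 2 P). lia. }
      wstep. wstep; [auto|]. wstep. apply wp_frame. eapply wp_mono.
      { apply (pass_wp (nv s1 vw)); scbn; auto.
        - intros y Hy. destruct (proj1 HM y) as (z & Hz & ->); [lia|]. apply HO; lia.
        - intros q y z. rewrite !FE. apply HS. }
      intros s2 k2 (Hk2 & HS2 & HM2) F2. scbn_in HS2. scbn_in HM2.
      cbv beta. wstep. apply wp_frame. eapply wp_mono.
      { apply copy_wp. rewrite (fr_n F2 vN eq_refl); auto. }
      intros s3 k3 (Hk3 & HE3) F3. cbv beta. wstep; [auto|].
      rewrite (fr_n F3 vw eq_refl), (fr_n F2 vw eq_refl). scbn.
      split; [|lia]. split; [|split; [|split]].
      * assert (F4 : frame sort_cmd s s3).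
        { assert (F5 : frame sort_cmd s (setn s1 vlo 0)) by (frame_upd F).
          assert (F6 : frame sort_cmd s s2) by ftrans F5 F2. ftrans F6 F3. }
        frame_upd F4.
      * exists (S P). split; [simpl; lia|]. split; [lia|]. right.
        replace (S P - 1)%nat with P by lia. lia.
      * intros q y z Hy Hyz Hz HzN. rewrite !HE3 by lia.
        specialize (HS2 q y z). rewrite !FE in HS2. apply HS2; lia.
      * apply samemem_trans with (na s1 bO); auto. destruct HM2 as [A1 A2]. split.
        { intros y Hy. rewrite HE3 by lia. auto. }
        { intros z Hz. destruct (A2 z Hz) as (y & Hy & E). exists y. rewrite HE3 by lia. auto. }
  - scbn. split; [frame_upd (frame_refl sort_cmd s)|]. split; [exists 0%nat; simpl; lia|].
    split; [intros q y z Hy Hyz Hz; replace y with z by lia; lra|].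
    split; intros y Hy; exists y; auto.
Qed.

End Sort.

(** * Crossings and envelopes of lines *)

Definition lpos (X V : nat -> R) (tk : R) (s : nat) (t : R) : R := X s + V s * (t - tk).

(* Lines with equal slopes that meet at all coincide; their meeting is
   recorded at the start of the slab. *)
Definition etime (X V : nat -> R) (tk : R) (i j : nat) : R :=
  if Req_EM_T (V i) (V j) then tk else tk + (X i - X j) / (V j - V i).

(** The factors are the differences of positions at the two ends of a slab of length [h]; a
    nonpositive product detects a meeting without division. *)
Definition crosses (X V : nat -> R) (h : R) (i j : nat) : Prop :=
  (X i - X j) * (X i - X j + (V i - V j) * h) <= 0.

Lemma crossing_sound X V tk h i j : 0 < h -> crosses X V h i j ->
  tk <= etime X V tk i j <= tk + h /\
  lpos X V tk i (etime X V tk i j) = lpos X V tk j (etime X V tk i j).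
Proof.
  unfold crosses, etime, lpos; intros Hh H. destruct (Req_EM_T (V i) (V j)) as [E|E].
  - rewrite E in H. replace ((V j - V j) * h) with 0 in H by ring.
    assert (X i - X j = 0) by nra. split; [lra|]. rewrite E. lra.
  - set (d := X i - X j) in *. set (e := V j - V i).
    assert (He : e <> 0) by (unfold e; lra).
    replace ((V i - V j) * h) with (- e * h) in H by (unfold e; ring).
    (* [q] is the meeting time relative to [tk]; dividing the sign condition by [e * e] leaves
       [q * (q - h) <= 0]. *)
    set (q := d / e). assert (Hd : d = q * e) by (unfold q; field; auto).
    assert (Hq : 0 <= q <= h).
    { rewrite Hd in H. assert (Hq0 : q * (q - h) * (e * e) <= 0) by nra.
      assert (0 < e * e) by nra.
      assert (q * (q - h) <= 0).
      { destruct (Rle_dec (q * (q - h)) 0); auto. exfalso. assert (0 < q * (q - h) * (e * e)); [|lra].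
        apply Rmult_lt_0_compat; lra. }
      split; nra. }
    split; [lra|]. unfold d, e in Hd. nra.
Qed.

(** The third conclusion treats both kinds of meeting uniformly: for a crossing the interval is the
    point [t], for coinciding lines it reaches back to the start of the slab. *)
Lemma crossing_complete X V tk h i j t : tk <= t <= tk + h ->
  lpos X V tk i t = lpos X V tk j t ->
  crosses X V h i j /\ etime X V tk i j <= t /\
  (forall w, etime X V tk i j <= w <= t -> lpos X V tk i w = lpos X V tk j w) /\
  (V i <> V j -> etime X V tk i j = t).
Proof.
  unfold crosses, etime, lpos; intros Ht H. destruct (Req_EM_T (V i) (V j)) as [E|E].
  - rewrite E in *. assert (X i = X j) by lra. rewrite H0.
    split; [lra|]. split; [lra|]. split; [intros; lra|]. lra.
  - assert (Hd : X i - X j = (V j - V i) * (t - tk)) by lra.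
    assert (Et : tk + (X i - X j) / (V j - V i) = t) by (rewrite Hd; field; lra).
    rewrite Et. split; [|split; [lra|split; auto]].
    + rewrite Hd. set (e := V j - V i). replace (V i - V j) with (- e) by (unfold e; ring).
      replace (e * (t - tk) * (e * (t - tk) + - e * h)) with
        (- (e * e * ((t - tk) * (tk + h - t)))) by ring.
      assert (0 <= e * e) by nra. assert (0 <= (t - tk) * (tk + h - t)) by (apply Rmult_le_pos; lra).
      assert (0 <= e * e * ((t - tk) * (tk + h - t))) by (apply Rmult_le_pos; auto). lra.
    + intros w Hw. replace w with t by lra. lra.
Qed.

(* The second hypothesis on [top] excludes lines that left the envelope point
   at time [u] upwards; any other line overtaking [top] before [u'] would give
   an unprocessed event earlier than [u']. *)
Lemma envelope_advance n X V tk h (U : nat -> R) (I : nat -> nat) N e top u u' t q :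
  (forall i j t, (i < n)%nat -> (j < n)%nat -> V i <> V j -> tk <= t <= tk + h ->
     lpos X V tk i t = lpos X V tk j t -> exists y, (y < N)%nat /\ I y = i /\ U y = t) ->
  (forall y, (y < e)%nat -> U y <= u) -> (forall y, (e <= y < N)%nat -> u' <= U y) ->
  (top < n)%nat -> (forall q, (q < n)%nat -> lpos X V tk q u <= lpos X V tk top u) ->
  (forall y, (y < e)%nat -> (forall q, (q < n)%nat -> lpos X V tk q (U y) <= lpos X V tk (I y) (U y)) ->
     V (I y) <= V top) ->
  tk <= u -> u <= t -> t <= u' -> u' <= tk + h -> (q < n)%nat ->
  lpos X V tk q t <= lpos X V tk top t.
Proof.
  intros C H1 H2 Htop T0 T2 Hu Ht Hu' Hh Hq.
  destruct (Rle_dec (lpos X V tk q t) (lpos X V tk top t)) as [|Hn]; auto. exfalso.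
  apply Rnot_le_lt in Hn. pose proof (T0 q Hq) as Hqu.
  unfold lpos in Hn, Hqu.
  assert (Hut : u < t).
  { destruct (Req_dec u t); [subst; lra|lra]. }
  assert (HV : V top < V q) by nra.
  set (w := tk + (X top - X q) / (V q - V top)).
  assert (Hw : (w - tk) * (V q - V top) = X top - X q) by (unfold w; field; lra).
  assert (Huw : u <= w) by nra. assert (Hwt : w < t) by nra.
  destruct (C q top w) as (y & Hy & EI & EU); auto; try lra.
  { unfold lpos. lra. }
  destruct (Nat.lt_ge_cases y e) as [Hye|Hye].
  - specialize (H1 y Hye). assert (w = u) by lra.
    specialize (T2 y Hye). rewrite EI, EU in T2. assert (V q <= V top); [|lra].
    apply T2. intros q' Hq'. rewrite H in *. eapply Rle_trans; [apply T0; auto|].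
    unfold lpos. lra.
  - specialize (H2 y ltac:(lia)). lra.
Qed.

(** A potential for the upper envelope: the number of lines steeper than the top line. Each change
    of that line strictly lowers it, so a slab sees at most [n] changes. *)
Definition above (V : nat -> R) (v : R) (n : nat) : nat :=
  length (filter (fun q => if Rlt_dec v (V q) then true else false) (seq 0 n)).

Lemma above_le V v n : (above V v n <= n)%nat.
Proof. unfold above. etransitivity; [apply filter_length_le|]. rewrite length_seq; auto. Qed.

Lemma above_lt V v n i : (i < n)%nat -> v < V i -> (above V (V i) n < above V v n)%nat.
Proof.
  intros Hi Hv. unfold above. assert (Hin : In i (seq 0 n)) by (apply in_seq; lia).
  revert Hin. generalize (seq 0 n) as l.
  assert (M : forall l, (length (filter (fun q => if Rlt_dec (V i) (V q) then true else false) l) <=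
                    length (filter (fun q => if Rlt_dec v (V q) then true else false) l))%nat).
  { induction l as [|q l IH]; simpl; auto.
    destruct (Rlt_dec (V i) (V q)), (Rlt_dec v (V q)); simpl; lra || lia. }
  induction l as [|q l IH]; simpl; [tauto|]. intros [->|Hin].
  - destruct (Rlt_dec (V i) (V i)), (Rlt_dec v (V i)); try lra. simpl. specialize (M l). lia.
  - specialize (IH Hin). destruct (Rlt_dec (V i) (V q)), (Rlt_dec v (V q)); simpl; lra || lia.
Qed.

(** * Integrals of distances along a slab *)

Lemma is_RInt_affine p d a b :
  is_RInt (fun t => p + d * (t - a)) a b ((b - a) * (p + (p + d * (b - a))) / 2).
Proof.
  replace ((b - a) * (p + (p + d * (b - a))) / 2) with
    (minus (p * (b - a) + d / 2 * (b - a) ^ 2) (p * (a - a) + d / 2 * (a - a) ^ 2))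
    by (unfold minus, plus, opp; simpl; field).
  apply (is_RInt_derive (fun t => p * (t - a) + d / 2 * (t - a) ^ 2)).
  - intros t _. auto_derive; auto. field.
  - intros t _. apply continuous_ext with (fun u => (p - d * a) + d * u); [intros; simpl; ring|].
    apply continuous_affine.
Qed.

(** The integral of [|f|] over length [l], for [f] affine with end values [p] and [q]: a trapezoid
    if the signs agree, otherwise two triangles of heights [|p|] and [|q|] whose bases divide [l] in
    the same ratio. *)
Definition absint (p q l : R) : R :=
  if Rle_dec 0 (p * q) then Rabs (p + q) * l / 2 else (p * p + q * q) * l / (2 * Rabs (p - q)).

Lemma RInt_abs_affine p d a b : a <= b ->
  is_RInt (fun t => Rabs (p + d * (t - a))) a b (absint p (p + d * (b - a)) (b - a)).
Proof.
  intros Hab. set (q := p + d * (b - a)). unfold absint.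
  assert (Hpos : forall p d a b, a <= b -> 0 <= p -> 0 <= p + d * (b - a) ->
    is_RInt (fun t => Rabs (p + d * (t - a))) a b ((b - a) * (p + (p + d * (b - a))) / 2)).
  { clear. intros p d a b Hab Hp Hq.
    apply is_RInt_ext with (fun t => p + d * (t - a)); [|apply is_RInt_affine].
    intros t Ht. rewrite Rmin_left, Rmax_right in Ht by lra.
    rewrite Rabs_right; auto. apply Rle_ge.
    destruct (Req_dec a b); [lra|].
    (* A convex combination of the end values, hence nonnegative. *)
    replace (p + d * (t - a)) with ((p * (b - t) + (p + d * (b - a)) * (t - a)) / (b - a)) by (field; lra).
    apply Rmult_le_pos; [|left; apply Rinv_0_lt_compat; lra].
    apply Rplus_le_le_0_compat; apply Rmult_le_pos; lra. }
  assert (Hneg : forall p d a b, a <= b -> p <= 0 -> p + d * (b - a) <= 0 ->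
    is_RInt (fun t => Rabs (p + d * (t - a))) a b (- ((b - a) * (p + (p + d * (b - a))) / 2))).
  { intros p' d' a' b' Hab' Hp Hq. replace (- ((b' - a') * (p' + (p' + d' * (b' - a'))) / 2)) with
      ((b' - a') * (- p' + (- p' + - d' * (b' - a'))) / 2) by field.
    apply is_RInt_ext with (fun t => Rabs (- p' + - d' * (t - a'))); [|apply Hpos; lra].
    intros t _. rewrite <- Rabs_Ropp. f_equal; ring. }
  destruct (Rle_dec 0 (p * q)) as [Hpq|Hpq].
  - destruct (Rle_dec 0 (p + q)).
    + assert (0 <= p /\ 0 <= q) by nra.
      rewrite Rabs_right by lra. replace ((p + q) * (b - a) / 2) with ((b - a) * (p + q) / 2) by field.
      apply Hpos; tauto || lra.
    + assert (p <= 0 /\ q <= 0) by nra.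
      rewrite Rabs_left1 by lra. replace (- (p + q) * (b - a) / 2) with (- ((b - a) * (p + q) / 2)) by field.
      apply Hneg; tauto || lra.
  - apply Rnot_le_lt in Hpq.
    assert (Hd : d * (b - a) = q - p) by (unfold q; ring).
    assert (Hne : p - q <> 0) by nra.
    assert (Hd0 : d <> 0) by (intro; subst d; lra).
    assert (Hlt : a < b) by (destruct (Req_dec a b); [subst; exfalso; lra | lra]).
    (* [w] is the zero of the affine function; the integral is split there. *)
    set (w := a - p / d).
    assert (Hw : d * (w - a) = - p) by (unfold w; field; auto).
    assert (Hwb : d * (b - w) = q) by (replace (d * (b - w)) with (d * (b - a) - d * (w - a)) by ring; lra).
    assert (Haw : a <= w /\ w <= b).
    { clearbody w q. destruct (Rle_dec 0 p).
      - assert (q < 0) by nra. assert (d < 0) by nra.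
        split; apply Rnot_lt_le; intro; nra.
      - assert (0 < q) by nra. assert (0 < d) by nra.
        split; apply Rnot_lt_le; intro; nra. }
    assert (E2 : forall t, p + d * (t - a) = 0 + d * (t - w))
      by (intros; replace (d * (t - w)) with (d * (t - a) - d * (w - a)) by ring; lra).
    assert (Ew : w - a = - p * (b - a) / (q - p)).
    { rewrite <- Hd. replace (- p) with (d * (w - a)) by auto. field. split; lra. }
    assert (Eb : b - w = q * (b - a) / (q - p)).
    { rewrite <- Hd, <- Hwb. field. split; lra. }
    destruct (Rle_dec 0 p) as [Hp|Hp].
    + assert (q < 0) by nra. rewrite (Rabs_right (p - q)) by lra.
      replace ((p * p + q * q) * (b - a) / (2 * (p - q))) with
        (plus ((w - a) * (p + (p + d * (w - a))) / 2) (- ((b - w) * (0 + (0 + d * (b - w))) / 2))).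
      * apply (@is_RInt_Chasles R_NormedModule _ _ w).
        { apply Hpos; lra. }
        { apply is_RInt_ext with (fun t => Rabs (0 + d * (t - w))); [intros; rewrite E2; auto|].
          apply Hneg; lra. }
      * unfold plus; simpl. rewrite Hw, Hwb, Ew, Eb. field. lra.
    + assert (0 < q) by nra. rewrite (Rabs_left (p - q)) by lra.
      replace ((p * p + q * q) * (b - a) / (2 * - (p - q))) with
        (plus (- ((w - a) * (p + (p + d * (w - a))) / 2)) ((b - w) * (0 + (0 + d * (b - w))) / 2)).
      * apply (@is_RInt_Chasles R_NormedModule _ _ w).
        { apply Hneg; lra. }
        { apply is_RInt_ext with (fun t => Rabs (0 + d * (t - w))); [intros; rewrite E2; auto|].
          apply Hpos; lra. }
      * unfold plus; simpl. rewrite Hw, Hwb, Ew, Eb. field. lra.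
Qed.

(** The distance formula integrates to a trapezoid and an [absint]. The 4 combines the 2 of that
    formula with the 2 of the trapezoid area. *)
Lemma Ic_envelope n tau ts ps X V tk h s u d a b :
  (forall q t, (q < n)%nat -> tk <= t <= tk + h -> traj tau ts ps q t = lpos X V tk q t) ->
  (s < n)%nat -> (u < n)%nat -> (d < n)%nat -> tk <= a -> a <= b -> b <= tk + h ->
  (forall q t, (q < n)%nat -> a <= t <= b -> lpos X V tk d t <= lpos X V tk q t <= lpos X V tk u t) ->
  Ic n tau ts ps s a b =
  (b - a) * ((X u - X d) * 2 + (V u - V d) * ((a - tk) + (b - tk))) / 4 +
  absint (X u + X d - 2 * X s + (V u + V d - 2 * V s) * (a - tk))
         (X u + X d - 2 * X s + (V u + V d - 2 * V s) * (b - tk)) (b - a) / 2.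
Proof.
  intros Hx Hs Hu Hd Ha Hab Hb Env.
  set (p := X u + X d - 2 * X s + (V u + V d - 2 * V s) * (a - tk)).
  set (dd := V u + V d - 2 * V s).
  set (g := X u - X d + (V u - V d) * (a - tk)).
  unfold Ic. apply (@is_RInt_unique R_CompleteNormedModule).
  apply is_RInt_ext with (fun t => plus (scal (/ 2) (g + (V u - V d) * (t - a)))
      (scal (/ 2) (Rabs (p + dd * (t - a))))).
  - intros t Ht. rewrite Rmin_left, Rmax_right in Ht by lra.
    rewrite (Dist_envelope n tau ts ps s u d t); auto.
    + rewrite !Hx by (auto; lra). unfold plus, scal; simpl; unfold mult; simpl. unfold lpos.
      replace (X u + V u * (t - tk) + (X d + V d * (t - tk)) - 2 * (X s + V s * (t - tk)))
        with (p + dd * (t - a)) by (unfold p, dd; ring).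
      unfold g. field.
    + intros q Hq. rewrite !Hx by (auto; lra). apply Env; auto; lra.
  - replace (X u + X d - 2 * X s + dd * (b - tk)) with (p + dd * (b - a))
      by (unfold p, dd; ring).
    match goal with |- is_RInt _ _ _ ?v =>
      replace v with (plus (scal (/ 2) ((b - a) * (g + (g + (V u - V d) * (b - a))) / 2))
        (scal (/ 2) (absint p (p + dd * (b - a)) (b - a)))) end.
    + apply (@is_RInt_plus R_NormedModule).
      * apply (@is_RInt_scal R_NormedModule). apply is_RInt_affine.
      * apply (@is_RInt_scal R_NormedModule). apply RInt_abs_affine; auto.
    + unfold plus, scal; simpl; unfold mult; simpl. unfold g. field.
Qed.

(* INP is the input from its cell 2 on.  C[s] is the cost of reaching s at time
   L[s]; X[s] and V[s] are its position at the start of the slab and its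
   velocity.  Event e has time EU[e] and concerns the pair EI[e], EJ[e]; O lists
   the events in temporal order.  LU, LI, LJ hold the log of switches, TE and
   TT the pieces of the final trajectoid from the last to the first. *)
Notation aLOW := 0%nat (only parsing).
Notation aOUT := 1%nat (only parsing).
Notation aINP := 2%nat (only parsing).
Notation aC := 3%nat (only parsing).
Notation aL := 4%nat (only parsing).
Notation aX := 5%nat (only parsing).
Notation aV := 6%nat (only parsing).
Notation aLU := 8%nat (only parsing).
Notation aTT := 9%nat (only parsing).
Notation bEI := 0%nat (only parsing).
Notation bEJ := 1%nat (only parsing).
Notation bLI := 4%nat (only parsing).
Notation bLJ := 5%nat (only parsing).
Notation bTE := 6%nat (only parsing).
Notation rtk := 0%nat (only parsing).
Notation rh := 1%nat (only parsing).
Notation ru := 2%nat (only parsing).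
Notation rl := 3%nat (only parsing).
Notation rg := 4%nat (only parsing).
Notation rp := 5%nat (only parsing).
Notation rq := 6%nat (only parsing).
Notation rz := 7%nat (only parsing).
Notation rj := 8%nat (only parsing).
Notation rend := 9%nat (only parsing).

(** * The sweep *)

Ltac sides := unfold rix; repeat split; auto; try lia; try discriminate; try lra.

Notation gX a v := (RGet a (NVar v)) (only parsing).

Definition abs_cmd (e : rexp) : cmd :=
  Seq (RAsn rz e) (If (RLe (RCst 0) (RVar rz)) Skip (RAsn rz (RSub (RCst 0) (RVar rz)))).

(* Adds to C[vs] the integral of the distance of entity vs from L[vs] to ru. *)
Definition adv_cmd : cmd :=
  Seq (RAsn rl (gX aL vs))
  (Seq (RAsn rg (RAdd (RMul (RSub (gX aX vtop) (gX aX vbot)) (RCst 2))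
                 (RMul (RSub (gX aV vtop) (gX aV vbot))
                       (RAdd (RSub (RVar rl) (RVar rtk)) (RSub (RVar ru) (RVar rtk))))))
  (Seq (RAsn rp (RSub (RAdd (gX aX vtop) (gX aX vbot)) (RMul (RCst 2) (gX aX vs))))
  (Seq (RAsn rq (RSub (RAdd (gX aV vtop) (gX aV vbot)) (RMul (RCst 2) (gX aV vs))))
  (Seq (RAsn rj (RAdd (RVar rp) (RMul (RVar rq) (RSub (RVar rl) (RVar rtk)))))
  (Seq (RAsn rq (RAdd (RVar rp) (RMul (RVar rq) (RSub (RVar ru) (RVar rtk)))))
  (Seq (RAsn rp (RVar rj))
  (Seq (If (RLe (RCst 0) (RMul (RVar rp) (RVar rq)))
         (Seq (abs_cmd (RAdd (RVar rp) (RVar rq)))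
              (RAsn rj (RDiv (RMul (RVar rz) (RSub (RVar ru) (RVar rl))) (RCst 2))))
         (Seq (abs_cmd (RSub (RVar rp) (RVar rq)))
              (RAsn rj (RDiv (RMul (RAdd (RMul (RVar rp) (RVar rp)) (RMul (RVar rq) (RVar rq)))
                                   (RSub (RVar ru) (RVar rl)))
                             (RMul (RCst 2) (RVar rz))))))
  (Seq (RSet aC (NVar vs)
         (RAdd (gX aC vs)
           (RAdd (RDiv (RMul (RSub (RVar ru) (RVar rl)) (RVar rg)) (RCst 4))
                 (RDiv (RVar rj) (RCst 2)))))
       (RSet aL (NVar vs) (RVar ru)))))))))).

Definition flush_cmd : cmd := For vs (NVar vn) adv_cmd.

Notation pos_at v :=
  (RAdd (gX aX v) (RMul (gX aV v) (RSub (RVar ru) (RVar rtk)))) (only parsing).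

Definition relax_cmd : cmd :=
  If (RLe (gX aC vj) (gX aC vi)) Skip
    (Seq (RSet aC (NVar vj) (gX aC vi))
    (Seq (RSet aLU (NVar vcnt) (RVar ru))
    (Seq (NSet bLI (NVar vcnt) (NVar vi))
    (Seq (NSet bLJ (NVar vcnt) (NVar vj))
         (NAsn vcnt (NAdd (NVar vcnt) (NCst 1))))))).

Definition fetch_cmd : cmd :=
  Seq (NAsn vx (NGet bO (NVar ve)))
  (Seq (RAsn ru (gX aEU vx))
  (Seq (NAsn vi (NGet bEI (NVar vx)))
       (NAsn vj (NGet bEJ (NVar vx))))).

(** The top line can only give way to a steeper line meeting it; [vj] need not be examined, since
    the reversed pair is an event too. The flush comes first, while [vtop] is still the line valid
    since the times in [aL]. *)
Definition top_cmd : cmd :=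
  If (RLe (gX aV vi) (gX aV vtop)) Skip
    (If (RLe (pos_at vtop) (pos_at vi)) (Seq flush_cmd (NAsn vtop (NVar vi))) Skip).

Definition bot_cmd : cmd :=
  If (RLe (gX aV vbot) (gX aV vi)) Skip
    (If (RLe (pos_at vi) (pos_at vbot)) (Seq flush_cmd (NAsn vbot (NVar vi))) Skip).

Definition event_cmd : cmd :=
  Seq fetch_cmd (Seq top_cmd (Seq bot_cmd
  (Seq (Seq (NAsn vs (NVar vi)) adv_cmd)
  (Seq (Seq (NAsn vs (NVar vj)) adv_cmd) relax_cmd)))).

(** [aINP] begins with cell 2 of the input, so the positions start at [1 + tau] instead of
    [3 + tau]. *)
Definition setup_cmd : cmd :=
  Seq (RAsn rtk (gX aINP vk))
  (Seq (RAsn rh (RSub (RGet aINP (NAdd (NVar vk) (NCst 1))) (RVar rtk)))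
  (For vs (NVar vn)
    (Seq (NAsn vx (NAdd (NAdd (NAdd (NCst 1) (NVar vtau))
                              (NMul (NVar vs) (NAdd (NVar vtau) (NCst 1)))) (NVar vk)))
    (Seq (RSet aX (NVar vs) (gX aINP vx))
         (RSet aV (NVar vs)
            (RDiv (RSub (RGet aINP (NAdd (NVar vx) (NCst 1))) (gX aX vs)) (RVar rh))))))).

(** The outer test is [crosses], written with [V j - V i]. Equality of slopes takes two comparisons,
    as the machine decides only [<=]. *)
Definition gen_body : cmd :=
  Seq (RAsn rp (RSub (gX aX vi) (gX aX vj)))
  (Seq (RAsn rq (RSub (gX aV vj) (gX aV vi)))
  (If (RLe (RMul (RVar rp) (RSub (RVar rp) (RMul (RVar rq) (RVar rh)))) (RCst 0))
    (Seq (If (RLe (RVar rq) (RCst 0))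
           (If (RLe (RCst 0) (RVar rq)) (RAsn ru (RVar rtk))
              (RAsn ru (RAdd (RVar rtk) (RDiv (RVar rp) (RVar rq)))))
           (RAsn ru (RAdd (RVar rtk) (RDiv (RVar rp) (RVar rq)))))
    (Seq (RSet aEU (NVar vN) (RVar ru))
    (Seq (NSet bEI (NVar vN) (NVar vi))
    (Seq (NSet bEJ (NVar vN) (NVar vj))
    (Seq (NSet bO (NVar vN) (NVar vN))
         (NAsn vN (NAdd (NVar vN) (NCst 1))))))))
    Skip)).

(** All ordered pairs, since a switch may pay off in either direction. Diagonal pairs are harmless:
    relaxing an entity against itself does nothing. *)
Definition gen_cmd : cmd :=
  Seq (NAsn vN (NCst 0)) (For vi (NVar vn) (For vj (NVar vn) gen_body)).

Definition ext_cmd : cmd :=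
  Seq (NAsn vtop (NCst 0))
  (Seq (NAsn vbot (NCst 0))
  (For vs (NVar vn)
    (Seq (If (RLe (gX aX vtop) (gX aX vs)) (NAsn vtop (NVar vs)) Skip)
         (If (RLe (gX aX vs) (gX aX vbot)) (NAsn vbot (NVar vs)) Skip)))).

(** The closing flush is forced by the change of slopes at the vertex time, beyond which the closed
    formula with the present lines fails. *)
Definition slab_cmd : cmd :=
  Seq setup_cmd (Seq gen_cmd (Seq sort_cmd (Seq ext_cmd
  (Seq (For ve (NVar vN) event_cmd)
  (Seq (RAsn ru (RGet aINP (NAdd (NVar vk) (NCst 1)))) flush_cmd))))).

(** The list has the newest entry first and the arrays the oldest, hence the index [length l']. *)
Fixpoint logrel (LU : nat -> R) (LI LJ : nat -> nat) (l : list entry) : Prop :=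
  match l with
  | [] => True
  | (u, i, j) :: l' =>
      LU (length l') = u /\ LI (length l') = i /\ LJ (length l') = j /\ logrel LU LI LJ l'
  end.

Lemma logrel_ext LU LI LJ LU' LI' LJ' l :
  (forall e, (e < length l)%nat -> LU' e = LU e) -> (forall e, (e < length l)%nat -> LI' e = LI e) ->
  (forall e, (e < length l)%nat -> LJ' e = LJ e) ->
  logrel LU LI LJ l -> logrel LU' LI' LJ' l.
Proof.
  induction l as [|[[u i] j] l IH]; simpl; auto.
  intros H1 H2 H3 (E1 & E2 & E3 & E4). rewrite H1, H2, H3 by lia. repeat split; auto.
Qed.

(** * One slab: correctness and running time of the sweep *)

Section Slab.
Variables (n tau : nat) (ts : nat -> R) (ps : nat -> nat -> R).
Hypothesis Hv : valid_input n tau ts ps.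
Let B : nat := (128 * (tau * (n * n)))%nat.

Let Hn : (1 <= n)%nat := proj1 Hv.
Let Ht : (1 <= tau)%nat := proj1 (proj2 Hv).

Local Lemma nB : (n * n <= B)%nat /\ (tau * (n * n) <= B)%nat /\ (n < B)%nat.
Proof using Hv. clear -Hn Ht. unfold B. nia. Qed.

Local Lemma tauB : (tau + 1 < B)%nat.
Proof using Hv.
  clear -Hn Ht. unfold B. assert (1 <= n * n)%nat by nia.
  assert (tau * 1 <= tau * (n * n))%nat by (apply Nat.mul_le_mono_l; auto). lia.
Qed.

Definition SX (k q : nat) : R := ps q k.
Definition SV (k q : nat) : R := (ps q (S k) - ps q k) / (ts (S k) - ts k).

Lemma pos_traj k q t : (k < tau)%nat -> ts k <= t <= ts (S k) ->
  traj tau ts ps q t = lpos (SX k) (SV k) (ts k) q t.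
Proof using Hv. intros; unfold lpos, SX, SV. now apply (traj_segment n tau ts ps Hv k q t). Qed.

Section OneSlab.
Variable k : nat.
Hypothesis Hk : (k < tau)%nat.

Let X := SX k.
Let V := SV k.
Let x (q : nat) (t : R) : R := lpos X V (ts k) q t.

Local Lemma hpos : 0 < ts (S k) - ts k.
Proof using Hv Hk. pose proof (ts_lt n tau ts ps Hv k (S k) ltac:(lia) ltac:(lia)). lra. Qed.

Record slabst (s : st) : Prop := {
  sl_n : nv s vn = n;
  sl_tk : rv s rtk = ts k;
  sl_X : forall q, (q < n)%nat -> ra s aX q = X q;
  sl_V : forall q, (q < n)%nat -> ra s aV q = V q }.

Lemma slabst_frame c s s' : slabst s -> frame c s s' ->
  wn c vn = false -> wr c rtk = false -> wra c aX = false -> wra c aV = false -> slabst s'.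
Proof.
  intros [h1 h2 h3 h4] F f1 f2 f3 f4; constructor.
  - rewrite (fr_n F _ f1); auto.
  - rewrite (fr_r F _ f2); auto.
  - intros; rewrite (fr_ra F _ f3); auto.
  - intros; rewrite (fr_ra F _ f4); auto.
Qed.

Definition env (top bot : nat) (a b : R) : Prop :=
  forall q t, (q < n)%nat -> a <= t <= b -> x bot t <= x q t <= x top t.

Notation IC := (Ic n tau ts ps).

Lemma abs_wp e s v : dfR B s e -> v = evR s e ->
  wp B (abs_cmd e) (fun s' k => (k <= costR e + 20)%nat /\ rv s' rz = Rabs v) s.
Proof.
  intros D ->. unfold abs_cmd. wstep.
  eapply wp_rasn; [reflexivity|auto|]. wstep; [auto|..].
  - intros H. wstep. split; [lia|]. scbn. rewrite Rabs_right; auto; lra.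
  - intros H. wstep; [auto|]. split; [lia|]. scbn. rewrite Rabs_left by lra. lra.
Qed.

Lemma adv_wp s q : slabst s -> nv s vs = q -> (q < n)%nat ->
  (nv s vtop < n)%nat -> (nv s vbot < n)%nat ->
  ts k <= ra s aL q -> ra s aL q <= rv s ru -> rv s ru <= ts (S k) ->
  env (nv s vtop) (nv s vbot) (ra s aL q) (rv s ru) ->
  wp B adv_cmd (fun s' c => (c <= 300)%nat /\
    (forall r, ra s' aC r = if Nat.eqb r q then ra s aC q + IC q (ra s aL q) (rv s ru) else ra s aC r) /\
    (forall r, ra s' aL r = if Nat.eqb r q then rv s ru else ra s aL r)) s.
Proof using Hv Hk.
  intros SL Evs Hq Htop Hbot Ha Hau Hu Env. destruct nB as (_ & _ & HnB).
  set (a := ra s aL q) in *. set (u := rv s ru) in *.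
  set (top := nv s vtop) in *. set (bot := nv s vbot) in *.
  assert (EX : forall q, (q < n)%nat -> ra s aX q = X q) by apply SL.
  assert (EV : forall q, (q < n)%nat -> ra s aV q = V q) by apply SL.
  assert (Etk : rv s rtk = ts k) by apply SL.
  set (p0 := X top + X bot - 2 * X q + (V top + V bot - 2 * V q) * (a - ts k)).
  set (q0 := X top + X bot - 2 * X q + (V top + V bot - 2 * V q) * (u - ts k)).
  set (g0 := (X top - X bot) * 2 + (V top - V bot) * ((a - ts k) + (u - ts k))).
  assert (EI : IC q a u = (u - a) * g0 / 4 + absint p0 q0 (u - a) / 2).
  { apply (Ic_envelope n tau ts ps X V (ts k) (ts (S k) - ts k)); auto; try lra.
    intros; apply pos_traj; auto; lra. }
  assert (Fin : forall s1 c, frame adv_cmd s s1 -> rv s1 rl = a -> rv s1 rg = g0 ->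
    (forall r, ra s1 aC r = ra s aC r) -> (forall r, ra s1 aL r = ra s aL r) ->
    (c <= 220)%nat -> rv s1 rj = absint p0 q0 (u - a) ->
    wp B (Seq (RSet aC (NVar vs)
         (RAdd (gX aC vs)
           (RAdd (RDiv (RMul (RSub (RVar ru) (RVar rl)) (RVar rg)) (RCst 4))
                 (RDiv (RVar rj) (RCst 2)))))
       (RSet aL (NVar vs) (RVar ru)))
    (fun s' c' => (c + c' <= 300)%nat /\
      (forall r, ra s' aC r = if Nat.eqb r q then ra s aC q + IC q a u else ra s aC r) /\
      (forall r, ra s' aL r = if Nat.eqb r q then u else ra s aL r)) s1).
  { intros s1 c F Ea Eg EC EL Hc Ej.
    assert (Es : nv s1 vs = q) by unch.
    assert (Eu : rv s1 ru = u) by unch.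
    wstep. wstep. { rewrite Es; sides. }
    wstep. { rewrite Es; sides. }
    split; [lia|]. rewrite Es, Eu, Ea, Eg, Ej, EI.
    split; intros r; [rewrite EC | rewrite EL]; destruct (Nat.eqb_spec r q); auto. }
  unfold adv_cmd.
  wstep. wstep. { rewrite Evs; sides. } rewrite Evs. fold a.
  wstep. wstep. { fold top bot; sides. }
  fold top bot u. rewrite !EX, !EV, Etk by auto. fold g0.
  wstep. wstep. { rewrite Evs; fold top bot; sides. }
  fold top bot. rewrite Evs, !EX by auto.
  wstep. wstep. { rewrite Evs; fold top bot; sides. }
  fold top bot. rewrite Evs, !EV by auto.
  wstep. wstep; [auto|]. rewrite Etk. fold p0.
  wstep. wstep; [auto|]. rewrite Etk. fold u q0.
  wstep. wstep; [auto|].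
  set (s0 := setr _ rp p0).
  assert (F0 : frame adv_cmd s s0) by (unfold s0; frame_upd (frame_refl adv_cmd s)).
  assert (E1 : rv s0 rp = p0) by reflexivity. assert (E2 : rv s0 rq = q0) by reflexivity.
  assert (E3 : rv s0 rl = a) by reflexivity. assert (E4 : rv s0 rg = g0) by reflexivity.
  assert (E5 : rv s0 ru = u) by reflexivity.
  assert (E6 : forall r, ra s0 aC r = ra s aC r) by reflexivity.
  assert (E7 : forall r, ra s0 aL r = ra s aL r) by reflexivity.
  clearbody s0. wstep. wstep; [auto|..]; rewrite E1, E2; intros Hsgn.
  - wstep. apply wp_frame. eapply wp_mono.
    { apply (abs_wp _ _ (p0 + q0)); [simpl; auto|]. scbn. rewrite E1, E2; auto. }
    intros s1 c1 [Hc1 Ez] F1. cbv beta. change (costR _) with 5%nat in Hc1.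
    assert (R1 : rv s1 ru = u) by unch.
    assert (R2 : rv s1 rl = a) by unch.
    wstep. { repeat split; auto; lra. }
    eapply wp_mono; [apply Fin with (c := 220%nat)|]; scbn; auto; try lra.
    + assert (frame adv_cmd s s1) by ftrans F0 F1. frame_upd H.
    + rewrite (fr_r F1 rg eq_refl); auto.
    + intros r; rewrite (fr_ra F1 aC eq_refl); auto.
    + intros r; rewrite (fr_ra F1 aL eq_refl); auto.
    + rewrite Ez, R1, R2. unfold absint. destruct (Rle_dec 0 (p0 * q0)); [reflexivity|tauto].
    + intros s' c' (H1 & H2 & H3); split; [lia|auto].
  - wstep. apply wp_frame. eapply wp_mono.
    { apply (abs_wp _ _ (p0 - q0)); [simpl; auto|]. scbn. rewrite E1, E2; auto. }
    intros s1 c1 [Hc1 Ez] F1. cbv beta. change (costR _) with 5%nat in Hc1.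
    assert (R1 : rv s1 ru = u) by unch.
    assert (R2 : rv s1 rl = a) by unch.
    assert (R3 : rv s1 rp = p0) by unch.
    assert (R4 : rv s1 rq = q0) by unch.
    (* The end values have opposite signs in this branch, so the divisor does not vanish. *)
    assert (Hne : p0 - q0 <> 0) by (intro; apply Hsgn; nra).
    wstep. { repeat split; auto. rewrite Ez. pose proof (Rabs_pos_lt _ Hne). lra. }
    eapply wp_mono; [apply Fin with (c := 220%nat)|]; scbn; auto; try lra.
    + assert (frame adv_cmd s s1) by ftrans F0 F1. frame_upd H.
    + rewrite (fr_r F1 rg eq_refl); auto.
    + intros r; rewrite (fr_ra F1 aC eq_refl); auto.
    + intros r; rewrite (fr_ra F1 aL eq_refl); auto.
    + rewrite Ez, R1, R2, R3, R4. unfold absint. destruct (Rle_dec 0 (p0 * q0)); [tauto|reflexivity].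
    + intros s' c' (H1 & H2 & H3); split; [lia|auto].
Qed.

Notation PHI := (Phi n tau ts ps).

(** The lazy costs: by [dp_rep] the cost stored for [q] at its own time determines its value from
    then on, as no switch to [q] has been logged since; by [dp_env] the envelope lines have not
    changed since, so the closed formula applies up to [cur]. *)
Record dp (s : st) (l : list entry) (cur : R) : Prop := {
  dp_slab : slabst s;
  dp_top : (nv s vtop < n)%nat;
  dp_bot : (nv s vbot < n)%nat;
  dp_cur : ts k <= cur <= ts (S k);
  dp_log : vlog n tau ts ps cur l;
  dp_rel : logrel (ra s aLU) (na s bLI) (na s bLJ) l;
  dp_len : length l = nv s vcnt;
  dp_L : forall q, (q < n)%nat -> ts k <= ra s aL q <= cur;
  dp_rep : forall q, (q < n)%nat ->
    forall t, ra s aL q <= t -> PHI l q t = ra s aC q + IC q (ra s aL q) t;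
  dp_env : forall q, (q < n)%nat -> env (nv s vtop) (nv s vbot) (ra s aL q) cur }.

Lemma adv_dp s l q : dp s l (rv s ru) -> nv s vs = q -> (q < n)%nat ->
  wp B adv_cmd (fun s' c => (c <= 300)%nat /\ dp s' l (rv s' ru) /\ ra s' aL q = rv s' ru /\
    forall r, r <> q -> ra s' aL r = ra s aL r) s.
Proof using Hv Hk.
  intros D Es Hq. assert (D0 := D). destruct D as [d1 d2 d3 d4 d5 d6 d7 d8 d9 d10].
  pose proof (d8 q Hq) as Hl.
  apply wp_frame. eapply wp_mono; [apply (adv_wp s q); auto; lra|].
  intros s' c (Hc & EC & EL) F.
  assert (Eu : rv s' ru = rv s ru) by unch.
  rewrite Eu. split; [auto|]. split; [constructor|split].
  - eapply slabst_frame; eauto.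
  - rewrite (fr_n F vtop eq_refl); auto.
  - rewrite (fr_n F vbot eq_refl); auto.
  - auto.
  - auto.
  - eapply logrel_ext; [| | |exact d6]; intros.
    + apply (fr_ra F aLU eq_refl).
    + apply (fr_na F bLI eq_refl).
    + apply (fr_na F bLJ eq_refl).
  - rewrite (fr_n F vcnt eq_refl); auto.
  - intros r Hr. rewrite EL. destruct (Nat.eqb_spec r q); [lra|auto].
  - intros r Hr t Htt. rewrite EL in *; rewrite EC. destruct (Nat.eqb_spec r q); [|auto].
    subst r. rewrite (d9 q Hq t ltac:(lra)).
    rewrite (Ic_split n tau ts ps Hv q (ra s aL q) (rv s ru) t). ring.
  - intros r Hr. rewrite EL, (fr_n F vtop eq_refl), (fr_n F vbot eq_refl).
    destruct (Nat.eqb_spec r q); [|auto].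
    intros r' t Hr' Htt. apply (d10 q Hq); auto; lra.
  - rewrite EL, Nat.eqb_refl; auto.
  - intros r Hr. rewrite EL. destruct (Nat.eqb_spec r q); [tauto|auto].
Qed.

Lemma flush_dp s l : dp s l (rv s ru) ->
  wp B flush_cmd (fun s' c => (c <= 320 * n + 20)%nat /\ dp s' l (rv s' ru) /\
    forall q, (q < n)%nat -> ra s' aL q = rv s' ru) s.
Proof using Hv Hk.
  intros D. unfold flush_cmd, For. wstep. wstep; [auto|].
  apply wp_loop with (i0 := 0%nat) (N := n)
    (I := fun i s' c => nv s' vs = i /\ dp s' l (rv s' ru) /\ (c <= 312 * i)%nat /\
       forall q, (q < i)%nat -> ra s' aL q = rv s' ru).
  - reflexivity.
  - intros i s1 c (H1 & H2 & _). split; [auto|]. simpl. split; [auto|]. apply H2.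
  - intros i s1 c Hi Ei (H1 & H2 & H3 & H4).
    apply wp_frame. eapply wp_mono; [apply (adv_dp s1 l i); auto|].
    intros s2 c2 (Hc2 & D2 & EL & EL') F. scbn. split; [auto|]. split; [|split].
    + destruct D2 as [[h1 h2 h3 h4] d2 d3 d4 d5 d6 d7 d8 d9 d10]; constructor; auto.
      constructor; auto.
    + unfold cl, costN; simpl; lia.
    + intros q Hq. destruct (Nat.eq_dec q i); [subst; auto|].
      rewrite EL' by auto. rewrite H4 by lia. symmetry; apply (fr_r F ru eq_refl).
  - scbn. split; [auto|]. split; [|split; [lia|intros; lia]].
    destruct D as [[h1 h2 h3 h4] d2 d3 d4 d5 d6 d7 d8 d9 d10]; constructor; auto.
    constructor; auto.
  - lia.
  - intros s1 c (H1 & H2 & H3 & H4). split; auto. unfold cl, costN; simpl; lia.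
  - intros s1 c c' Hc (H1 & H2 & H3); split; [lia|auto].
Qed.

Lemma relax_dp s l : dp s l (rv s ru) -> (nv s vi < n)%nat -> (nv s vj < n)%nat ->
  ra s aL (nv s vi) = rv s ru -> ra s aL (nv s vj) = rv s ru ->
  traj tau ts ps (nv s vi) (rv s ru) = traj tau ts ps (nv s vj) (rv s ru) ->
  (nv s vcnt < B)%nat ->
  wp B relax_cmd (fun s' c => (c <= 100)%nat /\ exists l', dp s' l' (rv s' ru) /\
    ((l' = l /\ PHI l (nv s vj) (rv s ru) <= PHI l (nv s vi) (rv s ru)) \/
     l' = (rv s ru, nv s vi, nv s vj) :: l)) s.
Proof using Hv Hk.
  intros D Hi Hj Li Lj Hx Hcnt. assert (D0 := D).
  destruct D as [d1 d2 d3 d4 d5 d6 d7 d8 d9 d10].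
  destruct nB as (_ & _ & HnB).
  set (i := nv s vi) in *. set (j := nv s vj) in *. set (u := rv s ru) in *.
  assert (Pi : PHI l i u = ra s aC i).
  { rewrite (d9 i Hi) by (rewrite Li; lra). rewrite Li, Ic_refl; ring. }
  assert (Pj : PHI l j u = ra s aC j).
  { rewrite (d9 j Hj) by (rewrite Lj; lra). rewrite Lj, Ic_refl; ring. }
  unfold relax_cmd. wstep. { fold i j; sides. }
  - fold i j. intros Hle. wstep. split; [lia|]. exists l; split; [auto|]. left.
    split; [auto|]. rewrite Pi, Pj; auto.
  - fold i j. intros Hgt. apply Rnot_le_lt in Hgt.
    assert (Hij : i <> j) by (intros E; rewrite E in Hgt; lra).
    wstep. wstep. { fold i j; sides. }
    wstep. wstep. { sides. }
    wstep. wstep. { sides. }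
    wstep. wstep. { sides. }
    wstep; [auto|].
    fold i j u. split; [lia|]. exists ((u, i, j) :: l). split; [|auto].
    constructor; cbn [nv rv na ra setn setr setna setra Nat.eqb]; auto.
    + destruct d1 as [h1 h2 h3 h4]; constructor; auto.
    + split; [|exact d5]. pose proof (ts_le n tau ts ps Hv 0 k ltac:(lia) ltac:(lia)).
      fold u. split; [lra|]. split; [auto|]. split; [auto|]. split; [auto|]. rewrite Pi, Pj; auto.
    + split; [|split; [|split]]; [rewrite d7, Nat.eqb_refl; auto..|].
      eapply logrel_ext; [| | |exact d6]; intros e He; cbv beta;
        destruct (Nat.eqb_spec e (nv s vcnt)); auto; lia.
    + simpl; lia.
    (* The entry affects [j] alone, whose own time is [u]; the costs stored for all others stay
       valid, however old. *)
    + intros q Hq t Htt. cbn [Phi].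
      destruct (Nat.eqb_spec q j).
      * subst q. rewrite Lj in *. destruct (Rle_dec u t); [|lra]. rewrite Pi; auto.
      * apply d9; auto.
Qed.

(** Price of one flush with its bookkeeping, paid from the drop of the potential. *)
Local Notation F0 := (320 * n + 60)%nat.

(** The fourth conclusion is what [envelope_advance] asks for: a line that touches the envelope at
    its event is afterwards no steeper than the top line. The last one is an amortised time
    bound. *)
Lemma top_wp s l : dp s l (rv s ru) -> (nv s vi < n)%nat ->
  (forall q, (q < n)%nat -> x q (rv s ru) <= x (nv s vtop) (rv s ru)) ->
  wp B top_cmd (fun s' c =>
    dp s' l (rv s ru) /\ (forall q, (q < n)%nat -> x q (rv s ru) <= x (nv s' vtop) (rv s ru)) /\
    V (nv s vtop) <= V (nv s' vtop) /\
    ((forall q, (q < n)%nat -> x q (rv s ru) <= x (nv s vi) (rv s ru)) -> V (nv s vi) <= V (nv s' vtop)) /\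
    (c + F0 * above V (V (nv s' vtop)) n <= 100 + F0 * above V (V (nv s vtop)) n)%nat) s.
Proof using Hv Hk.
  intros D Hi HT. destruct nB as (_ & _ & HnB).
  set (i := nv s vi) in *. set (u := rv s ru) in *. set (top := nv s vtop) in *.
  assert (D0 := D). destruct D as [[h1 h2 h3 h4] d2 d3 d4 d5 d6 d7 d8 d9 d10].
  unfold top_cmd. wstep. { fold i top; sides. }
  - fold i top. rewrite !h4 by auto. intros Hle. wstep.
    split; [exact D0|]. fold top. split; [auto|]. split; [lra|]. split; [auto|]. lia.
  - fold i top. rewrite !h4 by auto. intros Hgt. wstep. { fold i top; sides. }
    + fold i top u. rewrite !h3, !h4, h2 by auto. intros Hle.
      wstep. call (flush_dp s l D0).
      intros s1 c1 (Hc1 & D1 & EL) F. cbv beta. wstep; [auto|].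
      assert (Eu : rv s1 ru = u) by unch.
      rewrite Eu in *. rewrite (fr_n F vi eq_refl). fold i.
      assert (HT' : forall q, (q < n)%nat -> x q u <= x i u).
      { intros q Hq. eapply Rle_trans; [apply HT; auto|]. exact Hle. }
      split; [|split; [auto|split; [lra|split; [lra|]]]].
      * destruct D1 as [[g1 g2 g3 g4] e2 e3 e4 e5 e6 e7 e8 e9 e10]; constructor; auto.
        { constructor; auto. }
        (* After the flush every own time is [u], so the new top line has to dominate at the single
           moment [u] only. *)
        intros q Hq r t Hr Htt. scbn_in Htt. scbn. rewrite EL in Htt by auto.
        replace t with u by lra. split; [|auto].
        apply (e10 q Hq r u Hr). rewrite EL by auto. lra.
      * assert (above V (V i) n < above V (V top) n)%nat by (apply above_lt; auto; lra). nia.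
    + fold i top u. rewrite !h3, !h4, h2 by auto. intros Hgt2.
      wstep. split; [exact D0|]. fold top. split; [auto|]. split; [lra|]. split; [|lia].
      intros HA. exfalso. apply Hgt2. apply HA; auto.
Qed.

(** Mirror image of [top_wp]; negated slopes make [above] count the lines of smaller slope than the
    bottom line. *)
Lemma bot_wp s l : dp s l (rv s ru) -> (nv s vi < n)%nat ->
  (forall q, (q < n)%nat -> x (nv s vbot) (rv s ru) <= x q (rv s ru)) ->
  wp B bot_cmd (fun s' c =>
    dp s' l (rv s ru) /\ (forall q, (q < n)%nat -> x (nv s' vbot) (rv s ru) <= x q (rv s ru)) /\
    V (nv s' vbot) <= V (nv s vbot) /\
    ((forall q, (q < n)%nat -> x (nv s vi) (rv s ru) <= x q (rv s ru)) -> V (nv s' vbot) <= V (nv s vi)) /\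
    (c + F0 * above (fun q => - V q) (- V (nv s' vbot)) n <=
     100 + F0 * above (fun q => - V q) (- V (nv s vbot)) n)%nat) s.
Proof using Hv Hk.
  intros D Hi HT. destruct nB as (_ & _ & HnB).
  set (i := nv s vi) in *. set (u := rv s ru) in *. set (bot := nv s vbot) in *.
  assert (D0 := D). destruct D as [[h1 h2 h3 h4] d2 d3 d4 d5 d6 d7 d8 d9 d10].
  unfold bot_cmd. wstep. { fold i bot; sides. }
  - fold i bot. rewrite !h4 by auto. intros Hle. wstep.
    split; [exact D0|]. fold bot. split; [auto|]. split; [lra|]. split; [auto|]. lia.
  - fold i bot. rewrite !h4 by auto. intros Hgt. wstep. { fold i bot; sides. }
    + fold i bot u. rewrite !h3, !h4, h2 by auto. intros Hle.
      wstep. call (flush_dp s l D0).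
      intros s1 c1 (Hc1 & D1 & EL) F. cbv beta. wstep; [auto|].
      assert (Eu : rv s1 ru = u) by unch.
      rewrite Eu in *. rewrite (fr_n F vi eq_refl). fold i.
      assert (HT' : forall q, (q < n)%nat -> x i u <= x q u).
      { intros q Hq. eapply Rle_trans; [|apply HT; auto]. exact Hle. }
      split; [|split; [auto|split; [lra|split; [lra|]]]].
      * destruct D1 as [[g1 g2 g3 g4] e2 e3 e4 e5 e6 e7 e8 e9 e10]; constructor; auto.
        { constructor; auto. }
        intros q Hq r t Hr Htt. scbn_in Htt. scbn. rewrite EL in Htt by auto.
        replace t with u by lra. split; [auto|].
        apply (e10 q Hq r u Hr). rewrite EL by auto. lra.
      * assert (above (fun q => - V q) (- V i) n < above (fun q => - V q) (- V bot) n)%nat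
          by (apply (above_lt (fun q => - V q)); auto; lra). nia.
    + fold i bot u. rewrite !h3, !h4, h2 by auto. intros Hgt2.
      wstep. split; [exact D0|]. fold bot. split; [auto|]. split; [lra|]. split; [|lia].
      intros HA. exfalso. apply Hgt2. apply HA; auto.
Qed.

(** Time moves on without any computation, because costs are lazy. *)
Lemma dp_advance s l cur u : dp s l cur -> cur <= u -> u <= ts (S k) ->
  env (nv s vtop) (nv s vbot) cur u -> dp s l u.
Proof.
  intros [d1 d2 d3 d4 d5 d6 d7 d8 d9 d10] Hcu Hu E; constructor; auto.
  - lra.
  - eapply vlog_mono; eauto.
  - intros q Hq; specialize (d8 q Hq); lra.
  - intros q Hq r t Hr Htt. destruct (Rle_dec t cur); [apply (d10 q); auto; lra | apply E; auto; lra].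
Qed.

Section Events.
Variables (N : nat) (U : nat -> R) (I J : nat -> nat) (D0 : R -> nat -> nat -> Prop).
Hypothesis HU : forall y z, (y <= z < N)%nat -> U y <= U z.
Hypothesis HEv : forall y, (y < N)%nat ->
  (I y < n)%nat /\ (J y < n)%nat /\ ts k <= U y <= ts (S k) /\ x (I y) (U y) = x (J y) (U y).
Hypothesis HComp : forall i j, (i < n)%nat -> (j < n)%nat -> crosses X V (ts (S k) - ts k) i j ->
  exists y, (y < N)%nat /\ I y = i /\ J y = j /\ U y = etime X V (ts k) i j.
Hypothesis HD0 : forall w a b, D0 w a b -> w <= ts k /\ (a < n)%nat /\ (b < n)%nat.

Record evst (s : st) : Prop := {
  es_N : nv s vN = N;
  es_O : forall y, (y < N)%nat -> (na s bO y < B)%nat;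
  es_U : forall y, (y < N)%nat -> ra s aEU (na s bO y) = U y;
  es_I : forall y, (y < N)%nat -> na s bEI (na s bO y) = I y;
  es_J : forall y, (y < N)%nat -> na s bEJ (na s bO y) = J y }.

(** [D0] stands for the meetings of earlier slabs, which later switches must not spoil. *)
Definition done (e : nat) (w : R) (a b : nat) : Prop :=
  D0 w a b \/ exists y, (y < e)%nat /\ U y = w /\ I y = a /\ J y = b.

(** A handled meeting keeps its effect for as long as the two entities stay together. With the
    reversed pair it gives equality of their values. *)
Definition inv_done (l : list entry) (D : R -> nat -> nat -> Prop) : Prop :=
  forall w a b t, D w a b -> w <= t -> t <= ts tau ->
    (forall v, w <= v <= t -> traj tau ts ps a v = traj tau ts ps b v) ->
    PHI l b t <= PHI l a t.

(** [sw_top2] and [sw_bot2] record that a line which touched an envelope at a processed event does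
    not leave it outwards; this excludes an unnoticed overtaking at a time shared by several
    events. *)
Record sweep (e : nat) (s : st) (l : list entry) (cur : R) : Prop := {
  sw_dp : dp s l cur;
  sw_before : forall y, (y < e)%nat -> U y <= cur;
  sw_after : forall y, (e <= y < N)%nat -> cur <= U y;
  sw_top : forall q, (q < n)%nat -> x q cur <= x (nv s vtop) cur;
  sw_top2 : forall y, (y < e)%nat -> (forall q, (q < n)%nat -> x q (U y) <= x (I y) (U y)) ->
    V (I y) <= V (nv s vtop);
  sw_bot : forall q, (q < n)%nat -> x (nv s vbot) cur <= x q cur;
  sw_bot2 : forall y, (y < e)%nat -> (forall q, (q < n)%nat -> x (I y) (U y) <= x q (U y)) ->
    V (nv s vbot) <= V (I y);
  sw_done : inv_done l (done e) }.

Local Lemma comp_time i j t : (i < n)%nat -> (j < n)%nat -> V i <> V j -> ts k <= t <= ts (S k) ->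
  x i t = x j t -> exists y, (y < N)%nat /\ I y = i /\ U y = t.
Proof using HComp.
  intros Hi Hj HV Htt Hx.
  destruct (crossing_complete X V (ts k) (ts (S k) - ts k) i j t ltac:(lra) Hx) as (C & _ & _ & E).
  destruct (HComp i j Hi Hj C) as (y & Hy & E1 & E2 & E3). exists y; rewrite E3; auto.
Qed.

Lemma sweep_env e s l cur u : sweep e s l cur -> cur <= u -> u <= ts (S k) ->
  (forall y, (e <= y < N)%nat -> u <= U y) -> env (nv s vtop) (nv s vbot) cur u.
Proof using HComp.
  intros [w1 w2 w3 w4 w5 w6 w7 w8] Hcu Hu Hy q t Hq Htt.
  assert (Hc := dp_cur _ _ _ w1). split.
  (* The lower envelope is the upper envelope of the reflected lines. *)
  - assert (NP : forall q t, lpos (fun q => - X q) (fun q => - V q) (ts k) q t = - x q t)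
      by (intros; unfold x, lpos; ring).
    assert (- x q t <= - x (nv s vbot) t); [|lra]. rewrite <- !NP.
    apply (envelope_advance n (fun q => - X q) (fun q => - V q) (ts k) (ts (S k) - ts k) U I N e
      (nv s vbot) cur u); auto; try lra.
    + intros i j t' Hi Hj HV Ht' Hx. rewrite !NP in Hx. apply (comp_time i j); auto; lra.
    + apply w1.
    + intros r Hr. rewrite !NP. specialize (w6 r Hr). lra.
    + intros y Hy' HA. specialize (w7 y Hy').
      assert (V (nv s vbot) <= V (I y)); [|lra]. apply w7. intros r Hr. specialize (HA r Hr).
      rewrite !NP in HA. lra.
  - apply (envelope_advance n X V (ts k) (ts (S k) - ts k) U I N e (nv s vtop) cur u); auto; try lra.
    + intros i j t' Hi Hj HV Ht' Hx. apply (comp_time i j); auto; lra.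
    + apply w1.
Qed.

Definition pot (s : st) : nat :=
  (above V (V (nv s vtop)) n + above (fun q => (- V q)%R) (- V (nv s vbot))%R n)%nat.

Lemma evst_frame c s s' : evst s -> frame c s s' -> wn c vN = false -> wna c bO = false ->
  wna c bEI = false -> wna c bEJ = false -> wra c aEU = false -> evst s'.
Proof.
  intros [e1 e2 e3 e4 e5] F f1 f2 f3 f4 f5; constructor.
  - rewrite (fr_n F _ f1); auto.
  - intros; rewrite (fr_na F _ f2); auto.
  - intros; rewrite (fr_na F _ f2), (fr_ra F _ f5); auto.
  - intros; rewrite (fr_na F _ f2), (fr_na F _ f3); auto.
  - intros; rewrite (fr_na F _ f2), (fr_na F _ f4); auto.
Qed.

(** Amortised time: 1200 covers the work of one event apart from the flushes, which are paid by the
    drop of [pot]. *)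
Lemma event_wp e s l cur : sweep e s l cur -> evst s -> (e < N)%nat -> (N <= B)%nat -> nv s ve = e ->
  (nv s vcnt < B)%nat ->
  wp B event_cmd (fun s' c => exists l' cur', sweep (S e) s' l' cur' /\
    (nv s' vcnt <= nv s vcnt + 1)%nat /\ (c + F0 * pot s' <= 1200 + F0 * pot s)%nat) s.
Proof using Hv Hk HU HEv HComp HD0.
  intros W ES He HNB Ee Hcnt. assert (W' := W). destruct W' as [w1 w2 w3 w4 w5 w6 w7 w8].
  destruct ES as [e1 e2 e3 e4 e5].
  destruct (HEv e He) as (Hi & Hj & Hu & Hx).
  set (u := U e) in *. set (i := I e) in *. set (j := J e) in *.
  assert (Hcu : cur <= u) by (apply w3; lia).
  assert (Env : env (nv s vtop) (nv s vbot) cur u).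
  { apply (sweep_env e s l); auto; try lra. intros y Hy. apply HU; lia. }
  assert (Du : dp s l u) by (eapply dp_advance; eauto; lra).
  unfold event_cmd, fetch_cmd.
  wstep. wstep. wstep. { sides. } rewrite Ee.
  wstep. wstep. { sides. } rewrite e3 by auto. fold u.
  wstep. wstep. { sides. } rewrite e4 by auto. fold i.
  wstep. { sides. } rewrite e5 by auto. fold j.
  set (s1 := setn _ vj j).
  assert (D1 : dp s1 l (rv s1 ru)).
  { destruct Du as [[g1 g2 g3 g4] g5 g6 g7 g8 g9 g10 g11 g12 g13]; constructor; auto.
    constructor; auto. }
  wstep. apply wp_frame. eapply wp_mono.
  { apply (top_wp s1 l D1); auto. cbn. intros q Hq. apply Env; auto; lra. }
  intros s2 c2 (D2 & T2 & T2' & T2'' & P2) F2. cbv beta.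
  change (rv s1 ru) with u in *. change (nv s1 vi) with i in *.
  change (nv s1 vtop) with (nv s vtop) in *.
  assert (Eu2 : rv s2 ru = u) by unch.
  assert (Ei2 : nv s2 vi = i) by unch.
  assert (Eb2 : nv s2 vbot = nv s vbot) by unch.
  wstep. apply wp_frame. eapply wp_mono.
  { apply (bot_wp s2 l); rewrite ?Eu2, ?Ei2, ?Eb2; auto. intros q Hq. apply Env; auto; lra. }
  intros s3 c3 (D3 & T3 & T3' & T3'' & P3) F3. cbv beta.
  rewrite Eu2, ?Ei2, ?Eb2 in *.
  assert (Eu3 : rv s3 ru = u) by unch.
  assert (Ei3 : nv s3 vi = i) by unch.
  assert (Ej3 : nv s3 vj = j)
    by unch.
  assert (Et3 : nv s3 vtop = nv s2 vtop) by unch.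
  assert (Ec3 : nv s3 vcnt = nv s vcnt)
    by unch.
  rewrite <- Et3 in *.
  wstep. wstep. wstep; [auto|]. rewrite Ei3.
  set (s4 := setn s3 vs i).
  assert (D4 : dp s4 l (rv s4 ru)).
  { change (rv s4 ru) with (rv s3 ru). rewrite Eu3.
    destruct D3 as [[g1 g2 g3 g4] g5 g6 g7 g8 g9 g10 g11 g12 g13]; constructor; auto.
    constructor; auto. }
  apply wp_frame. eapply wp_mono; [apply (adv_dp s4 l i D4); auto|].
  intros s5 c5 (Hc5 & D5 & L5 & L5') F5. cbv beta.
  wstep. wstep. wstep; [auto|].
  rewrite (fr_n F5 vj eq_refl). change (nv s4 vj) with (nv s3 vj). rewrite Ej3.
  assert (Eu5 : rv s5 ru = u) by unch.
  set (s6 := setn s5 vs j).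
  assert (D6 : dp s6 l (rv s6 ru)).
  { change (rv s6 ru) with (rv s5 ru).
    destruct D5 as [[g1 g2 g3 g4] g5 g6 g7 g8 g9 g10 g11 g12 g13]; constructor; auto.
    constructor; auto. }
  apply wp_frame. eapply wp_mono; [apply (adv_dp s6 l j D6); auto|].
  intros s7 c7 (Hc7 & D7 & L7 & L7') F7. cbv beta.
  assert (Eu7 : rv s7 ru = u) by unch.
  assert (Ei7 : nv s7 vi = i) by unch.
  assert (Ej7 : nv s7 vj = j) by unch.
  assert (Et7 : nv s7 vtop = nv s3 vtop) by unch.
  assert (Eb7 : nv s7 vbot = nv s3 vbot) by unch.
  assert (Ec7 : nv s7 vcnt = nv s vcnt) by unch.
  assert (Li : ra s7 aL i = u).
  { destruct (Nat.eq_dec i j) as [E|E]; [rewrite E, L7; auto|].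
    rewrite L7' by auto. change (ra s6 aL i) with (ra s5 aL i). rewrite L5; auto. }
  assert (Tx : traj tau ts ps i u = traj tau ts ps j u).
  { rewrite !(pos_traj k) by (auto; lra). exact Hx. }
  apply wp_frame. eapply wp_mono.
  { apply (relax_dp s7 l D7); rewrite ?Ei7, ?Ej7, ?Eu7, ?Ec7; auto. rewrite L7; auto. }
  intros s8 c8 (Hc8 & l' & D8 & Hl') F8.
  assert (Eu8 : rv s8 ru = u) by unch.
  assert (Et8 : nv s8 vtop = nv s3 vtop) by unch.
  assert (Eb8 : nv s8 vbot = nv s3 vbot) by unch.
  rewrite Ei7, Ej7, Eu7 in Hl'. rewrite Eu8 in D8.
  exists l', u. split; [constructor|split].
  - exact D8.
  - intros y Hy. apply HU; lia.
  - intros y Hy. apply HU; lia.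
  - rewrite Et8; auto.
  - intros y Hy HA. rewrite Et8. destruct (Nat.eq_dec y e) as [->|Hne].
    + apply T2''; auto.
    + eapply Rle_trans; [apply w5; auto; lia|auto].
  - rewrite Eb8; auto.
  - intros y Hy HA. rewrite Eb8. destruct (Nat.eq_dec y e) as [->|Hne].
    + apply T3''; auto.
    + eapply Rle_trans; [exact T3'|]. apply w7; auto; lia.
  - pose proof (ts_le n tau ts ps Hv 0 k ltac:(lia) ltac:(lia)) as Hk0.
    pose proof (ts_le n tau ts ps Hv (S k) tau ltac:(lia) ltac:(lia)) as Hk1.
    intros w a b t Hd Hw Htt Heq.
    (* Meetings handled before survive a newly logged switch by [relax_keep]. *)
    assert (Hold : done e w a b -> PHI l' b t <= PHI l' a t).
    { intros Hd'. specialize (w8 w a b t Hd' Hw Htt Heq).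
      destruct Hl' as [[-> _]| ->]; auto.
      assert (Hwab : w <= u /\ (a < n)%nat /\ (b < n)%nat).
      { destruct Hd' as [H|(y & Hy & <- & <- & <-)].
        - destruct (HD0 _ _ _ H) as (? & ? & ?). repeat split; auto; lra.
        - destruct (HEv y) as (? & ? & _); [lia|]. repeat split; auto. apply HU; lia. }
      apply (relax_keep n tau ts ps Hv u); try tauto; [apply D8|lra|].
      intros _ v Hv'. apply Heq. lra. }
    destruct Hd as [H|(y & Hy & E1 & E2 & E3)]; [apply Hold; left; auto|].
    destruct (Nat.eq_dec y e) as [->|Hne].
    + fold u in E1; fold i in E2; fold j in E3. subst w a b.
      destruct Hl' as [[-> HP]| ->].
      * apply (norelax_new n tau ts ps Hv u u); auto; try lra. apply Du.
      * apply (relax_new n tau ts ps Hv u); auto. apply D8.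
    + apply Hold. right. exists y; repeat split; auto; lia.
  - pose proof (dp_len _ _ _ D8) as HL8. pose proof (dp_len _ _ _ D7) as HL7.
    rewrite Ec7 in HL7. destruct Hl' as [[-> _]| ->]; simpl in HL8; lia.
  - unfold pot. rewrite Et8, Eb8. lia.
Qed.

End Events.

(** * Preparing a slab: lines, events and initial envelopes *)

Record input (s : st) : Prop := {
  in_n : nv s vn = n;
  in_tau : nv s vtau = tau;
  in_ts : forall e, (e <= tau)%nat -> ra s aINP e = ts e;
  in_ps : forall q e, (q < n)%nat -> (e <= tau)%nat ->
    ra s aINP (1 + tau + q * (tau + 1) + e)%nat = ps q e }.

Lemma input_frame c s s' : input s -> frame c s s' ->
  wn c vn = false -> wn c vtau = false -> wra c aINP = false -> input s'.
Proof.
  intros [h1 h2 h3 h4] F f1 f2 f3; constructor.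
  - rewrite (fr_n F _ f1); auto.
  - rewrite (fr_n F _ f2); auto.
  - intros; rewrite (fr_ra F _ f3); auto.
  - intros; rewrite (fr_ra F _ f3); auto.
Qed.

Lemma setup_wp s : input s -> nv s vk = k ->
  wp B setup_cmd (fun s' c => (c <= 120 * n + 100)%nat /\ slabst s' /\
    rv s' rh = ts (S k) - ts k) s.
Proof using Hv Hk.
  intros IN Ek. destruct nB as (_ & HtB & HnB). pose proof hpos as Hh.
  assert (HB : (3 + tau + n * (tau + 1) < B)%nat) by (clear -Hn Ht; unfold B; nia).
  assert (IN0 := IN). destruct IN as [h1 h2 h3 h4].
  unfold setup_cmd, For. wstep. wstep. { sides. } rewrite Ek, h3 by lia.
  wstep. wstep. { sides. } rewrite Ek, h3 by lia. rewrite Nat.add_1_r.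
  wstep. wstep; [auto|].
  match goal with |- context [setr (setr s rtk ?a) rh ?b] => set (s0 := setr (setr s rtk a) rh b) end.
  apply wp_loop with (i0 := 0%nat) (N := n)
    (I := fun i s' c => nv s' vs = i /\ (c <= 112 * i)%nat /\ input s' /\ nv s' vk = k /\
       rv s' rtk = ts k /\ rv s' rh = ts (S k) - ts k /\
       (forall q, (q < i)%nat -> ra s' aX q = X q /\ ra s' aV q = V q)).
  - reflexivity.
  - intros i s1 c (H1 & H2 & H3 & _). split; [auto|]. simpl; split; auto. apply H3.
  - intros i s1 c Hi Ei (H1 & H2 & [g1 g2 g3 g4] & H4 & H5 & H6 & H7).
    assert (Hix : (1 + tau + i * (tau + 1) + k < B)%nat) by nia.
    assert (Hix' : (S (1 + tau + i * (tau + 1) + k) < B)%nat) by nia.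
    wstep. wstep; [auto|]. rewrite g2, H1, H4.
    wstep. wstep. { sides. } rewrite g4, H1 by lia.
    wstep. { rewrite H1. sides. }
    rewrite H1, Nat.eqb_refl, H6.
    replace (1 + tau + i * (tau + 1) + k + 1)%nat with (1 + tau + i * (tau + 1) + S k)%nat by lia.
    rewrite g4 by lia.
    split; [auto|]. split; [unfold cl, costN; simpl; lia|].
    split; [constructor; auto|]. split; [auto|]. split; [auto|]. split; [auto|].
    intros q Hq. destruct (Nat.eqb_spec q i); [subst; auto|]. apply H7; lia.
  - scbn. unfold s0. scbn. split; [auto|]. split; [lia|]. split; [constructor; auto|]. 
    split; [auto|]. split; [auto|]. split; [auto|]. intros; lia.
  - lia.
  - intros s1 c (H1 & H2 & [g1 g2 g3 g4] & H4 & H5 & H6 & H7). split; [unfold cl, costN; simpl; lia|].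
    split; [constructor; auto|auto]; intros; apply H7; auto.
  - intros s1 c c' Hc (H1 & H2); split; [lia|auto].
Qed.

(** [P] is the set of pairs examined so far, a parameter so that both nested loops share the
    invariant. *)
Record gen (s : st) (P : nat -> nat -> Prop) : Prop := {
  ge_O : forall y, (y < nv s vN)%nat -> na s bO y = y;
  ge_I : forall y, (y < nv s vN)%nat -> (na s bEI y < n)%nat;
  ge_J : forall y, (y < nv s vN)%nat -> (na s bEJ y < n)%nat;
  ge_c : forall y, (y < nv s vN)%nat -> crosses X V (ts (S k) - ts k) (na s bEI y) (na s bEJ y);
  ge_U : forall y, (y < nv s vN)%nat -> ra s aEU y = etime X V (ts k) (na s bEI y) (na s bEJ y);
  ge_all : forall i j, (i < n)%nat -> (j < n)%nat -> P i j -> crosses X V (ts (S k) - ts k) i j ->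
    exists y, (y < nv s vN)%nat /\ na s bEI y = i /\ na s bEJ y = j }.

Lemma gen_body_wp s P i j : slabst s -> rv s rh = ts (S k) - ts k -> gen s P ->
  nv s vi = i -> nv s vj = j -> (i < n)%nat -> (j < n)%nat -> (nv s vN < B)%nat ->
  wp B gen_body (fun s' c => (c <= 160)%nat /\ (nv s' vN <= nv s vN + 1)%nat /\
    gen s' (fun a b => P a b \/ (a = i /\ b = j))) s.
Proof using Hv Hk.
  intros [h1 h2 h3 h4] Eh G Ei Ej Hi Hj HN. destruct nB as (_ & _ & HnB).
  assert (Fin : forall s1 c, frame gen_body s s1 -> (forall a r, na s1 a r = na s a r) ->
     (forall r, ra s1 aEU r = ra s aEU r) -> nv s1 vN = nv s vN ->
     rv s1 ru = etime X V (ts k) i j -> crosses X V (ts (S k) - ts k) i j -> (c <= 100)%nat ->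
     wp B (Seq (RSet aEU (NVar vN) (RVar ru))
    (Seq (NSet bEI (NVar vN) (NVar vi))
    (Seq (NSet bEJ (NVar vN) (NVar vj))
    (Seq (NSet bO (NVar vN) (NVar vN))
         (NAsn vN (NAdd (NVar vN) (NCst 1)))))))
     (fun s' c' => (c + c' <= 160)%nat /\ (nv s' vN <= nv s vN + 1)%nat /\
       gen s' (fun a b => P a b \/ (a = i /\ b = j))) s1).
  { intros s1 c F E1 E2 E3 E4 Hc Hcc.
    assert (Ei1 : nv s1 vi = i) by unch.
    assert (Ej1 : nv s1 vj = j) by unch.
    wstep. wstep. { sides. } wstep. wstep. { sides. } wstep. wstep. { sides. }
    wstep. wstep. { sides. } wstep. { sides. }
    split; [lia|]. split; [lia|].
    rewrite Ei1, Ej1, E3, E4.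
    destruct G as [g1 g2 g3 g4 g5 g6]; constructor;
      cbn [nv rv na ra setn setr setna setra Nat.eqb];
      [intros y Hy; destruct (Nat.eqb_spec y (nv s vN)); subst; rewrite ?E1, ?E2; auto; apply g1 ||
        apply g2 || apply g3 || apply g4 || apply g5; lia..|].
    intros a b Ha Hb [HP|[-> ->]] HC.
    - destruct (g6 a b Ha Hb HP HC) as (y & Hy & E5 & E6). exists y; split; [lia|].
      destruct (Nat.eqb_spec y (nv s vN)); [lia|]. rewrite !E1; auto.
    - exists (nv s vN). rewrite Nat.eqb_refl. split; [lia|auto]. }
  unfold gen_body. wstep. wstep. { sides. } rewrite Ei, Ej, !h3 by auto.
  wstep. wstep. { sides. } rewrite Ei, Ej, !h4 by auto.
  set (s1 := setr _ rq (V j - V i)).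
  assert (F1 : frame gen_body s s1) by (unfold s1; frame_upd (frame_refl gen_body s)).
  wstep; [auto|..].
  - unfold s1; scbn; fold s1. rewrite Eh. intros HC.
    assert (HC' : crosses X V (ts (S k) - ts k) i j).
    { unfold crosses. eapply Rle_trans; [|exact HC]. right; ring. }
    assert (Neq : V i <> V j -> etime X V (ts k) i j = ts k + (X i - X j) / (V j - V i)).
    { intros HV. unfold etime. destruct (Req_EM_T (V i) (V j)); [tauto|auto]. }
    wstep. wstep; [auto|..]; unfold s1; scbn; fold s1; intros Hq.
    + wstep; [auto|..]; unfold s1; scbn; fold s1; intros Hq'.
      * wstep; [auto|]. eapply wp_mono.
        { apply Fin with (c := 100%nat); auto.
          - unfold s1; frame_upd (frame_refl gen_body s).
          - scbn. unfold s1; scbn. unfold etime. destruct (Req_EM_T (V i) (V j)); [auto|lra]. }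
        intros s2 c2 (H1 & H2 & H3); split; [lia|auto].
      * wstep. { unfold s1; scbn. sides. } eapply wp_mono.
        { apply Fin with (c := 100%nat); auto.
          - unfold s1; frame_upd (frame_refl gen_body s).
          - scbn. unfold s1; scbn. rewrite Neq, h2 by lra. auto. }
        intros s2 c2 (H1 & H2 & H3); split; [lia|auto].
    + wstep. { unfold s1; scbn. sides. } eapply wp_mono.
        { apply Fin with (c := 100%nat); auto.
          - unfold s1; frame_upd (frame_refl gen_body s).
          - scbn. unfold s1; scbn. rewrite Neq, h2 by lra. auto. }
        intros s2 c2 (H1 & H2 & H3); split; [lia|auto].
  - unfold s1; scbn; fold s1. rewrite Eh. intros HC. wstep.
    split; [lia|]. split; [unfold s1; scbn; lia|].
    destruct G as [g1 g2 g3 g4 g5 g6]; constructor; auto.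
    intros a b Ha Hb [HP|[-> ->]] HC'; [apply g6; auto|].
    exfalso; apply HC. eapply Rle_trans; [|exact HC']. right; ring.
Qed.

Lemma gen_wp s : slabst s -> rv s rh = ts (S k) - ts k ->
  wp B gen_cmd (fun s' c => (c <= 200 * (n * n) + 50 * n + 50)%nat /\ (nv s' vN <= n * n)%nat /\
    gen s' (fun _ _ => True)) s.
Proof using Hv Hk.
  intros SL Eh. destruct nB as (HnnB & _ & HnB).
  assert (Hnn : (n * n < B)%nat) by (clear -Hn Ht; unfold B; nia).
  unfold gen_cmd. wstep. wstep; [auto|]. unfold For at 1. wstep. wstep; [auto|].
  apply wp_loop with (i0 := 0%nat) (N := n)
    (I := fun i s' c => nv s' vi = i /\ (c <= (180 * n + 40) * i)%nat /\ slabst s' /\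
       rv s' rh = ts (S k) - ts k /\ (nv s' vN <= i * n)%nat /\ gen s' (fun a _ => (a < i)%nat)).
  - reflexivity.
  - intros i s1 c (H1 & _ & H3 & _). split; [auto|]. simpl; split; auto. apply H3.
  - intros i s1 c Hi Ei (_ & Hc & SL1 & Eh1 & HN1 & G1). unfold For. wstep. wstep; [auto|].
    apply wp_loop with (i0 := 0%nat) (N := n)
      (I := fun j s' c' => nv s' vj = j /\ nv s' vi = i /\ (c' <= 172 * j)%nat /\ slabst s' /\
         rv s' rh = ts (S k) - ts k /\ (nv s' vN <= i * n + j)%nat /\
         gen s' (fun a b => (a < i \/ a = i /\ b < j))%nat).
    + reflexivity.
    + intros j s2 c2 (H1 & _ & _ & H3 & _). split; [auto|]. simpl; split; auto. apply H3.
    + intros j s2 c2 Hj Ej (_ & Ei2 & Hc2 & SL2 & Eh2 & HN2 & G2).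
      assert (HN2' : (nv s2 vN < n * n)%nat) by nia.
      apply wp_frame. eapply wp_mono; [eapply (gen_body_wp s2 _ i j); eauto; lia|].
      intros s3 c3 (Hc3 & HN3 & G3) F3. scbn.
      split; [auto|]. split; [rewrite (fr_n F3 vi eq_refl); auto|].
      split; [unfold cl, costN; simpl; lia|]. split; [|split; [|split; [lia|]]].
      * assert (SL3 : slabst s3) by (eapply slabst_frame; eauto).
        destruct SL3; constructor; auto.
      * rewrite (fr_r F3 rh eq_refl); auto.
      * destruct G3 as [g1 g2 g3 g4 g5 g6]; constructor; auto.
        intros a b Ha Hb HP HC. apply g6; auto. lia.
    + scbn. split; [auto|]. split; [auto|]. split; [lia|].
      split; [destruct SL1; constructor; auto|]. split; [auto|]. split; [lia|].
      destruct G1 as [g1 g2 g3 g4 g5 g6]; constructor; auto.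
      intros a b Ha Hb HP HC. apply g6; auto. lia.
    + lia.
    + intros s2 c2 (_ & Ei2 & Hc2 & SL2 & Eh2 & HN2 & G2). scbn.
      split; [auto|]. split; [unfold cl, costN; simpl; lia|].
      split; [destruct SL2; constructor; auto|]. split; [auto|]. split; [lia|].
      destruct G2 as [g1 g2 g3 g4 g5 g6]; constructor; auto.
      intros a b Ha Hb HP HC. apply g6; auto. lia.
    + scbn. intros s2 c2 c2' Hle (H1 & H2 & H3 & H4 & H5 & H6).
      split; [auto|]. split; [lia|auto].
  - scbn. split; [auto|]. split; [lia|]. split; [destruct SL; constructor; auto|].
    split; [auto|]. split; [lia|]. constructor; scbn; intros; lia.
  - lia.
  - intros s1 c (H1 & H2 & H3 & H4 & H5 & H6). split; [unfold cl, costN; simpl; lia|].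
    split; [auto|]. destruct H6 as [g1 g2 g3 g4 g5 g6]; constructor; auto.
  - intros s1 c c' Hle (H1 & H2); split; [lia|auto].
Qed.

(** Ties are broken by index and not by slope: lines that meet at the start of the slab have events
    there, and these correct the choice. *)
Lemma ext_wp s : slabst s ->
  wp B ext_cmd (fun s' c => (c <= 80 * n + 50)%nat /\ (nv s' vtop < n)%nat /\ (nv s' vbot < n)%nat /\
    (forall q, (q < n)%nat -> X (nv s' vbot) <= X q <= X (nv s' vtop))) s.
Proof using Hv Hk.
  intros SL. destruct nB as (_ & _ & HnB).
  unfold ext_cmd, For. wstep. wstep; [auto|]. wstep. wstep; [auto|]. wstep. wstep; [auto|].
  apply wp_loop with (i0 := 0%nat) (N := n)
    (I := fun i s' c => nv s' vs = i /\ (c <= 72 * i)%nat /\ slabst s' /\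
       (nv s' vtop < n)%nat /\ (nv s' vbot < n)%nat /\
       (forall q, (q < i)%nat -> X (nv s' vbot) <= X q <= X (nv s' vtop))).
  - reflexivity.
  - intros i s1 c (H1 & _ & H3 & _). split; [auto|]. simpl; split; auto. apply H3.
  - intros i s1 c Hi Ei (_ & Hc & SL1 & Ht1 & Hb1 & HX).
    assert (SL1' := SL1). destruct SL1 as [h1 h2 h3 h4].
    wstep. wstep. { rewrite Ei; sides. }
    1,2: rewrite Ei, !h3 by auto; intros Hx1.
    + assert (HXi : X (nv s1 vbot) <= X i -> forall q, (q < S i)%nat -> X (nv s1 vbot) <= X q <= X i).
      { intros Hbi q Hq. destruct (Nat.eq_dec q i) as [->|]; [lra|]. specialize (HX q ltac:(lia)). lra. }
      wstep; [auto|]. rewrite Ei. wstep. { rewrite Ei; sides. }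
      * rewrite Ei, !h3 by auto. intros Hx2. wstep; [auto|]. rewrite Ei.
        split; [auto|]. split; [unfold cl, costN; simpl; lia|]. split; [constructor; auto|].
        split; [auto|]. split; [auto|].
        intros q Hq. destruct (Nat.eq_dec q i) as [->|]; [lra|]. specialize (HX q ltac:(lia)). lra.
      * rewrite Ei, !h3 by auto. intros Hx2. wstep.
        split; [auto|]. split; [unfold cl, costN; simpl; lia|]. split; [constructor; auto|].
        split; [auto|]. split; [auto|]. apply HXi; lra.
    + wstep. wstep. { rewrite Ei; sides. }
      * rewrite Ei, !h3 by auto. intros Hx2. wstep; [auto|]. rewrite Ei.
        split; [auto|]. split; [unfold cl, costN; simpl; lia|]. split; [constructor; auto|].
        split; [auto|]. split; [auto|]. scbn.
        intros q Hq. destruct (Nat.eq_dec q i) as [->|]; [lra|]. specialize (HX q ltac:(lia)). lra.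
      * rewrite Ei, !h3 by auto. intros Hx2. wstep.
        split; [auto|]. split; [unfold cl, costN; simpl; lia|]. split; [constructor; auto|].
        split; [auto|]. split; [auto|]. scbn.
        intros q Hq. destruct (Nat.eq_dec q i) as [->|]; [lra|]. specialize (HX q ltac:(lia)). lra.
  - scbn. split; [auto|]. split; [lia|]. split; [destruct SL; constructor; auto|].
    split; [lia|]. split; [lia|]. intros; lia.
  - lia.
  - intros s1 c (H1 & H2 & H3 & H4 & H5 & H6). split; [unfold cl, costN; simpl; lia|auto].
  - intros s1 c c' Hle (H1 & H2); split; [lia|auto].
Qed.

(** The amortised bounds telescope, and [pot] is at most [2 * n] initially, so all flushes of the
    slab together take [O(n^2)] steps. *)
Lemma events_wp N U I J D0 s l :
  (forall y z, (y <= z < N)%nat -> U y <= U z) ->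
  (forall y, (y < N)%nat ->
    (I y < n)%nat /\ (J y < n)%nat /\ ts k <= U y <= ts (S k) /\ x (I y) (U y) = x (J y) (U y)) ->
  (forall i j, (i < n)%nat -> (j < n)%nat -> crosses X V (ts (S k) - ts k) i j ->
    exists y, (y < N)%nat /\ I y = i /\ J y = j /\ U y = etime X V (ts k) i j) ->
  (forall w a b, D0 w a b -> w <= ts k /\ (a < n)%nat /\ (b < n)%nat) ->
  sweep N U I J D0 0 s l (ts k) -> evst N U I J s -> (N <= B)%nat -> (nv s vcnt + N <= B)%nat ->
  wp B (For ve (NVar vN) event_cmd) (fun s' c => exists l' cur', sweep N U I J D0 N s' l' cur' /\
    (nv s' vcnt <= nv s vcnt + N)%nat /\ (c <= 1220 * N + F0 * (2 * n) + 20)%nat) s.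
Proof using Hv Hk.
  intros HU HEv HComp HD0 W0 E0 HN Hcnt. unfold For. wstep. wstep; [auto|].
  assert (SS : forall e s l cur v, sweep N U I J D0 e s l cur -> sweep N U I J D0 e (setn s ve v) l cur).
  { intros e s1 l1 cur v [[[h1 h2 h3 h4] d2 d3 d4 d5 d6 d7 d8 d9 d10] w2 w3 w4 w5 w6 w7 w8];
      constructor; auto. constructor; auto. constructor; auto. }
  assert (SE : forall s v, evst N U I J s -> evst N U I J (setn s ve v)).
  { intros s1 v [e1 e2 e3 e4 e5]; constructor; auto. }
  apply wp_loop with (i0 := 0%nat) (N := N)
    (I := fun e s' c => nv s' ve = e /\ evst N U I J s' /\ (nv s' vcnt <= nv s vcnt + e)%nat /\
       (c + F0 * pot s' <= 1212 * e + F0 * pot s)%nat /\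
       exists l' cur', sweep N U I J D0 e s' l' cur').
  - reflexivity.
  - intros e s1 c (H1 & [H2 _ _ _ _] & _). split; [auto|]. simpl; auto.
  - intros e s1 c He Ee (_ & ES & Hc1 & Hc & l1 & cur1 & W).
    apply wp_frame. eapply wp_mono.
    { apply (event_wp N U I J D0 HU HEv HComp HD0 e s1 l1 cur1 W ES He HN Ee); lia. }
    intros s2 c2 (l2 & cur2 & W2 & Hcnt2 & Hc2) F. scbn.
    split; [auto|]. split; [apply SE; eapply evst_frame; eauto|]. split; [lia|]. split.
    + change (pot (setn s2 ve (S e))) with (pot s2). unfold cl, costN; simpl length; lia.
    + exists l2, cur2; auto.
  - split; [auto|]. split; [auto|]. split; [scbn; lia|].
    split; [change (pot (setn s ve 0)) with (pot s); lia|]. exists l, (ts k); auto.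
  - lia.
  - intros s1 c (H1 & H2 & H3 & H4 & l1 & cur1 & W). exists l1, cur1. split; [auto|].
    split; [auto|]. unfold cl, costN. simpl length.
    assert (pot s <= 2 * n)%nat.
    { unfold pot. pose proof (above_le V (V (nv s vtop)) n).
      pose proof (above_le (fun q => - V q) (- V (nv s vbot)) n). lia. }
    assert (F0 * pot s <= F0 * (2 * n))%nat by (apply Nat.mul_le_mono_l; auto). lia.
  - intros s1 c c' Hle (l1 & cur1 & H1 & H2 & H3). exists l1, cur1. split; [auto|]. split; [auto|]. lia.
Qed.

End OneSlab.

Definition meets (k : nat) (w : R) (a b : nat) : Prop :=
  (a < n)%nat /\ (b < n)%nat /\ exists k', (k' < k)%nat /\
    crosses (SX k') (SV k') (ts (S k') - ts k') a b /\ w = etime (SX k') (SV k') (ts k') a b.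

(** At a vertex time all costs are current. [gi_cnt] makes the log fit into a block of size [B]; it
    holds because an event logs at most one switch. *)
Record ginv (k : nat) (s : st) (l : list entry) : Prop := {
  gi_input : input s;
  gi_log : vlog n tau ts ps (ts k) l;
  gi_rel : logrel (ra s aLU) (na s bLI) (na s bLJ) l;
  gi_len : length l = nv s vcnt;
  gi_cnt : (nv s vcnt <= k * (n * n))%nat;
  gi_L : forall q, (q < n)%nat -> ra s aL q = ts k;
  gi_C : forall q, (q < n)%nat -> ra s aC q = Phi n tau ts ps l q (ts k);
  gi_done : inv_done l (meets k) }.

(** One more than a bound on the merge passes for [n * n] events, and at least 2 even for [n = 1],
    so that terms without a logarithm are absorbed as well. *)
Definition LG : nat := S (S (Nat.log2 (n * n))).

Lemma slab_wp k s l : (k < tau)%nat -> ginv k s l -> nv s vk = k ->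
  wp B slab_cmd (fun s' c => (c <= 4000 * (n * n) * LG)%nat /\ exists l', ginv (S k) s' l') s.
Proof using Hv.
  intros Hk [g1 g2 g3 g4 g5 g6 g7 g8] Ek.
  pose proof (hpos k Hk) as Hh. destruct nB as (HnnB & HtB & HnB).
  pose proof (ts_le n tau ts ps Hv 0 k ltac:(lia) ltac:(lia)) as Hk0.
  assert (HcntB : (nv s vcnt + n * n <= B)%nat).
  { assert (k * (n * n) + n * n <= tau * (n * n))%nat by nia. lia. }
  unfold slab_cmd.
  wstep. call (setup_wp k Hk s g1 Ek).
  intros s1 c1 (Hc1 & SL1 & Eh1) F1. cbv beta.
  wstep. call (gen_wp k Hk s1 SL1 Eh1).
  intros s2 c2 (Hc2 & HN & G) F2. cbv beta. set (N := nv s2 vN) in *.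
  assert (SL2 : slabst k s2) by (eapply slabst_frame; eauto).
  destruct G as [o1 o2 o3 o4 o5 o6]. fold N in o1, o2, o3, o4, o5, o6.
  wstep. apply wp_frame. eapply wp_mono.
  { apply (sort_wp B N); [lia|auto|]. intros y Hy; rewrite o1 by auto; lia. }
  intros s3 c3 ((P & Hc3 & HP) & Srt & [M1 M2]) F3. cbv beta.
  assert (SL3 : slabst k s3) by (eapply slabst_frame; eauto).
  wstep. call (ext_wp k Hk s3 SL3).
  intros s4 c4 (Hc4 & Ht4 & Hb4 & HX4) F4. cbv beta.
  assert (SL4 : slabst k s4) by (eapply slabst_frame; eauto).
  assert (FC : forall q, ra s4 aC q = ra s aC q) by (intros; unch).
  assert (FL : forall q, ra s4 aL q = ra s aL q) by (intros; unch).
  assert (FLU : forall q, ra s4 aLU q = ra s aLU q) by (intros; unch).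
  assert (FLI : forall q, na s4 bLI q = na s bLI q) by (intros; unch).
  assert (FLJ : forall q, na s4 bLJ q = na s bLJ q) by (intros; unch).
  assert (Fc : nv s4 vcnt = nv s vcnt) by unch.
  assert (IN4 : input s4).
  { apply (input_frame setup_cmd s s1) in F1; auto. apply (input_frame gen_cmd s1 s2) in F2; auto.
    apply (input_frame sort_cmd s2 s3) in F3; auto. apply (input_frame ext_cmd s3 s4) in F4; auto. }
  set (O := na s3 bO). set (U := fun y => ra s2 aEU (O y)).
  set (I := fun y => na s2 bEI (O y)). set (J := fun y => na s2 bEJ (O y)).
  assert (HO : forall y, (y < N)%nat -> (O y < N)%nat).
  { intros y Hy. destruct (M1 y) as (z & Hz & E); [lia|]. fold O in E. rewrite E, o1 by lia. lia. }
  assert (HU : forall y z, (y <= z < N)%nat -> U y <= U z) by exact Srt.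
  assert (HEv : forall y, (y < N)%nat -> (I y < n)%nat /\ (J y < n)%nat /\ ts k <= U y <= ts (S k) /\
     lpos (SX k) (SV k) (ts k) (I y) (U y) = lpos (SX k) (SV k) (ts k) (J y) (U y)).
  { intros y Hy. specialize (HO y Hy). unfold U, I, J. rewrite o5 by auto.
    destruct (crossing_sound (SX k) (SV k) (ts k) (ts (S k) - ts k) _ _ Hh (o4 _ HO)) as [A1 A2].
    split; [auto|]. split; [auto|]. split; [lra|auto]. }
  assert (HComp : forall i j, (i < n)%nat -> (j < n)%nat ->
    crosses (SX k) (SV k) (ts (S k) - ts k) i j ->
    exists y, (y < N)%nat /\ I y = i /\ J y = j /\ U y = etime (SX k) (SV k) (ts k) i j).
  { intros i j Hi Hj HC. destruct (o6 i j Hi Hj Logic.I HC) as (z & Hz & E1 & E2).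
    destruct (M2 z) as (y & Hy & E); [lia|]. rewrite o1 in E by auto. fold O in E.
    exists y. unfold U, I, J. rewrite E, o5, E1, E2 by auto. split; [lia|auto]. }
  assert (HD0 : forall w a b, meets k w a b -> w <= ts k /\ (a < n)%nat /\ (b < n)%nat).
  { intros w a b (Ha & Hb & k' & Hk' & HC & ->). split; [|auto].
    assert (Hh' : 0 < ts (S k') - ts k') by (apply hpos; lia).
    destruct (crossing_sound _ _ (ts k') _ _ _ Hh' HC) as [A1 _].
    pose proof (ts_le n tau ts ps Hv (S k') k ltac:(lia) ltac:(lia)). lra. }
  assert (ES : evst N U I J s4).
  { constructor.
    - rewrite (fr_n F4 vN eq_refl), (fr_n F3 vN eq_refl); auto.
    - intros y Hy. rewrite (fr_na F4 bO eq_refl). specialize (HO y Hy). fold O. lia.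
    - intros y Hy. rewrite (fr_na F4 bO eq_refl), (fr_ra F4 aEU eq_refl),
        (fr_ra F3 aEU eq_refl); auto.
    - intros y Hy. rewrite (fr_na F4 bO eq_refl), (fr_na F4 bEI eq_refl),
        (fr_na F3 bEI eq_refl); auto.
    - intros y Hy. rewrite (fr_na F4 bO eq_refl), (fr_na F4 bEJ eq_refl),
        (fr_na F3 bEJ eq_refl); auto. }
  assert (P0 : forall q, lpos (SX k) (SV k) (ts k) q (ts k) = SX k q) by (intros; unfold lpos; ring).
  assert (W : sweep k N U I J (meets k) 0 s4 l (ts k)).
  { constructor.
    - constructor; auto.
      + lra.
      + eapply logrel_ext; [| | |exact g3]; auto.
      + lia.
      + intros q Hq. rewrite FL, g6 by auto. lra.
      + intros q Hq t Htt. rewrite FL, FC in *. rewrite g6, g7 in * by auto.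
        apply (Phi_advance n tau ts ps Hv (ts k)); auto; lra.
      + intros q Hq r t Hr Htt. rewrite FL, g6 in Htt by auto. replace t with (ts k) by lra.
        rewrite !P0. auto.
    - intros; lia.
    - intros y Hy. apply HEv; lia.
    - intros q Hq. rewrite !P0. apply HX4; auto.
    - intros; lia.
    - intros q Hq. rewrite !P0. apply HX4; auto.
    - intros; lia.
    - intros w a b t [HD|(y & Hy & _)]; [|lia]. apply g8; auto. }
  wstep. apply wp_frame. eapply wp_mono.
  { apply (events_wp k Hk N U I J (meets k) s4 l HU HEv HComp HD0 W ES); lia. }
  intros s5 c5 (l5 & cur5 & W5 & Hcnt5 & Hc5) F5. cbv beta.
  assert (IN5 : input s5) by (eapply input_frame; eauto).
  assert (Ek5 : nv s5 vk = k) by unch.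
  wstep. wstep.
  { rewrite Ek5. assert (tau + 1 < B)%nat by (pose proof tauB; lia). sides. }
  rewrite Ek5, (in_ts _ IN5), Nat.add_1_r by lia.
  set (s6 := setr s5 ru (ts (S k))).
  assert (D6 : dp k s6 l5 (rv s6 ru)).
  { change (rv s6 ru) with (ts (S k)).
    assert (Hcur := dp_cur _ _ _ _ (sw_dp _ _ _ _ _ _ _ _ _ _ W5)).
    (* No event is left, so the envelope lines stay valid up to the end of the slab. *)
    assert (D5 : dp k s5 l5 (ts (S k))).
    { eapply dp_advance; [apply W5|lra|lra|].
      eapply (sweep_env k N U I J (meets k)); eauto; try lra. intros; lia. }
    destruct D5 as [[h1 h2 h3 h4] d2 d3 d4 d5 d6 d7 d8 d9 d10]; constructor; auto.
    constructor; auto. }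
  call (flush_dp k Hk s6 l5 D6).
  intros s7 c7 (Hc7 & D7 & L7) F7.
  assert (Eu7 : rv s7 ru = ts (S k)) by unch.
  rewrite Eu7 in *. split.
  - assert (HLG : (P <= LG - 1)%nat).
    { unfold LG. destruct HP as [->|HP]; [lia|].
      assert (2 ^ (P - 1) <= n * n)%nat by lia.
      apply Nat.log2_le_pow2 in H; [lia|]. clear -Hn; nia. }
    assert (HLG1 : (2 <= LG)%nat) by (unfold LG; lia).
    assert (A1 : (200 * (N + 1) * (P + 1) <= 200 * (n * n + 1) * LG)%nat).
    { apply Nat.mul_le_mono; lia. }
    assert (A2 : (n <= n * n)%nat) by (clear -Hn; nia).
    assert (A3 : (1 <= n * n)%nat) by (clear -Hn; nia).
    assert (A4 : (LG <= (n * n) * LG)%nat) by (clear -A3; nia).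
    assert (A5 : (n * n <= (n * n) * LG)%nat) by (clear -HLG1; nia).
    lia.
  - exists l5. destruct D7 as [[h1 h2 h3 h4] d2 d3 d4 d5 d6 d7 d8 d9 d10].
    constructor; auto.
    + assert (input s6) by (destruct IN5; constructor; auto). eapply input_frame; eauto.
    + rewrite (fr_n F7 vcnt eq_refl). change (nv s6 vcnt) with (nv s5 vcnt). lia.
    + intros q Hq. rewrite (d9 q Hq) by (rewrite L7 by auto; lra).
      rewrite L7 by auto. rewrite Ic_refl. ring.
    + intros w a b t (Ha & Hb & k' & Hk' & HC & Ew) Hw Htt Heq.
      apply (sw_done _ _ _ _ _ _ _ _ _ _ W5 w a b t); auto.
      destruct (Nat.eq_dec k' k) as [->|Hne].
      (* A meeting in this slab is one of its events; the earlier ones are [meets k], which was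
         passed for [D0]. *)
      * right. destruct (HComp a b Ha Hb HC) as (y & Hy & E1 & E2 & E3).
        exists y. rewrite Ew. auto.
      * left. split; [auto|]. split; [auto|]. exists k'. split; [lia|auto].
Qed.

End Slab.

(** * The whole algorithm *)

(** Cells 2 to 63 are in [aINP] already, so copying starts at 64. The limit lies 61 cells past the
    input, among zeros, and is thus never below the start. *)
Definition copyin_cmd : cmd :=
  Seq (NAsn vx (NCst 64))
    (Loop vx (NAdd (NAdd (NCst 64) (NVar vtau)) (NMul (NVar vn) (NAdd (NVar vtau) (NCst 1))))
      (RSet aINP (NSub (NVar vx) (NCst 2)) (gX aLOW vx))).

Definition init_cmd : cmd :=
  For vs (NVar vn) (Seq (RSet aC (NVar vs) (RCst 0)) (RSet aL (NVar vs) (RGet aINP (NCst 0)))).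

Definition best_cmd : cmd :=
  Seq (NAsn vcur (NCst 0))
    (For vs (NVar vn) (If (RLe (gX aC vs) (gX aC vcur)) (NAsn vcur (NVar vs)) Skip)).

Definition emit_cmd : cmd :=
  Seq (NSet bTE (NVar vm) (NVar vcur))
  (Seq (RSet aTT (NVar vm) (RVar rend))
       (NAsn vm (NAdd (NVar vm) (NCst 1)))).

(** One unfolding of [pcs], on the newest entry not yet read; equality of entities is tested by two
    comparisons. *)
Definition back_body : cmd :=
  Seq (NAsn ve (NSub (NVar ve) (NCst 1)))
  (If (NLe (NGet bLJ (NVar ve)) (NVar vcur))
    (If (NLe (NVar vcur) (NGet bLJ (NVar ve)))
      (Seq emit_cmd
      (Seq (RAsn rend (gX aLU ve))
           (NAsn vcur (NGet bLI (NVar ve)))))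
      Skip)
    Skip).

Definition back_cmd : cmd :=
  Seq (NAsn vm (NCst 0))
  (Seq (RAsn rend (gX aINP vtau))
  (Seq (NAsn ve (NVar vcnt))
  (Seq (Until (NLe (NVar ve) (NCst 0)) back_body)
       emit_cmd))).

Definition out_cmd : cmd :=
  Seq (RSet aOUT (NCst 0) (RNat (NVar vm)))
  (For vi (NVar vm)
    (Seq (NAsn vx (NSub (NSub (NVar vm) (NCst 1)) (NVar vi)))
    (Seq (RSet aOUT (NAdd (NCst 1) (NMul (NCst 2) (NVar vi))) (RNat (NGet bTE (NVar vx))))
         (RSet aOUT (NAdd (NCst 2) (NMul (NCst 2) (NVar vi))) (gX aTT vx))))).

(** Cells below 64 are registers to the very end and are filled by the postlude. The rest of the
    output may overwrite the input, which has been copied. *)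
Definition copyout_cmd : cmd :=
  Seq (NAsn vx (NCst 64))
    (Loop vx (NAdd (NCst 64) (NMul (NCst 2) (NVar vm))) (RSet aLOW (NVar vx) (gX aOUT vx))).

Definition main_cmd : cmd :=
  Seq copyin_cmd (Seq init_cmd (Seq (For vk (NVar vtau) slab_cmd)
  (Seq best_cmd (Seq back_cmd (Seq out_cmd copyout_cmd))))).

Section Main.
Variables (n tau : nat) (ts : nat -> R) (ps : nat -> nat -> R).
Hypothesis Hv : valid_input n tau ts ps.
Let B : nat := (128 * (tau * (n * n)))%nat.
Let S2 : nat := (tau * (n * n))%nat.

Let Hn : (1 <= n)%nat := proj1 Hv.
Let Ht : (1 <= tau)%nat := proj1 (proj2 Hv).

Local Lemma sizes : (1 <= S2 /\ tau <= S2 /\ n <= S2 /\ n * tau <= S2 /\ B = 128 * S2)%nat.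
Proof using Hv.
  clear -Hn Ht. unfold B, S2. assert (n <= n * n)%nat by nia.
  assert (n * tau <= n * n * tau)%nat by (apply Nat.mul_le_mono_r; auto).
  repeat split; nia.
Qed.

Lemma copyin_wp : wp B copyin_cmd (fun s c => (c <= 200 * S2 + 100)%nat /\
   input n tau ts ps s) (start n tau ts ps).
Proof using Hv.
  destruct sizes as (z1 & z2 & z3 & z4 & z5).
  set (s0 := start n tau ts ps). set (e := (64 + tau + n * (tau + 1))%nat).
  assert (He : (e <= 67 * S2)%nat) by (unfold e; lia).
  unfold copyin_cmd. wstep. wstep; [auto|].
  apply wp_loop with (i0 := 64%nat) (N := e)
    (I := fun i s c => nv s vx = i /\ nv s vn = n /\ nv s vtau = tau /\ (64 <= i)%nat /\
       (c <= 50 * (i - 64))%nat /\ (forall r, ra s aLOW r = init_mem n tau ts ps r) /\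
       forall r, (r + 2 < i)%nat -> ra s aINP r = init_mem n tau ts ps (r + 2)).
  - reflexivity.
  - intros i s c (H1 & H2 & H3 & _). scbn. rewrite H2, H3. repeat split; auto.
  - intros i s c Hi Ei (_ & H2 & H3 & H4 & H5 & H6 & H7). wstep.
    { rewrite Ei. unfold rix, KR. repeat split; auto; try lia; discriminate. }
    rewrite Ei, H6. repeat split; auto.
    + unfold cl, costN; simpl; lia.
    + intros r Hr. destruct (Nat.eqb_spec r (i - 2)); [f_equal; lia|]. apply H7; lia.
  - scbn. repeat split; auto; try lia. intros r Hr. cbn [ra start s0].
    destruct (Nat.ltb_spec r 62); [auto|lia].
  - unfold e; lia.
  - intros s c (H1 & H2 & H3 & H4 & H5 & H6 & H7). split; [unfold cl, costN; simpl; lia|].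
    constructor; auto.
    + intros q Hq. rewrite H7 by (unfold e; lia). unfold init_mem.
      replace (q + 2)%nat with (S (S q)) by lia. cbn [Nat.eqb].
      destruct (Nat.ltb_spec (S (S q)) (3 + tau)); [f_equal; lia|lia].
    + intros q r Hq Hr.
      assert (Hb : (q * (tau + 1) + r < n * (tau + 1))%nat) by nia.
      rewrite H7 by (unfold e; lia). unfold init_mem.
      set (y := (q * (tau + 1) + r)%nat) in *.
      replace (1 + tau + q * (tau + 1) + r + 2)%nat with (3 + tau + y)%nat by (unfold y; lia).
      destruct (Nat.eqb_spec (3 + tau + y) 0); [lia|].
      destruct (Nat.eqb_spec (3 + tau + y) 1); [lia|].
      destruct (Nat.ltb_spec (3 + tau + y) (3 + tau)); [lia|].
      destruct (Nat.ltb_spec (3 + tau + y) (3 + tau + n * (tau + 1))); [|lia].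
      replace (3 + tau + y - (3 + tau))%nat with y by lia.
      assert (y / (tau + 1) = q)%nat.
      { symmetry; apply (Nat.div_unique y (tau + 1) q r); unfold y; lia. }
      assert (y mod (tau + 1) = r)%nat.
      { symmetry; apply (Nat.mod_unique y (tau + 1) q r); unfold y; lia. }
      congruence.
  - intros s c c' Hc (H1 & H2); split; [lia|auto].
Qed.

Lemma init_wp s : input n tau ts ps s ->
  wp B init_cmd (fun s' c => (c <= 50 * n + 50)%nat /\ input n tau ts ps s' /\
    forall q, (q < n)%nat -> ra s' aC q = 0 /\ ra s' aL q = ts 0%nat) s.
Proof using Hv.
  intros IN. destruct sizes as (z1 & z2 & z3 & z4 & z5).
  unfold init_cmd, For. wstep. wstep; [auto|].
  apply wp_loop with (i0 := 0%nat) (N := n)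
    (I := fun i s' c => nv s' vs = i /\ (c <= 50 * i)%nat /\ input n tau ts ps s' /\
      forall q, (q < i)%nat -> ra s' aC q = 0 /\ ra s' aL q = ts 0%nat).
  - reflexivity.
  - intros i s1 c (H1 & _ & [H2 _ _ _] & _). split; [auto|]. simpl; auto.
  - intros i s1 c Hi Ei (_ & Hc & [h1 h2 h3 h4] & HC).
    wstep. wstep. { rewrite Ei; sides. } wstep. { rewrite Ei; sides. }
    rewrite Ei, h3 by lia. split; [auto|]. split; [unfold cl, costN; simpl; lia|].
    split; [constructor; auto|]. intros q Hq.
    destruct (Nat.eqb_spec q i); [auto|]. apply HC; lia.
  - scbn. split; [auto|]. split; [lia|]. split; [destruct IN; constructor; auto|]. intros; lia.
  - lia.
  - intros s1 c (H1 & H2 & H3 & H4). split; [unfold cl, costN; simpl; lia|auto].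
  - intros s1 c c' Hc (H1 & H2); split; [lia|auto].
Qed.

Lemma slabs_wp s l : ginv n tau ts ps 0 s l ->
  wp B (For vk (NVar vtau) slab_cmd) (fun s' c =>
    (c <= (4000 * (n * n) * LG n + 12) * tau + 20)%nat /\ exists l', ginv n tau ts ps tau s' l') s.
Proof using Hv.
  intros G. unfold For. wstep. wstep; [auto|].
  assert (SG : forall k s l v, ginv n tau ts ps k s l -> ginv n tau ts ps k (setn s vk v) l).
  { intros k s1 l1 v [[h1 h2 h3 h4] g2 g3 g4 g5 g6 g7 g8]; constructor; auto. constructor; auto. }
  apply wp_loop with (i0 := 0%nat) (N := tau)
    (I := fun k s' c => nv s' vk = k /\ (c <= (4000 * (n * n) * LG n + 12) * k)%nat /\
      exists l', ginv n tau ts ps k s' l').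
  - reflexivity.
  - intros k s1 c (H1 & _ & l1 & [[h1 h2 h3 h4] _ _ _ _ _ _ _]). split; [auto|]. simpl; auto.
  - intros k s1 c Hk Ek (_ & Hc & l1 & G1).
    eapply wp_mono; [apply (slab_wp n tau ts ps Hv k s1 l1 Hk G1 Ek)|].
    intros s2 c2 (Hc2 & l2 & G2). scbn. split; [auto|]. split; [|eauto].
    unfold cl, costN. simpl length. rewrite Nat.mul_succ_r. lia.
  - scbn. split; [auto|]. split; [lia|eauto].
  - lia.
  - intros s1 c (H1 & H2 & H3). split; [unfold cl, costN; simpl length; lia|auto].
  - intros s1 c c' Hc (H1 & H2); split; [lia|auto].
Qed.

Lemma best_wp s : nv s vn = n ->
  wp B best_cmd (fun s' c => (c <= 60 * n + 60)%nat /\ (nv s' vcur < n)%nat /\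
    forall q, (q < n)%nat -> ra s aC (nv s' vcur) <= ra s aC q) s.
Proof using Hv.
  intros En. destruct sizes as (z1 & z2 & z3 & z4 & z5).
  unfold best_cmd, For. wstep. wstep; [auto|]. wstep. wstep; [auto|].
  apply wp_loop with (i0 := 0%nat) (N := n)
    (I := fun i s' c => nv s' vs = i /\ nv s' vn = n /\ (c <= 60 * i)%nat /\ (nv s' vcur < n)%nat /\
      (forall q, ra s' aC q = ra s aC q) /\
      forall q, (q < i)%nat -> ra s aC (nv s' vcur) <= ra s aC q).
  - reflexivity.
  - intros i s1 c (H1 & H2 & _). split; [auto|]. simpl; auto.
  - intros i s1 c Hi Ei (_ & H2 & H3 & H4 & H5 & H6). wstep. { rewrite Ei; sides. }
    + rewrite Ei, !H5. intros Hle. wstep; [auto|]. rewrite Ei.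
      repeat split; auto; [unfold cl, costN; simpl; lia|].
      intros q Hq. destruct (Nat.eq_dec q i) as [->|]; [lra|]. specialize (H6 q ltac:(lia)). lra.
    + rewrite Ei, !H5. intros Hgt. wstep.
      repeat split; auto; [unfold cl, costN; simpl; lia|].
      scbn. intros q Hq. destruct (Nat.eq_dec q i) as [->|]; [lra|]. apply H6; lia.
  - scbn. repeat split; auto; intros; lia.
  - lia.
  - intros s1 c (H1 & H2 & H3 & H4 & H5 & H6). split; [unfold cl, costN; simpl; lia|auto].
  - intros s1 c c' Hc (H1 & H2); split; [lia|auto].
Qed.

Lemma back_wp s l : (nv s vtau < B)%nat -> (length l + 1 < B)%nat -> nv s vcnt = length l ->
  logrel (ra s aLU) (na s bLI) (na s bLJ) l ->
  let P := pcs l (nv s vcur) (ra s aINP (nv s vtau)) in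
  wp B back_cmd (fun s' c => (c <= 100 * length l + 100)%nat /\ nv s' vm = length P /\
    forall i, (i < length P)%nat -> nth i P (0%nat, 0) = (na s' bTE i, ra s' aTT i)) s.
Proof.
  intros Htau Hl Ec LR P. unfold back_cmd.
  wstep. wstep; [auto|]. wstep. wstep. { sides. } wstep. wstep; [auto|]. rewrite Ec.
  wstep.
  (* [done] has been written out and [l'] is the part of the log still to be read; [ve] is its
     length, hence one past the index of its newest entry. *)
  apply wp_until with (kb := 3%nat)
    (I := fun s' c => exists done l', P = done ++ pcs l' (nv s' vcur) (rv s' rend) /\
      logrel (ra s' aLU) (na s' bLI) (na s' bLJ) l' /\ nv s' ve = length l' /\
      (length done + length l' <= length l)%nat /\ nv s' vm = length done /\
      (c + 80 * length l' <= 80 * length l)%nat /\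
      forall i, (i < length done)%nat -> nth i done (0%nat, 0) = (na s' bTE i, ra s' aTT i))
    (mu := fun s' => nv s' ve).
  - reflexivity.
  - intros s1 c (done & l' & EP & LR1 & Ee & Hlen & Em & Hc & HD). scbn.
    split; [auto|]. split.
    + intros He. assert (l' = []) as -> by (destruct l'; simpl in *; [auto|lia]).
      cbn [pcs] in EP. unfold emit_cmd.
      wstep. wstep. { sides. } wstep. wstep. { sides. } wstep; [auto|].
      rewrite Em, EP, length_app. simpl length in *. split; [lia|]. split; [auto|].
      intros i Hi. destruct (Nat.eqb_spec i (length done)) as [->|Hne].
      * rewrite app_nth2, Nat.sub_diag by lia. reflexivity.
      * rewrite app_nth1 by lia. apply HD; lia.
    + intros He. destruct l' as [|[[u a] b] l']; [simpl in *; lia|].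
      cbn [logrel] in LR1. destruct LR1 as (R1 & R2 & R3 & LR1). cbn [length] in *.
      unfold back_body. wstep. wstep. { sides. }
      replace (nv s1 ve - 1)%nat with (length l') by lia.
      cbn [pcs] in EP.
      wstep. { sides. }
      * rewrite R3. intros H1. wstep. { sides. }
        { rewrite R3. intros H2. assert (E : nv s1 vcur = b) by lia.
          rewrite E, Nat.eqb_refl in EP. unfold emit_cmd.
          wstep. wstep. wstep. { sides. } wstep. wstep. { sides. } wstep; [auto|].
          wstep. wstep. { sides. } wstep. { sides. } rewrite R1, R2, Em, E. split; [|lia].
          exists (done ++ [(b, rv s1 rend)]), l'. scbn. rewrite length_app. simpl length.
          split; [rewrite EP, <- app_assoc; reflexivity|]. split; [auto|]. split; [auto|].
          split; [lia|]. split; [auto|]. split; [lia|].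
          intros i Hi. destruct (Nat.eqb_spec i (length done)) as [->|Hne].
          - rewrite app_nth2, Nat.sub_diag by lia. reflexivity.
          - rewrite app_nth1 by lia. apply HD; lia. }
        { rewrite R3. intros H2. wstep. split; [|scbn; lia].
          destruct (Nat.eqb_spec (nv s1 vcur) b) as [E|E] in EP; [lia|].
          exists done, l'. scbn. repeat split; auto; lia. }
      * rewrite R3. intros H1. wstep. split; [|scbn; lia].
        destruct (Nat.eqb_spec (nv s1 vcur) b) as [E|E] in EP; [lia|].
        exists done, l'. scbn. repeat split; auto; lia.
  - exists [], l. scbn. repeat split; auto; simpl; try lia.
Qed.

Lemma out_wp s m : nv s vm = m -> (3 + 2 * m < B)%nat -> (1 <= m)%nat ->
  wp B out_cmd (fun s' c => (c <= 100 * m + 100)%nat /\ ra s' aOUT 0%nat = INR m /\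
    forall i, (i < m)%nat -> ra s' aOUT (1 + 2 * i)%nat = INR (na s bTE (m - 1 - i)%nat) /\
      ra s' aOUT (2 + 2 * i)%nat = ra s aTT (m - 1 - i)%nat) s.
Proof.
  intros Em HB H1m. unfold out_cmd, For. wstep. wstep. { sides. } wstep. wstep; [auto|].
  apply wp_loop with (i0 := 0%nat) (N := m)
    (I := fun i s' c => nv s' vi = i /\ nv s' vm = m /\ (c <= 100 * i)%nat /\
      ra s' aOUT 0%nat = INR m /\ (forall r, na s' bTE r = na s bTE r) /\
      (forall r, ra s' aTT r = ra s aTT r) /\
      forall r, (r < i)%nat -> ra s' aOUT (1 + 2 * r)%nat = INR (na s bTE (m - 1 - r)%nat) /\
      ra s' aOUT (2 + 2 * r)%nat = ra s aTT (m - 1 - r)%nat).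
  - reflexivity.
  - intros i s1 c (H1 & H2 & _). split; [auto|]. simpl; auto.
  - intros i s1 c Hi Ei (_ & H2 & H3 & H4 & H5 & H6 & H7).
    wstep. wstep. { sides. } rewrite H2, Ei.
    wstep. wstep. { rewrite Ei; sides. } rewrite Ei, H5.
    wstep. { rewrite Ei; sides. } rewrite Ei, H6.
    split; [auto|]. split; [auto|]. split; [unfold cl, costN; simpl; lia|].
    split; [|split; [auto|split; [auto|]]].
    + replace (1 + 2 * i)%nat with (S (2 * i)) by lia. exact H4.
    + intros r Hr.
      destruct (Nat.eqb_spec (1 + 2 * r) (2 + 2 * i)); [lia|].
      destruct (Nat.eqb_spec (2 + 2 * r) (1 + 2 * i)); [lia|].
      destruct (Nat.eqb_spec (1 + 2 * r) (1 + 2 * i)), (Nat.eqb_spec (2 + 2 * r) (2 + 2 * i));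
        try lia.
      * replace r with i by lia. auto.
      * apply H7; lia.
  - scbn. rewrite Em. repeat split; auto; intros; lia.
  - lia.
  - intros s1 c (H1 & H2 & H3 & H4 & H5 & H6 & H7). split; [unfold cl, costN; simpl; lia|auto].
  - intros s1 c c' Hc (H1 & H2); split; [lia|auto].
Qed.

Lemma copyout_wp s m : nv s vm = m -> (64 + 2 * m <= B)%nat ->
  wp B copyout_cmd (fun s' c => (c <= 100 * m + 100)%nat /\
    (forall r, ra s' aOUT r = ra s aOUT r) /\
    forall r, (64 <= r < 64 + 2 * m)%nat -> ra s' aLOW r = ra s aOUT r) s.
Proof.
  intros Em HB. unfold copyout_cmd. wstep. wstep; [auto|].
  apply wp_loop with (i0 := 64%nat) (N := (64 + 2 * m)%nat)
    (I := fun i s' c => nv s' vx = i /\ nv s' vm = m /\ (64 <= i)%nat /\ (c <= 40 * (i - 64))%nat /\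
      (forall r, ra s' aOUT r = ra s aOUT r) /\
      forall r, (64 <= r < i)%nat -> ra s' aLOW r = ra s aOUT r).
  - reflexivity.
  - intros i s1 c (H1 & H2 & _). scbn. rewrite H2. auto.
  - intros i s1 c Hi Ei (_ & H2 & H3 & H4 & H5 & H6).
    wstep. { rewrite Ei; unfold rix, KR. repeat split; auto; try lia; discriminate. }
    rewrite Ei, H5. repeat split; auto; [unfold cl, costN; simpl; lia|].
    intros r Hr. destruct (Nat.eqb_spec r i); [subst; auto|]. apply H6; lia.
  - scbn. repeat split; auto; try lia.
  - lia.
  - intros s1 c (H1 & H2 & H3 & H4 & H5 & H6). split; [unfold cl, costN; simpl; lia|auto].
  - intros s1 c c' Hc (H1 & H2); split; [lia|auto].
Qed.

(** The low memory after the postlude, which moves 64 entries of [aOUT] down over the registers. *)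
Definition low_view (s : st) (r : nat) : R := if Nat.ltb r 64 then ra s aOUT r else ra s aLOW r.

Lemma main_wp : wp B main_cmd (fun s c => (c <= 4690 * (tau * (n * n)) * LG n)%nat /\
  forall M, (forall r, (r < B)%nat -> M r = low_view s r) -> output_central n tau ts ps M)
  (start n tau ts ps).
Proof using Hv.
  destruct sizes as (z1 & z2 & z3 & z4 & z5).
  unfold main_cmd. wstep. apply wp_frame. eapply wp_mono; [apply copyin_wp|].
  intros s1 c1 (Hc1 & IN1) F1. cbv beta.
  wstep. call (init_wp s1 IN1).
  intros s2 c2 (Hc2 & IN2 & CL2) F2. cbv beta.
  assert (Ec2 : nv s2 vcnt = 0%nat).
  { rewrite (fr_n F2 vcnt eq_refl), (fr_n F1 vcnt eq_refl). reflexivity. }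
  assert (G0 : ginv n tau ts ps 0 s2 []).
  { constructor; simpl; auto; try lia.
    - intros; apply CL2; auto.
    - intros q Hq. rewrite Ic_refl. apply CL2; auto.
    - intros w a b t (_ & _ & k' & Hk' & _). lia. }
  wstep. eapply wp_mono; [apply (slabs_wp s2 [] G0)|].
  intros s3 c3 (Hc3 & l & [g1 g2 g3 g4 g5 g6 g7 g8]). cbv beta.
  wstep. apply wp_frame. eapply wp_mono; [apply (best_wp s3); apply g1|].
  intros s4 c4 (Hc4 & Hcur & Hmin) F4. cbv beta.
  assert (IN4 : input n tau ts ps s4) by (eapply input_frame; eauto).
  assert (Hl : (length l <= S2)%nat) by (unfold S2; lia).
  wstep. apply wp_frame. eapply wp_mono.
  { apply (back_wp s4 l).
    - rewrite (in_tau _ _ _ _ _ IN4). lia.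
    - lia.
    - rewrite (fr_n F4 vcnt eq_refl); auto.
    - eapply logrel_ext; [| | |exact g3]; intros.
      + apply (fr_ra F4 aLU eq_refl).
      + apply (fr_na F4 bLI eq_refl).
      + apply (fr_na F4 bLJ eq_refl). }
  intros s5 c5. rewrite (in_tau _ _ _ _ _ IN4), (in_ts _ _ _ _ _ IN4) by lia.
  set (best := nv s4 vcur) in *. set (P := pcs l best (ts tau)). intros (Hc5 & Em & HP) F5. cbv beta.
  assert (HlP : (1 <= length P <= S (length l))%nat).
  { split; [|apply pcs_length]. unfold P. destruct (pcs_head l best (ts tau)) as (Q & ->). simpl; lia. }
  wstep. apply wp_frame. eapply wp_mono; [apply (out_wp s5 (length P) Em); lia|].
  intros s6 c6 (Hc6 & O0 & OP) F6. cbv beta.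
  eapply wp_mono; [apply (copyout_wp s6 (length P)); [rewrite (fr_n F6 vm eq_refl); auto|lia]|].
  intros s7 c7 (Hc7 & EO & EL). split.
  - assert (HLG : (2 <= LG n)%nat) by (unfold LG; lia).
    assert (A1 : (2 * S2 <= S2 * LG n)%nat) by (clear -HLG; nia).
    replace ((4000 * (n * n) * LG n + 12) * tau + 20)%nat
      with (4000 * (S2 * LG n) + 12 * tau + 20)%nat in Hc3 by (unfold S2; lia).
    fold S2. lia.
  - intros M HM.
    assert (EM : forall r, (r < 1 + 2 * length P)%nat -> M r = ra s6 aOUT r).
    { intros r Hr. rewrite HM by lia. unfold low_view.
      destruct (Nat.ltb_spec r 64); [apply EO | apply EL; lia]. }
    apply (output_optimal n tau ts ps Hv (ts tau) l best); auto.
    + lra.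
    + intros a b t Ha Hb Htt Hx.
      assert (EK : exists k, (k < tau)%nat /\ ts k <= t <= ts (S k)).
      { assert (HH : forall j, (j <= tau)%nat -> ts 0%nat <= t <= ts j -> (1 <= j)%nat ->
          exists k, (k < tau)%nat /\ ts k <= t <= ts (S k)).
        { induction j; intros Hj Hjt H1; [lia|].
          destruct (Rle_dec (ts j) t).
          - exists j; split; [lia|lra].
          - destruct j; [lra|]. apply IHj; try lia. lra. }
        apply (HH tau); auto. }
      destruct EK as (k & Hk & Hkt).
      rewrite !(pos_traj n tau ts ps Hv k) in Hx by auto.
      (* The meeting at [t] has its event at or before [t], and [a] and [b] have been together
         since, so the invariant on handled meetings applies. *)
      destruct (crossing_complete (SX ps k) (SV ts ps k) (ts k) (ts (S k) - ts k) a b t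
        ltac:(lra) Hx) as (HC & HE & HW & _).
      apply (g8 (etime (SX ps k) (SV ts ps k) (ts k) a b) a b t); auto; try lra.
      * split; [auto|]. split; [auto|]. exists k. auto.
      * intros v Hvv. assert (Hh : 0 < ts (S k) - ts k)
          by (pose proof (ts_lt n tau ts ps Hv k (S k) ltac:(lia) ltac:(lia)); lra).
        pose proof (crossing_sound _ _ (ts k) _ _ _ Hh HC) as [HB1 _].
        rewrite !(pos_traj n tau ts ps Hv k) by (auto; lra). apply HW; auto.
    + intros q Hq. rewrite <- !g7 by auto. auto.
    + fold P. split.
      * rewrite EM by lia. auto.
      * intros i Hi. rewrite !EM by lia. destruct (OP i Hi) as [-> ->].
        rewrite HP by lia. auto.
Qed.

End Main.

(** From [2 ^ a <= n * n] follows [a * ln 2 <= 2 * ln n], and [ln 2 > 1/2] turns this into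
    [a <= 4 * ln n]. *)
Lemma LG_le n : (1 <= n)%nat -> INR (LG n) <= 4 * (1 + ln (INR n)).
Proof.
  intros Hn. unfold LG. rewrite !S_INR. set (a := Nat.log2 (n * n)).
  assert (Hn' : 1 <= INR n) by (apply (le_INR 1); auto).
  assert (Hln : 0 <= ln (INR n)) by (rewrite <- ln_1; apply ln_le; lra).
  assert (H : (2 ^ a <= n * n)%nat) by (apply Nat.log2_spec; nia).
  apply le_INR in H. rewrite pow_INR, mult_INR in H. simpl (INR 2) in H.
  assert (H2 : INR a * ln 2 <= 2 * ln (INR n)).
  { apply ln_le in H; [|apply pow_lt; lra]. rewrite ln_mult, ln_pow in H by lra.
    replace (1 + 1) with 2 in H by ring. lra. }
  pose proof ln_lt_2. pose proof (pos_INR a). nra.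
Qed.

(** Program and constant precede the input, so the algorithm is uniform. The factor is [1 + ln n]
    because [ln 1 = 0], while a single entity still requires a positive number of steps. *)
Theorem mainTheorem18 :
  exists (p : list instr) (c : R), 0 < c /\
    forall (n tau : nat) (ts : nat -> R) (ps : nat -> nat -> R),
      valid_input n tau ts ps ->
      exists (k sp pc : nat) (M : nat -> R),
        run sp p k (O, init_mem n tau ts ps) (pc, M) /\
        nth_error p pc = Some IHalt /\
        INR k <= c * INR tau * INR n ^ 2 * (1 + ln (INR n)) /\
        INR sp <= c * INR tau * INR n ^ 2 /\
        output_central n tau ts ps M.
Proof.
  (* Time requires [4 * 4900 = 19600] and space [17 * 128 = 2176]. *)
  exists (program main_cmd), 20000. split; [lra|]. intros n tau ts ps Hv.
  assert (Hn : (1 <= n)%nat) by apply Hv. assert (Ht : (1 <= tau)%nat) by apply Hv.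
  destruct (main_wp n tau ts ps Hv) as (k & s & E & Hk & HM).
  destruct (program_run n tau ts ps main_cmd k s Hn Ht eq_refl E) as (pc & M & R & Hh & M1 & M2).
  eexists _, _, pc, M. split; [exact R|]. split; [exact Hh|].
  assert (HS : (1 <= tau * (n * n))%nat) by nia.
  assert (HSr : INR (tau * (n * n)) = INR tau * INR n ^ 2) by (rewrite !mult_INR; ring).
  split; [|split].
  - assert (HL : (2 <= LG n)%nat) by (unfold LG; lia).
    (* The prelude and postlude take 205 and 190 steps; as [tau * (n * n) * LG n] is at least 2,
       they fit between the factors 4690 and 4900. *)
    assert (A : (length prelude + (k + 190) <= 4900 * ((tau * (n * n)) * LG n))%nat).
    { change (length prelude) with 205%nat.
      assert (1 * 2 <= tau * (n * n) * LG n)%nat by (apply Nat.mul_le_mono; auto). lia. }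
    apply le_INR in A. eapply Rle_trans; [exact A|].
    rewrite mult_INR, (mult_INR (tau * (n * n))), HSr.
    replace (INR 4900) with 4900 by (rewrite INR_IZR_INZ; reflexivity).
    pose proof (LG_le n Hn) as HL'.
    assert (0 <= INR tau * INR n ^ 2) by (rewrite <- HSr; apply pos_INR).
    assert (INR tau * INR n ^ 2 * INR (LG n) <= INR tau * INR n ^ 2 * (4 * (1 + ln (INR n))))
      by (apply Rmult_le_compat_l; auto).
    assert (0 <= INR (LG n)) by apply pos_INR. nra.
  - change (RS + NS)%nat with 17%nat. rewrite Nat.mul_assoc, mult_INR, HSr.
    replace (INR (17 * 128)) with 2176 by (rewrite INR_IZR_INZ; reflexivity).
    assert (0 <= INR tau * INR n ^ 2) by (rewrite <- HSr; apply pos_INR). nra.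
  - apply HM. intros r Hr. unfold low_view. unfold KR in *.
    destruct (Nat.ltb_spec r 64); [apply M1; auto | apply M2; lia].
Qed.
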